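(* Suppose that a function $f(x)=f_{Kr}(x)$ with parameters $(\alpha,\beta,\gamma,\lambda)\in\mathbb{C}^4$ satisfies the equation \[ \frac1{f(x_2-x_1)f(x_3-x_1)}+\frac1{f(x_1-x_2)f(x_3-x_2)}+\frac1{f(x_1-x_3)f(x_2-x_3)}=0 \] (identically in $x_1,x_2,x_3$). Then \[ \beta=3\alpha^2,\qquad \lambda=12\alpha(9\alpha^3+\gamma). \]
   Context: The function $f_{Kr}$. Let $\wp,\zeta,\sigma$ be the Weierstrass functions of a lattice in $\mathbb{C}$ with invariants $g_2,g_3$, let $z$ be a point not in the lattice, $\alpha\in\mathbb{C}$, and \[ f_{Kr}(x)=\frac{\sigma(x)\sigma(z)}{\sigma(z-x)}\exp(\alpha x-\zeta(z)x). \] The Taylor coefficients of $f_{Kr}$ at $x=0$ are polynomials with rational coefficients in $\alpha$, $\beta=\wp(z)$, $\gamma=\wp'(z)$, $\lambda=g_2$ (and $g_3=4\beta^3-\lambda\beta-\gamma^2$); these polynomials define $f_{Kr}$ for all $(\alpha,\beta,\gamma,\lambda)\in\mathbb{C}^4$, including degenerate values with $\Delta=g_2^3-27g_3^2=0$: \[ f_{Kr}(x)=x+\alpha x^2+(\alpha^2+\beta)\tfrac{x^3}{2}+(\alpha^3+3\alpha\beta-\gamma)\tfrac{x^4}{3!}+(5\alpha^4+30\alpha^2\beta+45\beta^2-20\alpha\gamma-3\lambda)\tfrac{x^5}{5!}+O(x^6). \] *)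

(* Defs.v *)
From mathcomp Require Import all_boot all_order all_algebra.
From mathcomp Require Import all_classical all_reals all_analysis.
From mathcomp Require Import complex.
From mathcomp Require mpoly.

Set Implicit Arguments.
Unset Strict Implicit.
Unset Printing Implicit Defensive.
Import Order.TTheory GRing.Theory Num.Theory.
Import numFieldNormedType.Exports.
Local Open Scope classical_set_scope.
Local Open Scope complex_scope.
Local Open Scope ring_scope.

(* R[i] viewed as a numClosedFieldType, the type on which the library puts the
   norm topology and complex differentiation. *)
Definition cplx (R : realType) : numClosedFieldType := R[i].

Section Weierstrass.
Variable R : realType.
Local Notation C := (cplx R).

Definition cexp (z : C) : C :=
  (expR (complex.Re z))%:C * (cos (complex.Im z) +i* sin (complex.Im z)).

Section Lattice.
Variables w1 w2 : C.

Definition lattice_basis : Prop :=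
  forall a b : R, a%:C * w1 + b%:C * w2 = 0 :> C -> a = 0 /\ b = 0.

Definition period (p : int * int) : C := p.1%:~R * w1 + p.2%:~R * w2.

Definition in_lattice (z : C) : Prop := exists p, z = period p.

(* The pairs (m, n) <> (0, 0) with |m|, |n| <= N. *)
Definition box (N : nat) : seq (int * int) :=
  let s := [seq (i%:Z - N%:Z)%R | i <- iota 0 N.*2.+1] in
  [seq p <- [seq (m, n) | m <- s, n <- s] | p != (0, 0)].

(* Sums and products over the nonzero periods; all those used below converge
   absolutely, so the exhaustion by boxes only fixes an order. *)
Definition lattice_sum (F : C -> C) : C :=
  lim ((fun N => \sum_(p <- box N) F (period p)) @ \oo).

Definition lattice_prod (F : C -> C) : C :=
  lim ((fun N => \prod_(p <- box N) F (period p)) @ \oo).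

Definition wsigma (z : C) : C :=
  z * lattice_prod (fun w => (1 - z / w) * cexp (z / w + (z / w) ^+ 2 / 2)).

Definition wzeta (z : C) : C :=
  z^-1 + lattice_sum (fun w => (z - w)^-1 + w^-1 + z / w ^+ 2).

Definition wp (z : C) : C :=
  z ^- 2 + lattice_sum (fun w => (z - w) ^- 2 - w ^- 2).

Definition g2 : C := 60 * lattice_sum (fun w => w ^- 4).

Definition krichever (z alpha x : C) : C :=
  wsigma x * wsigma z / wsigma (z - x) * cexp (alpha * x - wzeta z * x).

End Lattice.

Definition eval4 (p : mpoly.mpoly 4 rat) (alpha beta gamma lambda : C) : C :=
  mpoly.mmap (ratr : rat -> C)
    (fun i => [:: alpha; beta; gamma; lambda]`_i) p.

(* f is the sum of the power series with coefficients a in a neighbourhood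
   of 0. *)
Definition expands_at0 (f : C -> C) (a : nat -> C) : Prop :=
  \forall x \near (0 : C), [series a n * x ^+ n]_n @ \oo --> f x.

(* P n is the polynomial over the rationals giving the n-th Taylor coefficient
   at 0 of the Krichever function of every lattice, with g3 eliminated by
   means of g3 = 4 * beta ^+ 3 - lambda * beta - gamma ^+ 2. *)
Definition krichever_polys (P : nat -> mpoly.mpoly 4 rat) : Prop :=
  forall w1 w2 z alpha : C, lattice_basis w1 w2 -> ~ in_lattice w1 w2 z ->
  expands_at0 (krichever w1 w2 z alpha)
    (fun n => eval4 (P n) alpha (wp w1 w2 z) (derive1 (wp w1 w2) z) (g2 w1 w2)).

(* Near 0, f is the function f_Kr with arbitrary, possibly degenerate,
   parameters.  The values ((wp z), (wp' z), g2) of all lattices are Zariski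
   dense in C^3, so the family P is unique. *)
Definition is_fKr (alpha beta gamma lambda : C) (f : C -> C) : Prop :=
  exists2 P, krichever_polys P &
    expands_at0 f (fun n => eval4 (P n) alpha beta gamma lambda).

End Weierstrass.

(* Main.v *)
(* Put K for the Krichever function of a lattice.  With
   E(y) = (1 - y) exp (y + y^2 / 2) and D(x) = prod_w E(x / (z - w)) over all
   periods w, comparing factors gives
     K(x) D(x) = sigma(x) exp (alpha x + wp(z) x^2 / 2),
   from which the first Taylor coefficients of K are read off in terms of
   wp(z), the sums over w of (z - w)^-3 = - wp'(z) / 2 and (z - w)^-4, and g2.
   Since the coefficient of x^5 is by assumption a universal polynomial,
   homogeneity under rescaling of the lattice forces the sum of (z - w)^-4 to be
   a combination of wp^2 and g2, and z -> 0 identifies it as wp^2 - g2 / 12.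

   These formulas extend to all parameters because the lattice values are
   Zariski dense.  The hexagonal lattice has g2 = 0 and, with rescaling, its
   values are dense in the plane g2 = 0, as wp'^2 - 4 wp^3 tends to a nonzero
   constant at z = 0.  So a polynomial vanishing on all lattice values is
   divisible by lambda; the hexagonal lattice is a limit of lattices with
   g2 <> 0, on which the quotient vanishes too, and one concludes by descent on
   the degree.

   Finally, the functional equation at (0, t, - t) yields the two relations in
   degrees 2 and 4 in t. *)

(* The family [P] is known only through its values at lattices, and a small set of them suffices:
   [z] near 0 and the rescaled lattices of periods $w+t\bar w$, with $w$ hexagonal and $|t|\le 1/2$.
   There $|w+t\bar w|$ is at least a fixed multiple of the max norm of the index, so the lattice
   estimates reduce to one majorant, the sum of inverse cubes of that norm. Neither periodicity nor
   Liouville's theorem is used, which is why the quadratic expression of the fourth-power sum has to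
   be extracted from [P 5] itself.

   Density rests on two nonvanishing facts. The limit of $\wp'^2-4\wp^3$ at 0 is $-140\,G_6$, and
   $G_4$ leaves 0 at first order in $t$ with slope $-4\sum\bar w/w^5$. Both sums are dominated by
   the six units of the hexagonal lattice, where every summand is 1, so explicit tail bounds decide
   the matter.

   Coefficients are compared through uniqueness of asymptotic expansions at 0, without any
   analyticity. *)
Require Import Defs.
From mathcomp Require Import all_boot all_order all_algebra.
From mathcomp Require Import all_classical all_reals all_analysis.
From mathcomp Require Import complex ring lra zify.
Set Implicit Arguments.
Unset Strict Implicit.
Unset Printing Implicit Defensive.
Import Order.TTheory GRing.Theory Num.Theory.
Import numFieldNormedType.Exports.
Local Open Scope ring_scope.

(** * The complex norm and convergence of complex sequences *)

Section ComplexNorm.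
Variable R : realType.
Local Notation C := (cplx R).
Implicit Types (x y z : C) (u v : nat -> C).

(** The norm of [cplx R] takes its values in [cplx R]; a real-valued copy opens the estimates to
    [lra] and [nra]. *)
Definition nm (x : C) : R := Normc.normc x.

Lemma normE x : `|x| = (real_complex R (nm x) : C).
Proof. by []. Qed.

Lemma nm_ge0 x : 0 <= nm x.
Proof. by case: x => a b; rewrite /nm /= sqrtr_ge0. Qed.

Lemma nmM x y : nm (x * y) = nm x * nm y.
Proof. exact: Normc.normcM. Qed.

Lemma nmD x y : nm (x + y) <= nm x + nm y.
Proof. exact: le_normcD. Qed.

Lemma nmN x : nm (- x) = nm x.
Proof. exact: normcN. Qed.

Lemma nmV x : nm x^-1 = (nm x)^-1.
Proof. exact: Normc.normcV. Qed.

Lemma nm0 : nm 0 = 0.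
Proof. exact: Normc.normc0. Qed.

Lemma nm1 : nm 1 = 1.
Proof. exact: Normc.normc1. Qed.

Lemma nm_eq0 x : (nm x == 0) = (x == 0).
Proof.
apply/eqP/eqP => [|->]; last exact: nm0.
exact: (@Normc.eq0_normc R).
Qed.

Lemma nm_gt0 x : (0 < nm x) = (x != 0).
Proof. by rewrite lt_neqAle nm_ge0 andbT eq_sym nm_eq0. Qed.

Lemma nmB x y : nm (x - y) = nm (y - x).
Proof. by rewrite -nmN opprB. Qed.

Lemma nmX x n : nm (x ^+ n) = nm x ^+ n.
Proof. by elim: n => [|n IH]; rewrite ?expr0 ?nm1 // !exprS nmM IH. Qed.

Lemma nm_tri x y z : nm (x - z) <= nm (x - y) + nm (y - z).
Proof. by apply: le_trans (nmD _ _); rewrite addrA subrK. Qed.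

Lemma nm_rev x y : nm x - nm y <= nm (x - y).
Proof. by rewrite lerBlDr; apply: le_trans (nmD _ _); rewrite subrK. Qed.

Lemma nm_revD x y : nm x - nm y <= nm (x + y).
Proof. by rewrite -[y in leRHS]opprK -[nm y]nmN nm_rev. Qed.

Lemma nm_real (a : R) : nm (real_complex R a : C) = `|a|.
Proof. by rewrite /nm /= expr0n /= addr0 sqrtr_sqr. Qed.

Lemma nm_nat n : nm n%:R = n%:R.
Proof.
have -> : (n%:R : C) = real_complex R n%:R by rewrite rmorph_nat.
by rewrite nm_real ger0_norm.
Qed.

Lemma nm_sum (I : Type) (s : seq I) (F : I -> C) :
  nm (\sum_(i <- s) F i) <= \sum_(i <- s) nm (F i).
Proof.
elim: s => [|a s IH]; rewrite ?big_nil ?nm0 // !big_cons.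
by apply: le_trans (nmD _ _) _; rewrite lerD2l.
Qed.

Lemma nm_Re x : `|complex.Re x| <= nm x.
Proof.
case: x => a b; rewrite /nm /= -sqrtr_sqr ler_sqrt ?addr_ge0 ?sqr_ge0 //.
by rewrite lerDl sqr_ge0.
Qed.

Lemma nm_Im x : `|complex.Im x| <= nm x.
Proof.
case: x => a b; rewrite /nm /= -sqrtr_sqr ler_sqrt ?addr_ge0 ?sqr_ge0 //.
by rewrite lerDr sqr_ge0.
Qed.

Lemma nm_ReIm x : nm x <= `|complex.Re x| + `|complex.Im x|.
Proof.
case: x => a b; rewrite /nm /=.
have s0 : 0 <= `|a| + `|b| by rewrite addr_ge0.
have -> : `|a| + `|b| = Num.sqrt ((`|a| + `|b|) ^+ 2).
  by rewrite sqrtr_sqr (ger0_norm s0).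
rewrite ler_sqrt ?sqr_ge0 //.
rewrite -(real_normK (num_real a)) -(real_normK (num_real b)).
have := normr_ge0 a; have := normr_ge0 b; nra.
Qed.

Lemma ReB x y : complex.Re (x - y) = complex.Re x - complex.Re y.
Proof. by case: x y => a b [c d]. Qed.

Lemma ImB x y : complex.Im (x - y) = complex.Im x - complex.Im y.
Proof. by case: x y => a b [c d]. Qed.

(** Epsilons are real here; [cvs_cvg] identifies this with the filter convergence behind
    [lattice_sum] and [expands_at0]. *)
Definition cvs u (l : C) : Prop :=
  forall e : R, 0 < e -> exists N, forall n, (N <= n)%N -> nm (u n - l) < e.

Lemma ltc_nm x (e : R) : (`|x| < real_complex R e :> C) = (nm x < e).
Proof. by rewrite normE ltcR. Qed.

Lemma posC (e : C) : 0 < e -> exists2 a : R, 0 < a & e = real_complex R a.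
Proof.
move=> e0; exists (complex.Re e).
  by move: e0; rewrite (@ltcE R 0 e) => /andP[].
have /andP[/eqP i0 _] := etrans (esym (@ltcE R 0 e)) e0.
by case: (e) i0 => a b /= ->.
Qed.

Lemma cvs_cvg u l : cvs u l <-> (u @ \oo --> l)%classic.
Proof.
split=> [ul|/cvgrPdist_lt ul e e0].
  apply/cvgrPdist_lt => _ /posC[e e0 ->].
  have [N uN] := ul _ e0; exists N => // n Nn.
  by rewrite ltc_nm nmB; apply: uN.
have e0' : (0 : C) < real_complex R e by rewrite ltcR.
have [N _ uN] := ul _ e0'; exists N => n /uN.
by rewrite ltc_nm nmB.
Qed.

Lemma cvs_lim u l : cvs u l -> lim (u @ \oo)%classic = l.
Proof. by move/cvs_cvg => ul; apply: cvg_lim ul; exact: norm_hausdorff. Qed.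

Lemma cvs_ext u v l : (forall n, u n = v n) -> cvs u l -> cvs v l.
Proof. by move=> uv ul e /ul[N uN]; exists N => n; rewrite -uv; apply: uN. Qed.

Lemma cvs_cst l : cvs (fun=> l) l.
Proof. by move=> e e0; exists 0%N => n _; rewrite subrr nm0. Qed.

Lemma cvsD u v l m : cvs u l -> cvs v m -> cvs (fun n => u n + v n) (l + m).
Proof.
move=> ul vm e e0; have e2 : 0 < e / 2 by rewrite divr_gt0.
have [N uN] := ul _ e2; have [M vM] := vm _ e2.
exists (maxn N M) => n; rewrite geq_max => /andP[/uN h1 /vM h2].
rewrite opprD addrACA [e]splitr; apply: le_lt_trans (nmD _ _) _.
exact: ltrD.
Qed.

Lemma cvsN u l : cvs u l -> cvs (fun n => - u n) (- l).
Proof.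
move=> ul e /ul[N uN]; exists N => n /uN; rewrite -nmN.
by rewrite opprB opprK addrC.
Qed.

Lemma cvsM0 u v (B : R) : cvs u 0 -> (forall n, nm (v n) <= B) ->
  cvs (fun n => u n * v n) 0.
Proof.
move=> u0 vB e e0.
have B0 : 0 <= B by apply: le_trans (vB 0%N); apply: nm_ge0.
have B1 : 0 < B + 1 by rewrite ltr_wpDl.
have [|N uN] := u0 (e / (B + 1)); first by rewrite divr_gt0.
exists N => n /uN; rewrite !subr0 nmM ltr_pdivlMr // => h.
apply: le_lt_trans h; rewrite ler_wpM2l ?nm_ge0 //.
by apply: le_trans (vB n) _; rewrite lerDl.
Qed.

Lemma cvs_bounded u l : cvs u l -> exists B, forall n, nm (u n) <= B.
Proof.
move=> /(_ 1 ltr01)[N uN].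
exists (\sum_(i < N) nm (u i) + (nm l + 1)) => n.
have s0 : 0 <= \sum_(i < N) nm (u i) by apply: sumr_ge0 => i _; apply: nm_ge0.
have l0 := nm_ge0 l.
case: (ltnP n N) => [nN|/uN h].
  rewrite (bigD1 (Ordinal nN)) //= -addrA lerDl.
  by rewrite addr_ge0 ?addr_ge0 // sumr_ge0 // => i _; apply: nm_ge0.
have := nm_rev (u n) l; lra.
Qed.

Lemma cvs_sub0 u l : cvs u l -> cvs (fun n => u n - l) 0.
Proof. by move=> ul e /ul[N uN]; exists N => n /uN; rewrite subr0. Qed.

Lemma cvsM u v l m : cvs u l -> cvs v m -> cvs (fun n => u n * v n) (l * m).
Proof.
move=> ul vm; have [B vB] := cvs_bounded vm.
have h1 := cvsM0 (cvs_sub0 ul) vB.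
have h2 := cvsM0 (cvs_sub0 vm) (fun=> lexx (nm l)).
have := cvsD (cvsD h1 h2) (cvs_cst (l * m)); rewrite !add0r.
by apply: cvs_ext => n; rewrite mulrBl mulrBl [v n * l]mulrC [m * l]mulrC addrA !subrK.
Qed.

Lemma cvsB u v l m : cvs u l -> cvs v m -> cvs (fun n => u n - v n) (l - m).
Proof. by move=> ul vm; apply: cvsD => //; apply: cvsN. Qed.

Lemma cvs_uniq u l m : cvs u l -> cvs u m -> l = m.
Proof. by move=> /cvs_lim <- /cvs_lim <-. Qed.

Lemma cvs_le u l (a : C) (B : R) N :
  cvs u l -> (forall n, (N <= n)%N -> nm (u n - a) <= B) -> nm (l - a) <= B.
Proof.
move=> ul uB; apply/ler_addgt0Pr => e /ul[M uM].
have := uM _ (leq_maxr N M); have := uB _ (leq_maxl N M).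
move: (maxn N M) => n h1 h2.
by apply: le_trans (nm_tri _ (u n) _) _; rewrite addrC lerD // nmB ltW.
Qed.

Lemma cvs_le0 u l (B : R) : cvs u l -> (forall n, nm (u n) <= B) -> nm l <= B.
Proof.
by move=> ul uB; rewrite -[l]subr0; apply: (cvs_le (N := 0) ul) => n _; rewrite subr0.
Qed.

(** Completeness of [R] is applied to the real and imaginary parts, which are 1-Lipschitz for
    [nm]. *)
Lemma cvs_cauchy u :
  (forall e : R, 0 < e ->
     exists N, forall n m, (N <= n)%N -> (n <= m)%N -> nm (u m - u n) <= e) ->
  exists l, cvs u l.
Proof.
move=> uc.
have real_lim (p : C -> R) (pB : forall x y, p (x - y) = p x - p y)
    (pn : forall x, `|p x| <= nm x) : exists l : R,
    forall e : R, 0 < e -> exists N, forall n, (N <= n)%N -> `|p (u n) - l| < e.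
  have : cvg ((p \o u) @ \oo)%classic.
    apply/cauchy_cvgP; apply: cauchy_exP => e e0.
    have [|N uN] := uc (e / 2); first by rewrite divr_gt0.
    exists (p (u N)); exists N => // n Nn; rewrite -ball_normE /ball_ /=.
    rewrite distrC -pB; apply: le_lt_trans (pn _) _.
    apply: le_lt_trans (uN _ _ (leqnn N) Nn) _.
    by rewrite ltr_pdivrMr // ltr_pMr // ltr1n.
  move=> /cvg_ex[l /cvgrPdist_lt pl]; exists l => e e0.
  have [N _ uN] := pl _ e0; exists N => n /uN /=.
  by rewrite distrC.
have [a ua] := real_lim (@complex.Re R)
  ReB nm_Re.
have [b ub] := real_lim (@complex.Im R)
  ImB nm_Im.
exists (a +i* b)%C => e e0.
have e2 : 0 < e / 2 by rewrite divr_gt0.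
have [N uN] := ua _ e2; have [M uM] := ub _ e2.
exists (maxn N M) => n; rewrite geq_max => /andP[/uN h1 /uM h2].
apply: le_lt_trans (nm_ReIm _) _; rewrite [e]splitr.
by case: (u n) h1 h2 => c d /= h1 h2; rewrite ltrD.
Qed.

End ComplexNorm.

(** * Sums over boxes of integer pairs *)

Arguments box N : simpl never.

Section Shells.

(** The max norm, whose punctured balls are the boxes. *)
Definition sz (p : int * int) : nat := maxn `|p.1|%N `|p.2|%N.

Lemma sz_gt0 p : (0 < sz p)%N = (p != (0, 0)).
Proof.
case: p => m n; rewrite /sz leq_max !absz_gt0 /= -pair_eqE /= negb_and.
by [].
Qed.

Lemma mem_box N p : (p \in box N) = (p != (0, 0)) && (sz p <= N)%N.
Proof.
rewrite /box; set s := [seq _ | i <- iota 0 _].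
have ms (m : int) : (m \in s) = (absz m <= N)%N.
  apply/mapP/idP => [[k]|h]; first by rewrite mem_iota => + ->; lia.
  by exists (absz (m + N%:Z)%R); rewrite ?mem_iota; lia.
rewrite mem_filter; congr andb.
case: p => m n; rewrite geq_max -[(_ <= N)%N && _]/((absz m <= N)%N && (absz n <= N)%N) -!ms.
apply/allpairsP/andP => [|h]; last by case: h => hm hn; exists (m, n).
by case=> q [h1 h2 h3]; case: h3 => -> ->.
Qed.

Lemma box_uniq N : uniq (box N).
Proof.
have us : uniq [seq (i%:Z - N%:Z)%R | i <- iota 0 N.*2.+1].
  by rewrite map_inj_uniq ?iota_uniq // => i j; lia.
by apply: filter_uniq; apply: allpairs_uniq => // -[a b] [c d] _ _ /= [-> ->].
Qed.

Lemma size_box N : (size (box N)).+1 = (N.*2.+1 ^ 2)%N.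
Proof.
set s := [seq (i%:Z - N%:Z)%R | i <- iota 0 N.*2.+1].
have us : uniq s by rewrite map_inj_uniq ?iota_uniq // => i j; lia.
set t := [seq (m, n) | m <- s, n <- s].
have ut : uniq t by apply: allpairs_uniq => // -[a b] [c d] _ _ /= [-> ->].
have t0 : (0, 0) \in t.
  have s0 : 0 \in s by apply/mapP; exists N; rewrite ?mem_iota; lia.
  by apply/allpairsP; exists (0, 0).
have -> : (N.*2.+1 ^ 2)%N = size t by rewrite size_allpairs size_map size_iota.
rewrite size_filter -(count_predC (pred1 (0, 0)) t) (count_uniq_mem _ ut) t0.
by rewrite add1n; congr S; apply: eq_count.
Qed.

Definition shell k := [seq p <- box k | sz p == k].

Lemma mem_shell p k : (p \in shell k) = (sz p == k) && (p \in box k).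
Proof. by rewrite /shell mem_filter. Qed.

Lemma boxS N : perm_eq (box N.+1) (box N ++ shell N.+1).
Proof.
apply: uniq_perm; first exact: box_uniq.
  rewrite cat_uniq box_uniq filter_uniq ?box_uniq // andbT.
  apply/hasPn => p; rewrite mem_shell => /andP[/eqP pN _].
  by rewrite /= mem_box pN ltnn andbF.
move=> p; rewrite mem_cat mem_shell !mem_box.
case: (p != _) => /=; rewrite ?andbF //; move: (sz p) => k.
rewrite leq_eqVlt ltnS; case: (k =P N.+1) => [->|_] /=; last by rewrite orbF.
by rewrite orbT.
Qed.

(** The count is $(2k+3)^2-(2k+1)^2$. *)
Lemma size_shell k : size (shell k.+1) = (8 * k.+1)%N.
Proof.
have := perm_size (boxS k); rewrite size_cat.
have := size_box k; have := size_box k.+1.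
move: (size (box k)) (size (box k.+1)) (size (shell k.+1)) => a b c.
rewrite -!mulnn -!mul2n; nia.
Qed.

Lemma box0 : box 0 = [::].
Proof. by []. Qed.

Variable R : realType.

(** Summation by shells: [h] acts as a discrete primitive of the shell contributions, so the sum
    telescopes. *)
Lemma shell_sum_le (g h : nat -> R) N M :
  (forall k, (N <= k)%N -> 8 * k.+1%:R * g k.+1 <= h k - h k.+1) ->
  (N <= M)%N ->
  \sum_(p <- box M | (N < sz p)%N) g (sz p) <= h N - h M.
Proof.
move=> gh; elim: M => [|M IH] NM.
  by rewrite box0 big_nil; move: NM; rewrite leqn0 => /eqP->; rewrite subrr.
rewrite (perm_big _ (boxS M)) big_cat /=.
have -> : \sum_(p <- shell M.+1 | (N < sz p)%N) g (sz p)
    = (if (N < M.+1)%N then 8 * M.+1%:R * g M.+1 else 0).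
  have -> : \sum_(p <- shell M.+1 | (N < sz p)%N) g (sz p)
      = \sum_(p <- shell M.+1) (if (N < M.+1)%N then g M.+1 else 0).
    rewrite [LHS]big_mkcond /= !big_filter; apply: eq_bigr => p /eqP ->.
    by [].
  rewrite big_const_seq count_predT size_shell; case: ifP => _.
    by rewrite iter_addr_0 -[LHS]mulr_natl natrM.
  by rewrite iter_addr_0 mul0rn.
move: NM; rewrite leq_eqVlt => /orP[/eqP NM|NM].
  rewrite -NM ltnn addr0 subrr big1_seq // => p.
  by rewrite mem_box NM => /andP[/ltnW +]; lia.
rewrite NM; have := gh _ (NM : (N <= M)%N); have := IH NM; lra.
Qed.

(** Telescoping with $h(k)=8/k$, since $8/(k+1)^2\le 8/k-8/(k+1)$. *)
Lemma sum_sz3_tail N M : (0 < N)%N ->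
  \sum_(p <- box M | (N < sz p)%N) (sz p)%:R ^- 3 <= 8 / N%:R :> R.
Proof.
move=> N0; case: (leqP N M) => [NM|MN]; last first.
  rewrite big1_seq ?divr_ge0 // => p; rewrite mem_box.
  by move=> /andP[h /andP[_ h']]; lia.
have := @shell_sum_le (fun k => k%:R ^- 3) (fun k => 8 / k%:R) N M _ NM.
move=> /(_ _)/le_trans; apply; last by rewrite gerBl divr_ge0.
move=> k Nk; have k0 : 0 < k%:R :> R by rewrite ltr0n; lia.
rewrite /= -[k.+1%:R]natr1; set x : R := k%:R in k0 *.
have -> : 8 * (x + 1) * (x + 1) ^- 3 = 8 / (x + 1) ^+ 2.
  by field; rewrite gt_eqF // ltr_wpDr.
have -> : 8 / x - 8 / (x + 1) = 8 / (x * (x + 1)).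
  by field; rewrite !gt_eqF // ltr_wpDr.
rewrite ler_pM2l // lef_pV2 ?posrE ?exprn_gt0 ?mulr_gt0 ?ltr_wpDr //.
nra.
Qed.

(** The first shell has eight pairs of weight 1, and the tail adds at most $8/1$. *)
Lemma sum_sz3 N : \sum_(p <- box N) (sz p)%:R ^- 3 <= 16 :> R.
Proof.
have s1 : \sum_(p <- box N | (1 < sz p)%N) (sz p)%:R ^- 3 <= 8 :> R.
  by apply: le_trans (sum_sz3_tail _ _) _ => //; rewrite divr1.
have s2 : \sum_(p <- box N | ~~ (1 < sz p)%N) (sz p)%:R ^- 3 <= 8 :> R.
  case: N {s1} => [|N]; first by rewrite box0 big_nil.
  rewrite (_ : \sum_(p <- _ | _) _ = \sum_(p <- box 1) 1).
    rewrite big_const_seq count_predT iter_addr_0.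
    have /eqP := size_box 1; rewrite eqSS => /eqP ->.
    by [].
  rewrite -big_filter (perm_big (box 1)).
    rewrite big_seq [RHS]big_seq; apply: eq_bigr => p.
    rewrite mem_box -sz_gt0 => h; have -> : sz p = 1%N by lia.
    by rewrite expr1n invr1.
  apply: uniq_perm; [exact/filter_uniq/box_uniq|exact: box_uniq|move=> p].
  by rewrite mem_filter !mem_box; lia.
rewrite (bigID (fun p => 1 < sz p)%N) /=; lra.
Qed.

(** Telescoping with $h(k)=4/(k(k+1))$, so that $h(1)=2$. The sharp constant serves the numerical
    nonvanishing of two hexagonal sums. *)
Lemma sum_sz4_tail M :
  \sum_(p <- box M | (1 < sz p)%N) (sz p)%:R ^- 4 <= 2 :> R.
Proof.
case: (posnP M) => [->|M0]; first by rewrite box0 big_nil.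
have := @shell_sum_le (fun k => k%:R ^- 4) (fun k => 4 / (k%:R * k.+1%:R)) 1 M _ M0.
move=> /(_ _)/le_trans; apply; last first.
  have : 0 <= 4 / (M%:R * M.+1%:R) :> R by rewrite divr_ge0 ?mulr_ge0.
  rewrite /= mul1r; move: (_ / (M%:R * _)) => y y0; lra.
move=> k k1; have k0 : 1 <= k%:R :> R by rewrite ler1n.
rewrite /= -[k.+2%:R]natr1 -[k.+1%:R]natr1; set x : R := k%:R in k0 *.
have x0 : 0 < x by lra.
have x1 : 0 < x + 1 by lra.
have x2 : 0 < x + 1 + 1 by lra.
have -> : 8 * (x + 1) * (x + 1) ^- 4 = 8 / (x + 1) ^+ 3.
  by field; rewrite gt_eqF.
have -> : 4 / (x * (x + 1)) - 4 / ((x + 1) * (x + 1 + 1)) = 8 / (x * (x + 1) * (x + 1 + 1)).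
  by field; rewrite !gt_eqF.
rewrite ler_pM2l // lef_pV2 ?posrE ?exprn_gt0 ?mulr_gt0 //.
nra.
Qed.

End Shells.

(** * Lattice sums of cubic decay *)

Section LatticeSums.
Variable R : realType.
Local Notation C := (cplx R).
Implicit Types (F G : int * int -> C) (B : R).

Definition psum F (N : nat) : C := \sum_(p <- box N) F p.

Definition lsum F : C := lim (psum F @ \oo)%classic.

(** Three is the least integer exponent with absolutely convergent sums over pairs. The explicit [B]
    makes bounds uniform in [x], [z] and [t]. *)
Definition cubic B F := forall p, p != (0, 0) -> nm (F p) <= B * (sz p)%:R ^- 3.

Lemma cubic_ge0 B F : cubic B F -> 0 <= B.
Proof.
move=> /(_ (1, 0) isT); rewrite /sz /= maxn0 expr1n invr1 mulr1.
by apply: le_trans; apply: nm_ge0.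
Qed.

Lemma mixed_cubic (c : R) F G (j k : nat) :
  (forall p, p != (0, 0) -> nm (F p) * (sz p)%:R <= c) ->
  (forall p, p != (0, 0) -> nm (G p) * (sz p)%:R <= c) -> (3 <= j + k)%N ->
  cubic (c ^+ (j + k)) (fun p => F p ^+ j * G p ^+ k).
Proof.
move=> Fc Gc jk p p0; have s0 : (0 : R) < (sz p)%:R by rewrite ltr0n sz_gt0.
have s1 : (1 : R) <= (sz p)%:R by rewrite ler1n sz_gt0.
have h1 : nm (F p) <= c / (sz p)%:R by rewrite ler_pdivlMr ?Fc.
have h2 : nm (G p) <= c / (sz p)%:R by rewrite ler_pdivlMr ?Gc.
have cs : 0 <= c / (sz p)%:R by apply: le_trans h1; apply: nm_ge0.
have c0 : 0 <= c by move: cs; rewrite pmulr_lge0 // invr_gt0.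
apply: (@le_trans _ _ ((c / (sz p)%:R) ^+ j * (c / (sz p)%:R) ^+ k)).
  by rewrite nmM !nmX; apply: ler_pM; rewrite ?exprn_ge0 ?nm_ge0 // lerXn2r ?nnegrE ?nm_ge0.
rewrite -exprD [leLHS]expr_div_n ler_wpM2l ?exprn_ge0 //.
by rewrite lef_pV2 ?posrE ?exprn_gt0 // ler_weXn2l.
Qed.

Lemma sum_cubic B F (P : pred (int * int)) N : cubic B F ->
  \sum_(p <- box N | P p) nm (F p) <= B * \sum_(p <- box N | P p) (sz p)%:R ^- 3.
Proof.
move=> FB; rewrite mulr_sumr big_seq_cond [leRHS]big_seq_cond; apply: ler_sum => p.
by rewrite mem_box => /andP[/andP[p0 _] _]; apply: FB.
Qed.

Lemma sum_cubic_le B F N : cubic B F -> \sum_(p <- box N) nm (F p) <= 16 * B.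
Proof.
move=> FB; apply: le_trans (sum_cubic xpredT N FB) _.
by rewrite mulrC ler_wpM2r ?(cubic_ge0 FB) ?sum_sz3.
Qed.

Lemma sum_cubic_tail B F N M : (0 < N)%N -> cubic B F ->
  \sum_(p <- box M | (N < sz p)%N) nm (F p) <= 8 * B / N%:R.
Proof.
move=> N0 FB; apply: le_trans (sum_cubic _ M FB) _.
by rewrite [8 * B]mulrC -mulrA ler_wpM2l ?(cubic_ge0 FB) ?sum_sz3_tail.
Qed.

Lemma box_diff (V : zmodType) (G : int * int -> V) N M : (N <= M)%N ->
  \sum_(p <- box M) G p - \sum_(p <- box N) G p
    = \sum_(p <- box M | (N < sz p)%N) G p.
Proof.
move=> NM; have -> : \sum_(p <- box N) G p = \sum_(p <- box M | ~~ (N < sz p)%N) G p.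
  rewrite -[RHS]big_filter; apply: perm_big.
  apply: uniq_perm; [exact: box_uniq|exact/filter_uniq/box_uniq|move=> p].
  rewrite mem_box mem_filter mem_box -leqNgt; case: (p != _); rewrite ?andbF //=.
  by case: leqP => //= h; rewrite (leq_trans h NM).
by rewrite (bigID (fun p => N < sz p)%N) /= addrK.
Qed.

Lemma psum_diff B F N M : (0 < N)%N -> (N <= M)%N -> cubic B F ->
  nm (psum F M - psum F N) <= 8 * B / N%:R.
Proof.
move=> N0 NM FB; rewrite box_diff // -big_filter.
apply: le_trans (nm_sum _ _) _; rewrite big_filter.
exact: sum_cubic_tail.
Qed.

Lemma small_inv (a e : R) : 0 < e -> exists2 N : nat, (0 < N)%N & a / N%:R < e.
Proof.
move=> e0; pose N := (Num.trunc (`|a| / e)).+1.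
exists N => //; rewrite ltr_pdivrMr ?ltr0n //.
have : `|a| / e < N%:R.
  have := @truncnS_gt R (`|a| / e).
  by apply.
rewrite ltr_pdivrMr // mulrC; apply: le_lt_trans; exact: ler_norm.
Qed.

Lemma lsum_cvs B F : cubic B F -> cvs (psum F) (lsum F).
Proof.
move=> FB; have [|l Fl] := @cvs_cauchy R (psum F); last by rewrite /lsum (cvs_lim Fl).
move=> e e0; have [N N0 hN] := small_inv (8 * B) e0.
exists N => n m Nn nm'; apply: le_trans (psum_diff _ nm' FB) _; first lia.
apply: le_trans (ltW hN); rewrite ler_wpM2l ?mulr_ge0 ?(cubic_ge0 FB) //.
by rewrite lef_pV2 ?posrE ?ltr0n ?ler_nat //; lia.
Qed.

Lemma lsum_le B F : cubic B F -> nm (lsum F) <= 16 * B.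
Proof.
move=> FB; apply: (cvs_le0 (lsum_cvs FB)) => n.
by apply: le_trans (nm_sum _ _) _; apply: sum_cubic_le.
Qed.

Lemma cubicD B B' F G : cubic B F -> cubic B' G -> cubic (B + B') (fun p => F p + G p).
Proof.
move=> FB GB p p0; apply: le_trans (nmD _ _) _; rewrite mulrDl.
by rewrite lerD ?FB ?GB.
Qed.

Lemma cubicZ B F c : cubic B F -> cubic (nm c * B) (fun p => c * F p).
Proof. by move=> FB p p0; rewrite nmM -mulrA ler_wpM2l ?nm_ge0 ?FB. Qed.

Lemma cubicB B B' F G : cubic B F -> cubic B' G -> cubic (B + B') (fun p => F p - G p).
Proof.
move=> FB GB p p0; apply: le_trans (nmD _ _) _; rewrite nmN mulrDl.
by rewrite lerD ?FB ?GB.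
Qed.

Lemma lsumD B B' F G : cubic B F -> cubic B' G ->
  lsum (fun p => F p + G p) = lsum F + lsum G.
Proof.
move=> FB GB; apply: (cvs_uniq (lsum_cvs (cubicD FB GB))).
by apply: cvs_ext (cvsD (lsum_cvs FB) (lsum_cvs GB)) => n; rewrite /psum big_split.
Qed.

Lemma lsumZ B F c : cubic B F -> lsum (fun p => c * F p) = c * lsum F.
Proof.
move=> FB; apply: (cvs_uniq (lsum_cvs (cubicZ c FB))).
by apply: cvs_ext (cvsM (cvs_cst c) (lsum_cvs FB)) => n; rewrite /psum mulr_sumr.
Qed.

Lemma lsum2 (a b : C) B B' F F' : cubic B F -> cubic B' F' ->
  lsum (fun p => a * F p + b * F' p) = a * lsum F + b * lsum F'.
Proof. by move=> h h'; rewrite (lsumD (cubicZ a h) (cubicZ b h')) (lsumZ a h) (lsumZ b h'). Qed.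

Lemma cubic2 (a b : C) B B' F F' : cubic B F -> cubic B' F' ->
  exists B2, cubic B2 (fun p => a * F p + b * F' p).
Proof. by move=> h h'; eexists; apply: cubicD (cubicZ a h) (cubicZ b h'). Qed.

Lemma lsumB B B' F G : cubic B F -> cubic B' G ->
  lsum (fun p => F p - G p) = lsum F - lsum G.
Proof.
move=> FB GB; rewrite -[- lsum G]mulN1r -(lsumZ (-1) GB) -(lsumD FB (cubicZ (-1) GB)).
by congr lsum; apply: funext => p; rewrite mulN1r.
Qed.

Lemma eq_psum F G : (forall p, p != (0, 0) -> F p = G p) -> psum F =1 psum G.
Proof.
move=> FG N; rewrite /psum big_seq [RHS]big_seq; apply: eq_bigr => p.
by rewrite mem_box => /andP[/FG].
Qed.

Lemma eq_lsum F G : (forall p, p != (0, 0) -> F p = G p) -> lsum F = lsum G.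
Proof. by move=> /eq_psum/funext FG; rewrite /lsum FG. Qed.

Lemma eq_cubic B F G : (forall p, p != (0, 0) -> F p = G p) -> cubic B F -> cubic B G.
Proof. by move=> FG FB p p0; rewrite -FG ?FB. Qed.

(* Both [A @` box (2 L)] and [box (4 L)] contain [box L], so the two partial
   sums differ by terms outside it. *)
Lemma lsum_reindex B F (A A' : int * int -> int * int) :
  cubic B F -> cancel A A' -> cancel A' A -> A (0, 0) = (0, 0) ->
  (forall p, (sz (A p) <= 2 * sz p)%N) -> (forall p, (sz (A' p) <= 2 * sz p)%N) ->
  lsum (fun p => F (A p)) = lsum F.
Proof.
move=> FB AK A'K A0 szA szA'.
have A_eq0 p : (A p == (0, 0)) = (p == (0, 0)).
  by apply/eqP/eqP => [/(congr1 A')|->//]; rewrite AK -{1}A0 AK.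
(* The 8 is the cube of the distortion 2 of [A']. *)
have FAB : cubic (8 * B) (fun p => F (A p)).
  move=> p p0; apply: le_trans (FB _ _) _; first by rewrite A_eq0.
  rewrite [8 * B]mulrC -mulrA ler_wpM2l ?(cubic_ge0 FB) //.
  have sA : (sz p <= 2 * sz (A p))%N by rewrite -{1}[p]AK.
  have s0 : 0 < (sz p)%:R :> R by rewrite ltr0n sz_gt0.
  have t0 : 0 < (sz (A p))%:R :> R by rewrite ltr0n sz_gt0 A_eq0.
  rewrite -ler_pdivrMl // -[8^-1 * _]invfM lef_pV2 ?posrE ?mulr_gt0 ?exprn_gt0 //.
  have : (sz p)%:R <= 2 * (sz (A p))%:R :> R by rewrite -natrM ler_nat.
  move=> h; have -> : 8 * (sz (A p))%:R ^+ 3 = (2 * (sz (A p))%:R) ^+ 3 :> R by ring.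
  by rewrite lerXn2r ?nnegrE ?mulr_ge0.
apply/eqP; rewrite -subr_eq0 -nm_eq0 eq_le nm_ge0 andbT.
apply/ler_addgt0Pl => e e0; rewrite addr0.
have cv := cvsB (lsum_cvs FAB) (lsum_cvs FB).
have [K K0 hK] := small_inv (8 * B) (divr_gt0 e0 (ltr0n R 2)).
have e4 : 0 < e / 4 by rewrite divr_gt0.
have [N1 h1] := lsum_cvs FAB e4; have [N2 h2] := lsum_cvs FB e4.
pose L := (K + N1 + N2)%N.
have {h1} h1 : nm (psum (fun p => F (A p)) (2 * L) - lsum (fun p => F (A p))) < e / 4.
  by apply: h1; lia.
have {h2} h2 : nm (psum F (4 * L) - lsum F) < e / 4 by apply: h2; lia.
have d : nm (psum F (4 * L) - psum (fun p => F (A p)) (2 * L)) <= 8 * B / K%:R.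
  have -> : psum (fun p => F (A p)) (2 * L)
      = \sum_(p <- box (4 * L) | p \in map A (box (2 * L))) F p.
    rewrite -big_filter /psum -(big_map A xpredT F); apply: perm_big.
    have uA : uniq (map A (box (2 * L))) by rewrite (map_inj_uniq (can_inj AK)) box_uniq.
    apply: uniq_perm => //; first exact/filter_uniq/box_uniq.
    move=> p; rewrite mem_filter; case: mapP => //= -[q].
    by rewrite !mem_box => /andP[q0 hq] ->; rewrite A_eq0 q0 /=; have := szA q; lia.
  rewrite /psum (bigID (fun p => p \in map A (box (2 * L)))) /= addrAC subrr add0r.
  rewrite -big_filter; apply: le_trans (nm_sum _ _) _; rewrite big_filter.
  apply: le_trans (sum_cubic_tail (4 * L) K0 FB).
  rewrite big_mkcond [leRHS]big_mkcond /= big_seq [leRHS]big_seq; apply: ler_sum => p.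
  rewrite mem_box => /andP[p0 _].
  case: ifP => [pA|_]; last by case: ifP => // _; apply: nm_ge0.
  case: ifP => // /negP; case; rewrite ltnNge; apply: contra pA => pK.
  apply/mapP; exists (A' p); last by rewrite A'K.
  rewrite mem_box -A_eq0 A'K p0 /=; have := szA' p; lia.
set a := lsum _ in h1 *; set b := lsum _ in h2 *.
move: h1 h2 d; set u := psum _ _; set v := psum _ _ => h1 h2 d.
apply: le_trans (nm_tri _ u _) _; rewrite [nm (a - u)]nmB.
have := nm_tri u v b; rewrite [nm (u - v)]nmB; lra.
Qed.

End LatticeSums.

(** * Taylor estimates for the exponential *)

Section RealTaylor.
Variable R : realType.

(** By the mean value theorem $f(x)=f'(c)x$ with $|c|\le|x|$, so a bound on the derivative gains one
    power. *)
Lemma taylor_step (f df : R -> R) (M : R) (k : nat) :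
  (forall x : R, is_derive x (1 : R) f (df x)) -> f 0 = 0 -> 0 <= M ->
  (forall x : R, `|x| <= 1 -> `|df x| <= M * `|x| ^+ k) ->
  forall x : R, `|x| <= 1 -> `|f x| <= M * `|x| ^+ k.+1.
Proof.
move=> fdf f0 M0 dfM x x1.
have cf (A : set R) : {within A, continuous f}%classic.
  apply: continuous_subspaceT => y; apply/differentiable_continuous/derivable1_diffP.
  by have [] := fdf y.
suff [c cx ->] : exists2 c, `|c| <= `|x| & f x = df c * x.
  rewrite normrM exprSr mulrA ler_wpM2r //.
  apply: le_trans (dfM c _) _; first exact: le_trans cx x1.
  by rewrite ler_wpM2l // lerXn2r ?nnegrE.
case: (leP 0 x) => x0.
  have [c] := MVT_segment x0 (fun z _ => fdf z) (cf _).
  rewrite f0 !subr0 in_itv /= => /andP[c0 cx] ->; exists c => //.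
  by rewrite !ger0_norm.
have [c] := MVT_segment (ltW x0) (fun z _ => fdf z) (cf _).
rewrite f0 !sub0r in_itv /= mulrN => /andP[xc c0] /oppr_inj ->; exists c => //.
by rewrite !ler0_norm ?lerN2 // ltW.
Qed.

(** Each Taylor remainder is the derivative of the next one; the chain starts from
    [expR x <= expR 1] on the unit interval. *)
Lemma expR_taylor : exists2 M : R, 0 <= M & forall x : R, `|x| <= 1 ->
  `|expR x - (1 + x + x ^+ 2 / 2 + x ^+ 3 / 6 + x ^+ 4 / 24)| <= M * `|x| ^+ 5.
Proof.
exists (expR 1) => [|]; first exact: expR_ge0.
pose T (k : nat) (f : R -> R) := forall x : R, `|x| <= 1 -> `|f x| <= expR 1 * `|x| ^+ k.
have st k (f df : R -> R) : (forall x : R, is_derive x (1 : R) f (df x)) -> f 0 = 0 ->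
    T k df -> T k.+1 f.
  by move=> h1 h2 h3; apply: taylor_step h1 h2 (expR_ge0 _) h3.
have e0 : T 0%N expR.
  move=> y y1; rewrite mulr1 ger0_norm ?expR_ge0 // ler_expR.
  by apply: le_trans y1; exact: ler_norm.
have e1 : T 1%N (fun x => expR x - 1).
  apply: (st _ _ _ _ _ e0); last by rewrite expR0 subrr.
  by move=> y; apply: is_derive_eq; rewrite subr0.
have e2 : T 2%N (fun x => expR x - (1 + x)).
  apply: (st _ _ _ _ _ e1); last by rewrite expR0 addr0 subrr.
  by move=> y; apply: is_derive_eq; rewrite add0r.
have e3 : T 3%N (fun x => expR x - (1 + x + x ^+ 2 / 2)).
  apply: (st _ _ _ _ _ e2); last by rewrite expR0 !expr0n /=; field.
  by move=> y; apply: is_derive_eq; rewrite /GRing.scale /=; field.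
have e4 : T 4%N (fun x => expR x - (1 + x + x ^+ 2 / 2 + x ^+ 3 / 6)).
  apply: (st _ _ _ _ _ e3); last by rewrite expR0 !expr0n /=; field.
  by move=> y; apply: is_derive_eq; rewrite /GRing.scale /=; field.
have e5 : T 5%N (fun x => expR x - (1 + x + x ^+ 2 / 2 + x ^+ 3 / 6 + x ^+ 4 / 24)).
  apply: (st _ _ _ _ _ e4); last by rewrite expR0 !expr0n /=; field.
  by move=> y; apply: is_derive_eq; rewrite /GRing.scale /=; field.
exact: e5.
Qed.

(** Up to sign, the remainders of [cos] and [sin] are alternately derivatives of each other; the
    chain starts from the bound 1 on both functions. *)
Lemma cos_sin_taylor (x : R) : `|x| <= 1 ->
  `|cos x - (1 - x ^+ 2 / 2 + x ^+ 4 / 24)| <= `|x| ^+ 5 /\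
  `|sin x - (x - x ^+ 3 / 6)| <= `|x| ^+ 5.
Proof.
pose T (k : nat) (f : R -> R) := forall x : R, `|x| <= 1 -> `|f x| <= 1 * `|x| ^+ k.
have st k (f df : R -> R) : (forall x : R, is_derive x (1 : R) f (df x)) -> f 0 = 0 ->
    T k df -> T k.+1 f.
  by move=> h1 h2 h3; apply: taylor_step h1 h2 ler01 h3.
have TN k (f g : R -> R) : (forall x, g x = - f x) -> T k f -> T k g.
  by move=> fg Tf y /Tf; rewrite fg normrN.
have s1 : T 1%N sin.
  apply: (st _ _ cos); [exact: sin0|].
  by move=> y _; rewrite mulr1 ler_norml cos_geN1 cos_le1.
have c1 : T 1%N (fun x => cos x - 1).
  apply: (st _ _ (fun x => - sin x)).
  - by move=> y; apply: is_derive_eq; rewrite subr0.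
  - by rewrite cos0 subrr.
  apply: TN (fun=> erefl) _ => y _.
  by rewrite mulr1 ler_norml sin_geN1 sin_le1.
have c2 : T 2%N (fun x => cos x - 1).
  apply: (st _ _ (fun x => - sin x)).
  - by move=> y; apply: is_derive_eq; rewrite subr0.
  - by rewrite cos0 subrr.
  exact: TN (fun=> erefl) s1.
have s2 : T 2%N (fun x => sin x - x).
  by apply: (st _ _ _ _ _ c1); rewrite sin0 subrr.
have s3 : T 3%N (fun x => sin x - x).
  by apply: (st _ _ _ _ _ c2); rewrite sin0 subrr.
have c3 : T 3%N (fun x => cos x - 1 + x ^+ 2 / 2).
  apply: (st _ _ (fun x => - (sin x - x))).
  - by move=> y; apply: is_derive_eq; rewrite /GRing.scale /=; field.
  - by rewrite cos0 !expr0n /=; field.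
  exact: TN (fun=> erefl) s2.
have c4 : T 4%N (fun x => cos x - 1 + x ^+ 2 / 2).
  apply: (st _ _ (fun x => - (sin x - x))).
  - by move=> y; apply: is_derive_eq; rewrite /GRing.scale /=; field.
  - by rewrite cos0 !expr0n /=; field.
  exact: TN (fun=> erefl) s3.
have s4 : T 4%N (fun x => sin x - x + x ^+ 3 / 6).
  apply: (st _ _ _ _ _ c3).
  - by move=> y; apply: is_derive_eq; rewrite /GRing.scale /=; field.
  - by rewrite sin0 !expr0n /=; field.
have s5 : T 5%N (fun x => sin x - x + x ^+ 3 / 6).
  apply: (st _ _ _ _ _ c4).
  - by move=> y; apply: is_derive_eq; rewrite /GRing.scale /=; field.
  - by rewrite sin0 !expr0n /=; field.
have c5 : T 5%N (fun x => cos x - 1 + x ^+ 2 / 2 - x ^+ 4 / 24).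
  apply: (st _ _ (fun x => - (sin x - x + x ^+ 3 / 6))).
  - by move=> y; apply: is_derive_eq; rewrite /GRing.scale /=; field.
  - by rewrite cos0 !expr0n /=; field.
  exact: TN (fun=> erefl) s4.
move=> x1; have := c5 _ x1; have := s5 _ x1; rewrite !mul1r => h1 h2; split.
  by apply: le_trans h2; rewrite le_eqVlt; apply/orP; left; apply/eqP; congr `|_|; ring.
by apply: le_trans h1; rewrite le_eqVlt; apply/orP; left; apply/eqP; congr `|_|; ring.
Qed.

End RealTaylor.

(** * Asymptotic expansions at 0 *)

Section BigO.
Variable R : realType.
Local Notation C := (cplx R).
Implicit Types (f g h : C -> C).

(* The bound is only required away from 0, so that poles are allowed. *)
Definition Oz (k : nat) g : Prop := exists M r : R,
  [/\ 0 <= M, 0 < r, r <= 1 &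
      forall x, x != 0 -> nm x < r -> nm (g x) <= M * nm x ^+ k].

Lemma OzI k g (M r : R) : 0 < r ->
  (forall x, x != 0 -> nm x < r -> nm (g x) <= M * nm x ^+ k) -> Oz k g.
Proof.
move=> r0 gM; exists `|M|, (Num.min r 1); split=> //.
- by rewrite lt_min r0 ltr01.
- by rewrite ge_min lexx orbT.
move=> x x0; rewrite lt_min => /andP[xr _]; apply: le_trans (gM x x0 xr) _.
by rewrite ler_wpM2r ?exprn_ge0 ?nm_ge0 ?ler_norm.
Qed.

Lemma Oz_near k f g (r : R) : 0 < r ->
  (forall x, x != 0 -> nm x < r -> f x = g x) -> Oz k f -> Oz k g.
Proof.
move=> r0 fg [M [s [M0 s0 s1 fM]]]; apply: (@OzI _ _ M (Num.min r s)).
  by rewrite lt_min r0.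
by move=> x x0; rewrite lt_min => /andP[xr xs]; rewrite -fg ?fM.
Qed.

Lemma Oz_ext k f g : f =1 g -> Oz k f -> Oz k g.
Proof. by move=> fg; apply: (@Oz_near _ _ _ 1) => // x _ _; apply: fg. Qed.

Lemma OzD k f g : Oz k f -> Oz k g -> Oz k (fun x => f x + g x).
Proof.
move=> [M [r [M0 r0 r1 fM]]] [N [s [N0 s0 s1 gN]]].
apply: (@OzI _ _ (M + N) (Num.min r s)); first by rewrite lt_min r0.
move=> x x0; rewrite lt_min => /andP[xr xs]; apply: le_trans (nmD _ _) _.
by rewrite mulrDl lerD ?fM ?gN.
Qed.

Lemma OzN k f : Oz k f -> Oz k (fun x => - f x).
Proof.
by move=> [M [r [M0 r0 r1 fM]]]; exists M, r; split=> // x x0 xr; rewrite nmN fM.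
Qed.

Lemma OzB k f g : Oz k f -> Oz k g -> Oz k (fun x => f x - g x).
Proof. by move=> Of Og; apply: OzD => //; apply: OzN. Qed.

Lemma OzM j k f g : Oz j f -> Oz k g -> Oz (j + k) (fun x => f x * g x).
Proof.
move=> [M [r [M0 r0 r1 fM]]] [N [s [N0 s0 s1 gN]]].
apply: (@OzI _ _ (M * N) (Num.min r s)); first by rewrite lt_min r0.
move=> x x0; rewrite lt_min => /andP[xr xs].
by rewrite nmM exprD mulrACA ler_pM ?nm_ge0 ?fM ?gN.
Qed.

Lemma Oz_le j k f : (k <= j)%N -> Oz j f -> Oz k f.
Proof.
move=> kj [M [r [M0 r0 r1 fM]]]; exists M, r; split=> // x x0 xr.
apply: le_trans (fM x x0 xr) _; rewrite ler_wpM2l //.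
by rewrite ler_wiXn2l ?nm_ge0 // (le_trans (ltW xr)).
Qed.

Lemma Oz_cst c : Oz 0 (fun=> c).
Proof. by apply: (@OzI _ _ (nm c) 1) => // x _ _; rewrite mulr1. Qed.

Lemma Oz_id : Oz 1 id.
Proof. by apply: (@OzI _ _ 1 1) => // x _ _; rewrite expr1 mul1r. Qed.

Lemma OzX k f n : Oz k f -> Oz (n * k) (fun x => f x ^+ n).
Proof.
move=> Of; elim: n => [|n IH]; first exact: Oz_cst.
rewrite mulSn; apply: Oz_ext (OzM Of IH) => x; by rewrite exprS.
Qed.

Lemma Oz_idX n : Oz n (fun x => x ^+ n).
Proof. by rewrite -[n in Oz n]muln1; apply: (OzX (f := id)); exact: Oz_id. Qed.

(** The bound on [g] includes [y = 0], because [h] may vanish away from 0. *)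
Lemma Oz_comp k g h (M r : R) : 0 < r ->
  (forall y, nm y < r -> nm (g y) <= M * nm y ^+ k) ->
  Oz 1 h -> Oz k (fun x => g (h x)).
Proof.
move=> r0 gM [N [s [N0 s0 s1 hN]]].
have N1 : 0 < N + 1 by rewrite ltr_wpDl.
apply: (@OzI _ _ (`|M| * (N + 1) ^+ k) (Num.min s (r / (N + 1)))).
  by rewrite lt_min s0 divr_gt0.
move=> x x0; rewrite lt_min => /andP[xs]; rewrite ltr_pdivlMr // => xr.
have hx : nm (h x) <= (N + 1) * nm x.
  by have := hN x x0 xs; rewrite expr1; have := nm_ge0 x; nra.
apply: (@le_trans _ _ (M * nm (h x) ^+ k)).
  by apply: gM; apply: le_lt_trans hx _; rewrite mulrC.
rewrite -mulrA -exprMn; apply: (@le_trans _ _ (`|M| * nm (h x) ^+ k)).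
  by rewrite ler_wpM2r ?exprn_ge0 ?nm_ge0 ?ler_norm.
by rewrite ler_wpM2l // lerXn2r ?nnegrE ?nm_ge0 ?mulr_ge0 ?nm_ge0 // ltW.
Qed.

Lemma Oz_cst0 k c : (0 < k)%N -> Oz k (fun=> c) -> c = 0.
Proof.
move=> k0 /(Oz_le k0)[M [r [M0 r0 r1 cM]]].
apply/eqP; rewrite -nm_eq0 eq_le nm_ge0 andbT; apply/ler_addgt0Pl => e e0.
have M1 : 0 < M + 1 by rewrite ltr_wpDl.
pose t := Num.min (r / 2) (e / (M + 1)).
have t0 : 0 < t by rewrite lt_min !divr_gt0.
have xt : nm (real_complex R t : C) = t by rewrite nm_real gtr0_norm.
have := cM (real_complex R t); rewrite xt -nm_gt0 xt => /(_ t0).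
have tr : t < r by rewrite gt_min ltr_pdivrMr // ltr_pMr // ltr1n.
have te : t * (M + 1) <= e by rewrite -ler_pdivlMr // ge_min lexx orbT.
move=> /(_ tr)/le_trans; apply; rewrite expr1 addr0; nra.
Qed.

Lemma Oz_divX j k g : Oz (j + k) (fun x => x ^+ j * g x) -> Oz k g.
Proof.
move=> [M [r [M0 r0 r1 fM]]]; exists M, r; split=> // x x0 xr.
have := fM x x0 xr; rewrite nmM nmX exprD mulrCA ler_pM2l //.
by rewrite exprn_gt0 // nm_gt0.
Qed.

(* Coefficient lists rather than polynomials, so that products of explicit
   expansions compute by simplification. *)
Fixpoint hrec (s : seq C) (x : C) : C := if s is c :: s' then c + x * hrec s' x else 0.

Lemma Oz_hrec s : Oz 0 (hrec s).
Proof.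
elim: s => [|c s IH] /=; first exact: Oz_cst.
by apply: OzD (Oz_cst c) _; apply: (Oz_le (leq0n 1)); apply: OzM Oz_id IH.
Qed.

Definition modO k f g := Oz k (fun x => f x - g x).

Lemma modO_refl k f : modO k f f.
Proof.
apply: (@OzI _ _ 0 1) => // x _ _; by rewrite subrr nm0 mul0r.
Qed.

Lemma modO_sym k f g : modO k f g -> modO k g f.
Proof. by move=> /OzN; apply: Oz_ext => x; rewrite opprB. Qed.

Lemma modO_trans k f g h : modO k f g -> modO k g h -> modO k f h.
Proof. by move=> fg gh; apply: Oz_ext (OzD fg gh) => x; rewrite addrA subrK. Qed.

Lemma modOD k f g f' g' : modO k f f' -> modO k g g' ->
  modO k (fun x => f x + g x) (fun x => f' x + g' x).
Proof. by move=> ff gg; apply: Oz_ext (OzD ff gg) => x; rewrite opprD addrACA. Qed.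

Lemma modOM k f g f' g' : Oz 0 f' -> Oz 0 g' -> modO k f f' -> modO k g g' ->
  modO k (fun x => f x * g x) (fun x => f' x * g' x).
Proof.
move=> Of Og ff gg.
have h1 := OzM ff gg; have h2 := OzM Of gg; have h3 := OzM ff Og.
rewrite add0n in h2; rewrite addn0 in h3.
apply: Oz_ext (OzD (OzD (Oz_le (leq_addr k k) h1) h2) h3) => x; ring.
Qed.

(** Uniqueness of expansions: the constant terms agree by [Oz_cst0], and dividing by [x] leaves the
    same problem for the tails. *)
Lemma modO_hrec k s t : modO k (hrec s) (hrec t) -> 
  forall i, (i < k)%N -> nth 0 s i = nth 0 t i.
Proof.
elim: k s t => [//|k IH] s t st i ik.
pose c (u : seq C) : C := nth 0 u 0.
have hE (w : seq C) x : hrec w x = c w + x * hrec (behead w) x.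
  by case: w => [|a w] //=; rewrite /c /= mulr0 addr0.
have c0 : c s - c t = 0.
  apply: (@Oz_cst0 1) => //.
  have O1 := OzM Oz_id (OzB (Oz_hrec (behead s)) (Oz_hrec (behead t))).
  apply: Oz_ext (OzB (Oz_le (ltn0Sn k) st) O1) => x /=.
  rewrite (hE s) (hE t) /=; ring.
case: i ik => [_|i ik]; first by apply/eqP; rewrite -subr_eq0 -/(c s) -/(c t) c0.
rewrite -(nth_behead _ s) -(nth_behead _ t); apply: IH ik; apply: (@Oz_divX 1).
apply: Oz_ext st => x /=; rewrite (hE s) (hE t) expr1.
have -> : c s = c t by apply/eqP; rewrite -subr_eq0 c0.
ring.
Qed.

Fixpoint hadd (s t : seq C) : seq C :=
  match s, t with
  | [::], _ => t
  | _, [::] => s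
  | a :: s', b :: t' => (a + b) :: hadd s' t'
  end.

Fixpoint hmul (s t : seq C) : seq C :=
  if s is a :: s' then hadd [seq a * b | b <- t] (0 :: hmul s' t) else [::].

Lemma hrec_add s t x : hrec (hadd s t) x = hrec s x + hrec t x.
Proof.
elim: s t => [|a s IH] [|b t] //=; rewrite ?add0r ?addr0 // IH; ring.
Qed.

Lemma hrec_scale a s x : hrec [seq a * b | b <- s] x = a * hrec s x.
Proof. by elim: s => [|b s IH] /=; rewrite ?mulr0 // IH; ring. Qed.

Lemma hrec_mul s t x : hrec (hmul s t) x = hrec s x * hrec t x.
Proof.
elim: s => [|a s IH]; first by rewrite /= mul0r.
rewrite /= hrec_add hrec_scale /= IH; ring.
Qed.

Lemma modO_mul k f g s t : modO k f (hrec s) -> modO k g (hrec t) ->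
  modO k (fun x => f x * g x) (hrec (hmul s t)).
Proof.
move=> fs gt; have := modOM (Oz_hrec s) (Oz_hrec t) fs gt.
by apply: Oz_ext => x; rewrite hrec_mul.
Qed.

Lemma modO_add k f g s t : modO k f (hrec s) -> modO k g (hrec t) ->
  modO k (fun x => f x + g x) (hrec (hadd s t)).
Proof.
by move=> fs gt; have := modOD fs gt; apply: Oz_ext => x; rewrite hrec_add.
Qed.

End BigO.

(** * The complex exponential and the primary factor *)

Section ComplexExp.
Variable R : realType.
Local Notation C := (cplx R).
Local Notation cexp := (@cexp R).

Lemma cexp0 : cexp 0 = 1.
Proof. by rewrite /Defs.cexp /= expR0 cos0 sin0 mul1r. Qed.

Lemma cexpD x y : cexp (x + y) = cexp x * cexp y.
Proof.
case: x y => a b [c d]; rewrite /Defs.cexp /= expRD cosD sinD.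
rewrite rmorphM /= mulrACA; congr (_ * _).
by apply/eqP; rewrite eq_complex /=; apply/andP; split; apply/eqP; ring.
Qed.

Lemma cexp_neq0 x : cexp x != 0.
Proof.
have : cexp x * cexp (- x) != 0 by rewrite -cexpD subrr cexp0 oner_neq0.
by rewrite mulf_eq0 negb_or => /andP[].
Qed.

Definition exp4 (x : C) : C := 1 + x + x ^+ 2 / 2 + x ^+ 3 / 6 + x ^+ 4 / 24.

(** Every monomial on the right has total degree at least 5, so [exp4] is multiplicative up to order
    5. *)
Lemma exp4_prod (u v : C) : exp4 u * exp4 v - exp4 (u + v) =
  (u * v ^+ 4 + u ^+ 4 * v) / 24 + (u ^+ 2 * v ^+ 3 + u ^+ 3 * v ^+ 2) / 12 +
  (u ^+ 2 * v ^+ 4 + u ^+ 4 * v ^+ 2) / 48 + u ^+ 3 * v ^+ 3 / 36 +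
  (u ^+ 3 * v ^+ 4 + u ^+ 4 * v ^+ 3) / 144 + u ^+ 4 * v ^+ 4 / 576.
Proof. by rewrite /exp4; field. Qed.

Lemma nm_divn (x : C) (n : nat) : nm (x / n%:R) = nm x / n%:R.
Proof. by rewrite nmM nmV nm_nat. Qed.

Lemma nmD5 (a b c d e : C) :
  nm (a + b + c + d + e) <= nm a + nm b + nm c + nm d + nm e.
Proof.
have := nmD (a + b + c + d) e; have := nmD (a + b + c) d.
by have := nmD (a + b) c; have := nmD a b; lra.
Qed.

Lemma exp4_prod_le (u v : C) (t : R) : nm u <= t -> nm v <= t -> t <= 1 ->
  nm (exp4 u * exp4 v - exp4 (u + v)) <= t ^+ 5.
Proof.
move=> ut vt t1; have t0 : 0 <= t by apply: le_trans ut; apply: nm_ge0.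
have mon (j k : nat) : (5 <= j + k)%N -> nm (u ^+ j * v ^+ k) <= t ^+ 5.
  move=> jk; rewrite nmM !nmX; apply: (@le_trans _ _ (t ^+ j * t ^+ k)).
    by rewrite ler_pM ?exprn_ge0 ?nm_ge0 // lerXn2r ?nnegrE ?nm_ge0.
  by rewrite -exprD ler_wiXn2l.
have add (x y : C) (a b : R) : nm x <= a -> nm y <= b -> nm (x + y) <= a + b.
  by move=> xa yb; apply: le_trans (nmD _ _) _; apply: lerD.
have dv (x : C) (a : R) (n : nat) : nm x <= a -> nm (x / n%:R) <= a / n%:R.
  by move=> xa; rewrite nm_divn ler_wpM2r // invr_ge0.
have T0 : 0 <= t ^+ 5 by rewrite exprn_ge0.
rewrite exp4_prod; set T := t ^+ 5 in mon T0 *.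
have m1 : nm (u * v ^+ 4) <= T by apply: (mon 1%N 4%N).
have m2 : nm (u ^+ 4 * v) <= T by apply: (mon 4%N 1%N).
apply: le_trans (add _ _ _ _ (add _ _ _ _ (add _ _ _ _ (add _ _ _ _ (add _ _ _ _
   (dv _ _ 24%N (add _ _ _ _ m1 m2))
   (dv _ _ 12%N (add _ _ _ _ (mon 2%N 3%N isT) (mon 3%N 2%N isT))))
   (dv _ _ 48%N (add _ _ _ _ (mon 2%N 4%N isT) (mon 4%N 2%N isT))))
   (dv _ _ 36%N (mon 3%N 3%N isT)))
   (dv _ _ 144%N (add _ _ _ _ (mon 3%N 4%N isT) (mon 4%N 3%N isT))))
   (dv _ _ 576%N (mon 4%N 4%N isT))) _.
lra.
Qed.

Local Notation rc x := (real_complex R x : C).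

Lemma rcD (a b : R) : rc (a + b) = rc a + rc b.
Proof. exact: rmorphD. Qed.

Lemma rcN (a : R) : rc (- a) = - rc a.
Proof. exact: rmorphN. Qed.

Lemma rcB (a b : R) : rc (a - b) = rc a - rc b.
Proof. exact: rmorphB. Qed.

Lemma rcM (a b : R) : rc (a * b) = rc a * rc b.
Proof. exact: rmorphM. Qed.

Lemma rcX (a : R) (n : nat) : rc (a ^+ n) = rc a ^+ n.
Proof. exact: rmorphXn. Qed.

Lemma rc_divn (a : R) (n : nat) : rc (a / n%:R) = rc a / n%:R.
Proof. by rewrite rcM; congr (_ * _); rewrite fmorphV rmorph_nat. Qed.

(** With $y=u+v$ split into real and imaginary parts, $e^u$ and $e^v$ are compared with their
    truncations separately, and [exp4_prod_le] recombines these. *)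
Lemma cexp_taylor : exists2 M : R, 0 <= M & forall y : C, nm y <= 1 ->
  nm (cexp y - exp4 y) <= M * nm y ^+ 5.
Proof.
have [M M0 hM] := expR_taylor R.
(* The 1 comes from [exp4_prod_le], 5 bounds [exp4] on the unit disc, and the 2 is the error
   constant of [F]. *)
exists (1 + 5 * M + 2 * (M + 5)) => [|y y1]; first by lra.
pose u : C := real_complex R (complex.Re y).
pose v : C := 'i%C * real_complex R (complex.Im y).
have yE : y = u + v by rewrite {1}[y]complexE.
have i1 : nm ('i%C : C) = 1 by rewrite /nm /= expr0n expr1n /= add0r sqrtr1.
have nu : nm u = `|complex.Re y| by rewrite nm_real.
have nv : nm v = `|complex.Im y| by rewrite nmM i1 mul1r nm_real.
have uy : nm u <= nm y by rewrite nu nm_Re.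
have vy : nm v <= nm y by rewrite nv nm_Im.
pose E : C := real_complex R (expR (complex.Re y)).
pose F : C := (cos (complex.Im y) +i* sin (complex.Im y))%C.
have cE : cexp y = E * F by [].
have i2 : ('i%C : C) ^+ 2 = -1 by rewrite sqr_i.
have hE : nm (E - exp4 u) <= M * nm y ^+ 5.
  have -> : E - exp4 u = real_complex R (expR (complex.Re y) - (1 + complex.Re y +
    complex.Re y ^+ 2 / 2 + complex.Re y ^+ 3 / 6 + complex.Re y ^+ 4 / 24)).
    by rewrite /exp4 /u rcB !rcD !rc_divn !rcX.
  rewrite nm_real; apply: le_trans (hM _ _) _; first exact: le_trans (nm_Re _) y1.
  by rewrite ler_wpM2l // lerXn2r ?nnegrE ?nm_ge0 ?nm_Re.
have hF : nm (F - exp4 v) <= 2 * nm y ^+ 5.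
  have [h1 h2] := cos_sin_taylor (le_trans (nm_Im y) y1).
  have b5 : `|complex.Im y| ^+ 5 <= nm y ^+ 5.
    by rewrite lerXn2r ?nnegrE ?nm_ge0 ?nm_Im.
  have {h1} h1 := le_trans h1 b5; have {h2} h2 := le_trans h2 b5.
  pose b := complex.Im y; rewrite -/b in h1 h2.
  have -> : F - exp4 v = real_complex R (cos b - (1 - b ^+ 2 / 2 + b ^+ 4 / 24))
    + 'i%C * real_complex R (sin b - (b - b ^+ 3 / 6)).
    rewrite !(rcD, rcN) !rc_divn !rcX.
    have -> : rc 1 = 1 by [].
    have -> : F = real_complex R (cos b) + 'i%C * real_complex R (sin b).
      exact: (complexE F).
    rewrite /exp4 /v -/b !exprMn.
    have -> : ('i%C : C) ^+ 3 = - 'i%C by rewrite exprS i2 mulrN1.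
    have -> : ('i%C : C) ^+ 4 = 1 by rewrite -[4%N]/(2 * 2)%N exprM i2 sqrrN expr1n.
    by rewrite i2; field.
  apply: le_trans (nmD _ _) _; rewrite nmM i1 mul1r !nm_real; lra.
have e5 (x : C) : nm x <= 1 -> nm (exp4 x) <= 5.
  move=> x1; have xk k : nm (x ^+ k) <= 1.
    by rewrite nmX exprn_ile1 ?nm_ge0.
  have dv (z : C) (n : nat) : (0 < n)%N -> nm z <= 1 -> nm (z / n%:R) <= 1.
    move=> n0 z1; rewrite nm_divn ler_pdivrMr ?ltr0n // mul1r.
    by apply: le_trans z1 _; rewrite ler1n.
  rewrite /exp4; apply: le_trans (nmD5 _ _ _ _ _) _; rewrite nm1.
  have := dv _ 2%N isT (xk 2%N); have := dv _ 6%N isT (xk 3%N).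
  have := dv _ 24%N isT (xk 4%N); lra.
have -> : cexp y - exp4 y = (exp4 u * exp4 v - exp4 (u + v))
   + (E - exp4 u) * exp4 v + (E - exp4 u) * (F - exp4 v) + exp4 u * (F - exp4 v).
  rewrite cE {1}yE; ring.
have u1 := le_trans uy y1; have v1 := le_trans vy y1.
have h0 := exp4_prod_le uy vy y1.
have y5 : 0 <= nm y ^+ 5 by rewrite exprn_ge0 ?nm_ge0.
have y51 : nm y ^+ 5 <= 1 by rewrite exprn_ile1 ?nm_ge0.
apply: le_trans (nmD _ _) _; apply: le_trans (lerD (nmD _ _) (lexx _)) _.
apply: le_trans (lerD (lerD (nmD _ _) (lexx _)) (lexx _)) _; rewrite !nmM.
have p1 := nm_ge0 (E - exp4 u); have p2 := nm_ge0 (F - exp4 v).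
have p3 := nm_ge0 (exp4 u); have p4 := nm_ge0 (exp4 v).
have q1 := ler_pM p1 p4 hE (e5 _ v1).
have q2 := ler_pM p3 p2 (e5 _ u1) hF.
have q3 := ler_pM p1 p2 hE hF.
set Y := nm y ^+ 5 in hE hF h0 y5 y51 q1 q2 q3 *.
have := ler_wpM2l (mulr_ge0 M0 y5) y51; lra.
Qed.

Lemma cexp_lip : exists2 M : R, 0 <= M & forall y : C, nm y <= 1 ->
  nm (cexp y - 1) <= M * nm y.
Proof.
have [M M0 hM] := cexp_taylor; exists (M + 4) => [|y y1]; first by lra.
have y0 := nm_ge0 y.
have hk k : nm (y ^+ k.+1) <= nm y.
  by rewrite nmX exprSr ler_piMl // exprn_ile1.
have dv (z : C) (n : nat) : (0 < n)%N -> nm z <= nm y -> nm (z / n%:R) <= nm y.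
  move=> n0 z1; rewrite nm_divn ler_pdivrMr ?ltr0n //.
  by apply: le_trans z1 _; rewrite ler_peMr // ler1n.
have -> : cexp y - 1 = (cexp y - exp4 y) + y + y ^+ 2 / 2 + y ^+ 3 / 6 + y ^+ 4 / 24.
  rewrite /exp4; ring.
apply: le_trans (nmD5 _ _ _ _ _) _.
have := dv _ 2%N isT (hk 1%N); have := dv _ 6%N isT (hk 2%N).
have := dv _ 24%N isT (hk 3%N); have := hM y y1.
have : M * nm y ^+ 5 <= M * nm y by rewrite ler_wpM2l // -nmX hk.
lra.
Qed.

Lemma cvs_cexp (u : nat -> C) (l : C) : cvs u l -> cvs (fun n => cexp (u n)) (cexp l).
Proof.
move=> ul; have [M M0 hM] := cexp_lip.
suff h : cvs (fun n => cexp (u n - l)) 1.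
  have := cvsM (cvs_cst (cexp l)) h; rewrite mulr1.
  by apply: cvs_ext => n; rewrite -cexpD addrC subrK.
move=> e e0; have M1 : 0 < M + 1 by lra.
have [|N hN] := ul (Num.min 1 (e / (M + 1))); first by rewrite lt_min ltr01 divr_gt0.
exists N => n /hN; rewrite lt_min => /andP[/ltW h1]; rewrite ltr_pdivlMr // => h2.
apply: le_lt_trans (hM _ h1) _; apply: le_lt_trans h2.
by have := nm_ge0 (u n - l); nra.
Qed.

(** The Weierstrass primary factor of genus 2. Its logarithm $-y^3/3-y^4/4-\dots$ begins in degree
    3, whence cubic decay over a lattice. *)
Definition E2 (y : C) : C := (1 - y) * cexp (y + y ^+ 2 / 2).

Lemma E2_taylor : exists2 M : R, 0 <= M & forall y : C, nm y <= 1 / 2 ->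
  nm (E2 y - (1 - y ^+ 3 / 3 - y ^+ 4 / 4)) <= M * nm y ^+ 5.
Proof.
have [M M0 hM] := cexp_taylor.
(* Here $|h|\le 2|y|$ contributes $2^5$ and $|1-y|\le 2$ doubles it; the final 1 bounds the explicit
   polynomial remainder. *)
exists (64 * M + 1) => [|y y1]; first by lra.
have y0 := nm_ge0 y.
pose h := y + y ^+ 2 / 2.
have hy : nm h <= 2 * nm y.
  apply: le_trans (nmD _ _) _; rewrite nm_divn nmX; nra.
have h5 : nm (cexp h - exp4 h) <= M * (32 * nm y ^+ 5).
  apply: le_trans (hM _ _) _; first lra.
  rewrite ler_wpM2l //; have -> : 32 * nm y ^+ 5 = (2 * nm y) ^+ 5 by ring.
  by rewrite lerXn2r ?nnegrE ?nm_ge0 // mulr_ge0.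
have -> : E2 y - (1 - y ^+ 3 / 3 - y ^+ 4 / 4) = (1 - y) * (cexp h - exp4 h)
  - y ^+ 5 * (5 / 24 + y / 8 + y ^+ 2 / 16 + 7 * y ^+ 3 / 384 + y ^+ 4 / 384).
  by rewrite /E2 -/h /exp4 /h; field.
have yk (k : nat) : nm (y ^+ k) <= 1.
  by rewrite nmX exprn_ile1 //; lra.
have q : nm (5 / 24 + y / 8 + y ^+ 2 / 16 + 7 * y ^+ 3 / 384 + y ^+ 4 / 384) <= 1.
  apply: le_trans (nmD5 _ _ _ _ _) _; rewrite !nm_divn nmM !nm_nat.
  have := yk 2%N; have := yk 3%N; have := yk 4%N; lra.
apply: le_trans (nmD _ _) _.
rewrite nmN [nm ((1 - y) * _)]nmM [nm (y ^+ 5 * _)]nmM [nm (y ^+ 5)]nmX.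
have a1 : nm (1 - y) <= 2.
  by apply: le_trans (nmD _ _) _; rewrite nmN nm1; lra.
have := ler_pM (nm_ge0 _) (nm_ge0 _) a1 h5.
have y5 : 0 <= nm y ^+ 5 by rewrite exprn_ge0.
have := ler_wpM2l y5 q; lra.
Qed.

End ComplexExp.

(** * Weierstrass products *)

Section WeierstrassProducts.
Variable R : realType.
Local Notation C := (cplx R).

(** The two bounds go through one induction, since the quadratic one at the next factor uses the
    linear one. *)
Lemma prod_1D_le (I : Type) (s : seq I) (u : I -> C) :
  \sum_(i <- s) nm (u i) <= 1 ->
  nm (\prod_(i <- s) (1 + u i) - 1 - \sum_(i <- s) u i) <= (\sum_(i <- s) nm (u i)) ^+ 2
  /\ nm (\prod_(i <- s) (1 + u i) - 1) <= 2 * \sum_(i <- s) nm (u i).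
Proof.
elim: s => [|a s IH].
  by rewrite !big_nil subrr subr0 nm0 expr0n mulr0.
rewrite !big_cons; set P := \prod_(i <- s) _; set S := \sum_(i <- s) u i.
set T := \sum_(i <- s) nm (u i) => h; rewrite -/T -/P -/S in IH.
have a0 := nm_ge0 (u a).
have T0 : 0 <= T by apply: sumr_ge0 => i _; apply: nm_ge0.
have [|h1 h2] := IH; first by lra.
have e1 : (1 + u a) * P - 1 - (u a + S) = (P - 1 - S) + u a * (P - 1) by ring.
have h3 : nm ((1 + u a) * P - 1 - (u a + S)) <= (nm (u a) + T) ^+ 2.
  rewrite e1; apply: le_trans (nmD _ _) _; rewrite nmM.
  have := ler_wpM2l a0 h2; nra.
split=> //; have -> : (1 + u a) * P - 1 = ((1 + u a) * P - 1 - (u a + S)) + (u a + S) by ring.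
apply: le_trans (nmD _ _) _; have := nmD (u a) S.
have : nm S <= T by apply: nm_sum.
nra.
Qed.

Lemma box_prod (G : int * int -> C) N M : (N <= M)%N ->
  \prod_(p <- box M) G p
    = \prod_(p <- box N) G p * \prod_(p <- box M | (N < sz p)%N) G p.
Proof.
move=> NM; have -> : \prod_(p <- box N) G p = \prod_(p <- box M | ~~ (N < sz p)%N) G p.
  rewrite -[RHS]big_filter; apply: perm_big.
  apply: uniq_perm; [exact: box_uniq|exact/filter_uniq/box_uniq|move=> p].
  rewrite mem_box mem_filter mem_box -leqNgt; case: (p != _); rewrite ?andbF //=.
  by case: leqP => //= h; rewrite (leq_trans h NM).
by rewrite (bigID (fun p => N < sz p)%N) /= mulrC.
Qed.

Section Product.
Variables (V : int * int -> C) (c : R).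
Hypothesis c0 : 0 < c.
Hypothesis Vc : forall p, p != (0, 0) -> nm (V p) * (sz p)%:R <= c.

Lemma pow_cubic (k : nat) : (3 <= k)%N -> cubic (c ^+ k) (fun p => V p ^+ k).
Proof.
move=> k3; have := mixed_cubic (k := 0) Vc Vc (_ : 3 <= k + 0)%N.
rewrite addn0 => /(_ k3); apply: eq_cubic => p _; exact: mulr1.
Qed.

(** The family [V] is kept abstract because it serves twice: inverse periods give [wsigma], and
    inverses of [z - w] give the denominator product. *)
Definition pprod (x : C) (N : nat) : C := \prod_(p <- box N) E2 (x * V p).

Definition lprod (x : C) : C := lim (pprod x @ \oo)%classic.

Lemma E2_near1 : exists2 M : R, 0 <= M & forall y : C, nm y <= 1 / 2 ->
  nm (E2 y - 1) <= M * nm y ^+ 3.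
Proof.
have [M M0 hM] := E2_taylor R; exists (M + 1) => [|y y1]; first by lra.
have y0 := nm_ge0 y.
have -> : E2 y - 1 = (E2 y - (1 - y ^+ 3 / 3 - y ^+ 4 / 4)) - (y ^+ 3 / 3 + y ^+ 4 / 4).
  by ring.
apply: le_trans (nmD _ _) _; rewrite nmN.
have := nmD (y ^+ 3 / 3) (y ^+ 4 / 4); rewrite !nm_divn !nmX.
have y3 : 0 <= nm y ^+ 3 by rewrite exprn_ge0.
have y4 : nm y ^+ 4 <= nm y ^+ 3 by rewrite ler_wiXn2l //; lra.
have y5 : nm y ^+ 5 <= nm y ^+ 3 by rewrite ler_wiXn2l //; lra.
have := ler_wpM2l M0 y5; have := hM y y1; lra.
Qed.

(** [E2_near1] needs $|xV_p|\le 1/2$, which holds outside a box; the finitely many other terms are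
    replaced by 0. *)
Lemma factor_cubic (x : C) : exists B : R, exists2 N0 : nat, (0 < N0)%N &
  cubic B (fun p => if (N0 < sz p)%N then E2 (x * V p) - 1 else 0).
Proof.
have [M M0 hM] := E2_near1.
have [N0 N00 hN] := small_inv (nm x * c) (divr_gt0 ltr01 (ltr0n R 2)).
exists (M * (nm x ^+ 3 * c ^+ 3)), N0 => // p p0; case: ifP => [hp|_]; last first.
  by rewrite nm0 !mulr_ge0 ?exprn_ge0 ?nm_ge0 ?(ltW c0) // invr_ge0 exprn_ge0.
have s0 : (0 : R) < (sz p)%:R by rewrite ltr0n sz_gt0.
apply: le_trans (hM _ _) _; last first.
  rewrite -mulrA ler_wpM2l // nmM exprMn -mulrA ler_wpM2l ?exprn_ge0 ?nm_ge0 //.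
  by have := pow_cubic (leqnn 3) p0; rewrite nmX.
rewrite nmM; apply: le_trans (ltW hN).
rewrite -mulrA ler_wpM2l ?nm_ge0 //; apply: (@le_trans _ _ (c / (sz p)%:R)).
  by rewrite ler_pdivlMr ?Vc.
by rewrite ler_wpM2l ?(ltW c0) // lef_pV2 ?posrE ?(ltr0n _ N0) // ler_nat ltnW.
Qed.

(** Of the two bounds on the quotient, the one in [B / N] gives the Cauchy property and the one by
    [1 / 2] keeps partial products away from 0. *)
Lemma pprod_tail (x : C) : exists B : R, exists2 N0 : nat, (0 < N0)%N &
  forall N M, (N0 <= N)%N -> (N <= M)%N -> exists2 q : C,
    pprod x M = pprod x N * q & nm (q - 1) <= B / N%:R /\ nm (q - 1) <= 1 / 2.
Proof.
have [B [N0 N00 FB]] := factor_cubic x; have B0 := cubic_ge0 FB.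
have [N1 N10 hN1] := small_inv (16 * B) (divr_gt0 ltr01 (ltr0n R 2)).
exists (16 * B), (maxn N0 N1) => [|N M]; first by lia.
rewrite geq_max => /andP[NN0 NN1] NM.
have N0' : (0 < N)%N by lia.
exists (\prod_(p <- box M | (N < sz p)%N) E2 (x * V p)); first exact: box_prod.
rewrite -big_filter; set s := [seq _ <- _ | _].
pose u p := E2 (x * V p) - 1.
have -> : \prod_(p <- s) E2 (x * V p) = \prod_(p <- s) (1 + u p).
  by apply: eq_bigr => p _; rewrite addrC subrK.
have su : \sum_(p <- s) nm (u p) <= 8 * B / N%:R.
  apply: le_trans (sum_cubic_tail M N0' FB).
  rewrite big_filter; apply: ler_sum => p hp.
  by rewrite (leq_ltn_trans NN0 hp).
have b1 : 16 * B / N%:R <= 1 / 2.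
  apply: le_trans (ltW hN1); rewrite ler_wpM2l ?mulr_ge0 //.
  by rewrite lef_pV2 ?posrE ?ltr0n // ler_nat.
have e : 16 * B / N%:R = 2 * (8 * B / N%:R) by rewrite !mulrA; congr (_ * _ / _); lra.
have [|_ h] := @prod_1D_le _ s u; first by lra.
split; apply: le_trans h _; lra.
Qed.

Lemma lprod_cvs (x : C) : cvs (pprod x) (lprod x).
Proof.
have [B [N0 N00 hB]] := pprod_tail x.
suff [l hl] : exists l, cvs (pprod x) l by rewrite /lprod (cvs_lim hl).
apply: cvs_cauchy => e e0.
pose P := nm (pprod x N0).
have PN N : (N0 <= N)%N -> nm (pprod x N) <= 2 * P.
  move=> hN; have [q -> [_ hq]] := hB N0 N (leqnn _) hN.
  rewrite nmM mulrC ler_wpM2r ?nm_ge0 //; have := nm_rev q 1; rewrite nm1; lra.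
have [N1 N10 hN1] := small_inv (2 * P * B) e0.
exists (maxn N0 N1) => n m; rewrite geq_max => /andP[n0 n1] nm'.
have [q -> [hq _]] := hB n m n0 nm'.
rewrite -{2}[pprod x n]mulr1 -mulrBr nmM; apply: le_trans (ltW hN1).
have n0' : (0 < n)%N by lia.
have Bn : 0 <= B / n%:R by apply: le_trans hq; apply: nm_ge0.
have B0 : 0 <= B by move: Bn; rewrite pmulr_lge0 // invr_gt0 ltr0n.
apply: (@le_trans _ _ (2 * P * (B / n%:R))); first by rewrite ler_pM ?nm_ge0 ?PN.
rewrite -[leRHS]mulrA ler_wpM2l ?mulr_ge0 ?nm_ge0 // ler_wpM2l //.
by rewrite lef_pV2 ?posrE ?ltr0n // ler_nat.
Qed.

(** The limit differs from a nonzero partial product by at most half its norm. *)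
Lemma lprod_neq0 (x : C) : (forall p, p != (0, 0) -> x * V p != 1) -> lprod x != 0.
Proof.
move=> xV; have [B [N0 N00 hB]] := pprod_tail x.
have P0 : pprod x N0 != 0.
  rewrite prodf_seq_neq0; apply/allP => p; rewrite mem_box => /andP[p0 _].
  by rewrite /= mulf_neq0 ?cexp_neq0 // subr_eq0 eq_sym xV.
have h : nm (lprod x - pprod x N0) <= nm (pprod x N0) * (1 / 2).
  apply: (cvs_le (N := N0) (lprod_cvs x)) => n hn.
  have [q -> [_ hq]] := hB N0 n (leqnn _) hn.
  by rewrite -{2}[pprod x N0]mulr1 -mulrBr nmM ler_wpM2l ?nm_ge0.
rewrite -nm_gt0; move: P0; rewrite -nm_gt0.
have := nm_rev (pprod x N0) (lprod x); rewrite nmB; lra.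
Qed.

(** With [u] the deviation of a factor from 1, the product is $1+\sum u$ up to $(\sum|u|)^2=O(x^6)$,
    and $\sum u$ is expanded termwise by [E2_taylor]. *)
Lemma lprod_taylor : modO 5 lprod
  (hrec [:: 1; 0; 0; - lsum (fun p => V p ^+ 3) / 3; - lsum (fun p => V p ^+ 4) / 4]).
Proof.
have [M1 M10 hM1] := E2_near1; have [M M0 hM] := E2_taylor R.
pose B := M1 * c ^+ 3.
have B0 : 0 <= B by rewrite mulr_ge0 ?exprn_ge0 // ltW.
have B1 : 0 < 16 * B + 1 by lra.
(* The first bound puts all the arguments [x * V p] in the range of [E2_taylor]; the last makes
   $\sum|u|\le 1$ for [prod_1D_le]. *)
pose r : R := Num.min (1 / (2 * c)) (Num.min 1 (1 / (16 * B + 1))).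
apply: (@OzI _ _ _ ((16 * B) ^+ 2 + 16 * (M * c ^+ 5)) r).
  by rewrite !lt_min ltr01 !divr_gt0 ?mulr_gt0.
move=> x x0; rewrite !lt_min => /and3P[xc x1 xB].
have n0 := nm_ge0 x.
have xc' : nm x * c <= 1 / 2.
  by move: (ltW xc); rewrite ler_pdivlMr ?mulr_gt0 //; lra.
have xB' : 16 * B * nm x <= 1.
  by move: (ltW xB); rewrite ler_pdivlMr //; nra.
have small p : p != (0, 0) -> nm (x * V p) <= 1 / 2.
  move=> p0; apply: le_trans xc'; rewrite nmM ler_wpM2l //.
  have s1 : (1 : R) <= (sz p)%:R by rewrite ler1n sz_gt0.
  by have := Vc p0; have := nm_ge0 (V p); nra.
pose u p := E2 (x * V p) - 1.
have uB : cubic (B * nm x ^+ 3) u.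
  move=> p p0; apply: le_trans (hM1 _ (small p p0)) _.
  have := pow_cubic (leqnn 3) p0; rewrite nmX => h.
  have -> : M1 * nm (x * V p) ^+ 3 = M1 * nm x ^+ 3 * nm (V p) ^+ 3 by rewrite nmM; ring.
  have -> : B * nm x ^+ 3 / (sz p)%:R ^+ 3 = M1 * nm x ^+ 3 * (c ^+ 3 / (sz p)%:R ^+ 3).
    by rewrite /B; ring.
  by rewrite ler_wpM2l // mulr_ge0 ?exprn_ge0.
pose r5 p := u p - (- (x ^+ 3 / 3) * V p ^+ 3 + - (x ^+ 4 / 4) * V p ^+ 4).
have rB : cubic (nm x ^+ 5 * (M * c ^+ 5)) r5.
  move=> p p0; have := hM _ (small p p0).
  have -> : E2 (x * V p) - (1 - (x * V p) ^+ 3 / 3 - (x * V p) ^+ 4 / 4) = r5 p.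
    by rewrite /r5 /u; field.
  move/le_trans; apply; have := pow_cubic (isT : 3 <= 5)%N p0; rewrite nmX => h.
  have -> : M * nm (x * V p) ^+ 5 = M * nm x ^+ 5 * nm (V p) ^+ 5 by rewrite nmM; ring.
  have -> : nm x ^+ 5 * (M * c ^+ 5) / (sz p)%:R ^+ 3
      = M * nm x ^+ 5 * (c ^+ 5 / (sz p)%:R ^+ 3) by ring.
  by rewrite ler_wpM2l // mulr_ge0 ?exprn_ge0.
pose w := hrec [:: 1; 0; 0; - lsum (fun p => V p ^+ 3) / 3; - lsum (fun p => V p ^+ 4) / 4].
have su N : \sum_(p <- box N) nm (u p) <= 16 * B * nm x ^+ 3.
  by apply: le_trans (sum_cubic_le N uB) _; rewrite mulrA.
have x3 : nm x ^+ 3 <= nm x by rewrite -[leRHS]expr1 ler_wiXn2l // ltW.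
have B16 : 0 <= 16 * B by lra.
have su1 N : \sum_(p <- box N) nm (u p) <= 1.
  apply: le_trans (su N) _; apply: le_trans xB'.
  exact: ler_wpM2l x3.
have pE N : pprod x N = \prod_(p <- box N) (1 + u p).
  by apply: eq_bigr => p _; rewrite addrC subrK.
have h1 N : nm (pprod x N - 1 - psum u N) <= (16 * B) ^+ 2 * nm x ^+ 5.
  rewrite pE; have [h _] := prod_1D_le (su1 N); apply: le_trans h _.
  apply: (@le_trans _ _ ((16 * B * nm x ^+ 3) ^+ 2)).
    have x30 := exprn_ge0 3 n0.
    rewrite lerXn2r ?nnegrE ?(mulr_ge0 B16 x30) ?su // sumr_ge0 // => p _.
    exact: nm_ge0.
  rewrite exprMn -exprM ler_wpM2l ?sqr_ge0 //.
  by rewrite ler_wiXn2l // (ltW x1).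
have h2 := cvs_le0 (cvsB (cvsB (lprod_cvs x) (cvs_cst 1)) (lsum_cvs uB)) h1.
have c3 := pow_cubic (leqnn 3); have c4 := pow_cubic (isT : 3 <= 4)%N.
have h3 := lsum_le rB.
have uE : lsum u = lsum r5 + (- (x ^+ 3 / 3) * lsum (fun p => V p ^+ 3)
    + - (x ^+ 4 / 4) * lsum (fun p => V p ^+ 4)).
  have [B2 c34] := cubic2 (- (x ^+ 3 / 3)) (- (x ^+ 4 / 4)) c3 c4.
  rewrite -(lsum2 _ _ c3 c4) -(lsumD rB c34).
  by apply: eq_lsum => p _; rewrite /r5 subrK.
have -> : lprod x - w x = (lprod x - 1 - lsum u) + lsum r5.
  by rewrite uE /w /=; field.
apply: le_trans (nmD _ _) _; lra.
Qed.

End Product.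
End WeierstrassProducts.

(** * Power series as asymptotic expansions *)

Section PowerSeries.
Variable R : realType.
Local Notation C := (cplx R).

Lemma near0P (P : C -> Prop) : (\forall x \near (0 : C), P x)%classic ->
  exists2 r : R, 0 < r & forall x, nm x < r -> P x.
Proof.
move=> /nbhs_ballP[_ /posC[r r0 ->] h]; exists r => // x xr; apply: h.
by rewrite -ball_normE /ball_ /= sub0r normrN ltc_nm.
Qed.

Lemma expands_cvs (f : C -> C) (a : nat -> C) : expands_at0 f a ->
  exists2 r : R, 0 < r & forall x, nm x < r -> cvs (fun n => \sum_(i < n) a i * x ^+ i) (f x).
Proof.
move=> /near0P[r r0 h]; exists r => // x /h /cvs_cvg.
by apply: cvs_ext => n; rewrite /series /= big_mkord.
Qed.

Lemma hrec_mkseq (a : nat -> C) k x : hrec (mkseq a k) x = \sum_(i < k) a i * x ^+ i.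
Proof.
elim: k a => [|k IH] a; first by rewrite big_ord0.
rewrite big_ord_recl expr0 mulr1 /mkseq /= (iotaDl 1 0) -map_comp /=.
rewrite -[map _ _]/(mkseq (fun i => a i.+1) k) IH mulr_sumr; congr (_ + _).
by apply: eq_bigr => i _; rewrite exprS mulrCA.
Qed.

Lemma geo_sum_le (q : R) k n : 0 <= q -> q <= 1 / 2 ->
  \sum_(k <= i < n) q ^+ i <= 2 * q ^+ k.
Proof.
move=> q0 q1; have qk m : 0 <= q ^+ m by rewrite exprn_ge0.
case: (leqP k n) => [kn|/ltnW nk]; last by rewrite big_geq // mulr_ge0.
suff : \sum_(k <= i < n) q ^+ i <= 2 * q ^+ k - 2 * q ^+ n by have := qk n; lra.
elim: n kn => [|n IH] kn.
  by move: kn; rewrite leqn0 => /eqP ->; rewrite big_geq // subrr.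
move: kn; rewrite leq_eqVlt => /orP[/eqP->|kn]; first by rewrite big_geq // subrr.
rewrite big_nat_recr //=; have := IH kn; rewrite exprS; have := qk n; nra.
Qed.

(** Convergence at the single point [s] bounds [nm (a n) * s ^+ n]; on the disc of radius [s / 2]
    the tail is then dominated by a geometric series. *)
Lemma expands_modO (f : C -> C) (a : nat -> C) k :
  expands_at0 f a -> modO k f (hrec (mkseq a k)).
Proof.
move=> /expands_cvs[r r0 h].
pose s : R := r / 2; have s0 : 0 < s by rewrite divr_gt0.
have sr : nm (real_complex R s : C) < r.
  by rewrite nm_real gtr0_norm // /s ltr_pdivrMr // ltr_pMr // ltr1n.
have [B aB] : exists B, forall n, nm (a n) * s ^+ n <= B.
  have [B hB] := cvs_bounded (h _ sr); exists (B + B) => n.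
  have := hB n.+1; rewrite big_ord_recr /=; have := hB n.
  set u := \sum_(i < n) _; set v := a n * _ => h1 h2.
  have -> : nm (a n) * s ^+ n = nm v by rewrite nmM nmX nm_real gtr0_norm.
  have := nm_rev v (- u); rewrite nmN opprK [v + u]addrC; lra.
have B0 : 0 <= B by apply: le_trans (aB 0%N); rewrite mulr_ge0 ?nm_ge0 ?exprn_ge0 ?ltW.
apply: (@OzI _ _ _ (2 * B / s ^+ k) (s / 2)); first by rewrite divr_gt0.
move=> x x0 xs; rewrite hrec_mkseq.
have xr : nm x < r by rewrite /s in xs; lra.
apply: (cvs_le (N := k) (h x xr)) => n kn.
rewrite -(big_mkord xpredT (fun i => a i * x ^+ i)) -(big_mkord xpredT (fun i => a i * x ^+ i)).
rewrite (big_cat_nat _ (n := k)) //= addrAC subrr add0r.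
apply: le_trans (nm_sum _ _) _.
pose q := nm x / s.
have q0 : 0 <= q by rewrite divr_ge0 ?nm_ge0 // ltW.
have q1 : q <= 1 / 2 by rewrite ler_pdivrMr //; lra.
apply: (@le_trans _ _ (\sum_(k <= i < n) B * q ^+ i)).
  apply: ler_sum => i _; rewrite nmM nmX.
  have -> : nm (a i) * nm x ^+ i = nm (a i) * s ^+ i * q ^+ i.
    by rewrite -mulrA -exprMn /q mulrCA divff ?mulr1 // gt_eqF.
  by rewrite ler_wpM2r ?exprn_ge0.
rewrite -mulr_sumr; have := ler_wpM2l B0 (geo_sum_le k n q0 q1).
move/le_trans; apply; rewrite /q expr_div_n.
by rewrite le_eqVlt; apply/orP; left; apply/eqP; ring.
Qed.

End PowerSeries.

(** * Lattices and the Krichever function *)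

Section Lattice.
Variable R : realType.
Local Notation C := (cplx R).
Variables (w1 w2 : C) (d : R).
Hypothesis d0 : 0 < d.
Hypothesis lower : forall p, d * (sz p)%:R <= nm (period w1 w2 p).

Definition pinv (p : int * int) : C := (period w1 w2 p)^-1.
Definition dinv (z : C) (p : int * int) : C := (z - period w1 w2 p)^-1.

Lemma period_neq0 p : p != (0, 0) -> period w1 w2 p != 0.
Proof.
move=> p0; rewrite -nm_gt0; apply: lt_le_trans (lower p).
by rewrite mulr_gt0 // ltr0n sz_gt0.
Qed.

(** Restricting to $|z|\le d/2$ keeps [z] away from all nonzero periods proportionally to [sz p],
    which makes later estimates uniform. *)
Lemma period_dist (z : C) p : nm z <= d / 2 -> p != (0, 0) ->
  d / 2 * (sz p)%:R <= nm (z - period w1 w2 p).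
Proof.
move=> zd p0; have s1 : (1 : R) <= (sz p)%:R by rewrite ler1n sz_gt0.
have ds : 0 <= d * ((sz p)%:R - 1) by rewrite mulr_ge0 ?subr_ge0 // ltW.
by have := lower p; have := nm_rev (period w1 w2 p) z; rewrite [nm (z - _)]nmB; lra.
Qed.

Lemma period_dist_neq0 (z : C) p : nm z <= d / 2 -> p != (0, 0) ->
  z - period w1 w2 p != 0.
Proof.
move=> zd p0; rewrite -nm_gt0; apply: lt_le_trans (period_dist zd p0).
by rewrite mulr_gt0 ?divr_gt0 // ltr0n sz_gt0.
Qed.

Lemma not_in_lattice (z : C) : z != 0 -> nm z <= d / 2 -> ~ in_lattice w1 w2 z.
Proof.
move=> z0 zd [p zp]; case: (eqVneq p (0, 0)) => [p0|p0].
  by move: z0; rewrite zp p0 /period /= !mul0r addr0 eqxx.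
by have := period_dist_neq0 zd p0; rewrite zp subrr eqxx.
Qed.

Let c : R := 2 / d.

Lemma c_gt0 : 0 < c. Proof. by rewrite divr_gt0. Qed.

Lemma U_le p : p != (0, 0) -> nm (pinv p) * (sz p)%:R <= c.
Proof.
move=> p0; have w0 : 0 < nm (period w1 w2 p) by rewrite nm_gt0 period_neq0.
rewrite nmV ler_pdivrMl // /c mulrA ler_pdivlMr //.
by have := lower p; have := ler0n R (sz p); nra.
Qed.

Lemma V_le z p : nm z <= d / 2 -> p != (0, 0) -> nm (dinv z p) * (sz p)%:R <= c.
Proof.
move=> zd p0; have w0 : 0 < nm (z - period w1 w2 p) by rewrite nm_gt0 period_dist_neq0.
rewrite nmV ler_pdivrMl // /c mulrA ler_pdivlMr //.
by have := period_dist zd p0; have := ler0n R (sz p); nra.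
Qed.

Lemma inv_le (a : C) (s : R) : 0 < s -> nm a * s <= c -> nm a <= c * s^-1.
Proof. by move=> s0 h; rewrite ler_pdivlMr. Qed.

Lemma UV_mixed (z : C) (j k : nat) : nm z <= d / 2 -> (3 <= j + k)%N ->
  cubic (c ^+ (j + k)) (fun p => pinv p ^+ j * dinv z p ^+ k).
Proof. by move=> zd; apply: mixed_cubic => p p0; [exact: U_le|exact: V_le]. Qed.

(** Trades a sum of two terms of decay 1 for a product of decay 2. Applied repeatedly, it yields the
    cubic decay of the zeta and wp terms. *)
Lemma UV_sum (z : C) p : nm z <= d / 2 -> p != (0, 0) ->
  pinv p + dinv z p = z * pinv p * dinv z p.
Proof.
move=> zd p0; rewrite /pinv /dinv; field.
by rewrite period_neq0 //= period_dist_neq0.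
Qed.

Definition zetaT (z : C) p := dinv z p + pinv p + z * pinv p ^+ 2.
Definition wpT (z : C) p := dinv z p ^+ 2 - pinv p ^+ 2.

Lemma zetaTE z p : nm z <= d / 2 -> p != (0, 0) ->
  zetaT z p = z ^+ 2 * (pinv p ^+ 2 * dinv z p).
Proof.
move=> zd p0; rewrite /zetaT [dinv z p + _]addrC UV_sum //.
have -> : z * pinv p * dinv z p + z * pinv p ^+ 2 = z * pinv p * (pinv p + dinv z p) by ring.
by rewrite UV_sum //; ring.
Qed.

Lemma wpTE z p : nm z <= d / 2 -> p != (0, 0) ->
  wpT z p = 2 * z * (pinv p * dinv z p ^+ 2) + - z ^+ 2 * (pinv p ^+ 2 * dinv z p ^+ 2).
Proof.
move=> zd p0; have h := UV_sum zd p0.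
have -> : wpT z p = (pinv p + dinv z p) * (2 * dinv z p - (pinv p + dinv z p)).
  by rewrite /wpT; ring.
by rewrite h; ring.
Qed.

Lemma zetaT_cubic z : nm z <= d / 2 -> cubic (nm (z ^+ 2) * c ^+ 3) (zetaT z).
Proof.
move=> zd; apply: eq_cubic (cubicZ (z ^+ 2) (UV_mixed zd (isT : 3 <= 2 + 1)%N)) => p p0.
by rewrite zetaTE.
Qed.

Lemma wpT_cubic z : nm z <= d / 2 -> exists B, cubic B (wpT z).
Proof.
move=> zd; eexists.
have c1 := UV_mixed zd (isT : 3 <= 1 + 2)%N; have c2 := UV_mixed zd (isT : 3 <= 2 + 2)%N.
apply: eq_cubic (cubicD (cubicZ _ c1) (cubicZ _ c2)) => p p0.
by rewrite wpTE.
Qed.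

Lemma wsigmaE z : wsigma w1 w2 z = z * lprod pinv z.
Proof. by []. Qed.

Lemma wzetaE z : wzeta w1 w2 z = z^-1 + lsum (zetaT z).
Proof.
congr (_ + _); apply: (eq_lsum (G := zetaT z)) => p p0.
by rewrite /zetaT /pinv exprVn.
Qed.

Lemma wpE z : wp w1 w2 z = z ^- 2 + lsum (wpT z).
Proof.
congr (_ + _); apply: (eq_lsum (G := wpT z)) => p p0.
by rewrite /wpT /pinv /dinv !exprVn.
Qed.

Definition Gsum k : C := lsum (fun p => pinv p ^+ k).
Definition Ssum k z : C := z ^- k + lsum (fun p => dinv z p ^+ k).

Lemma g2E : g2 w1 w2 = 60 * Gsum 4.
Proof.
congr (_ * _); apply: eq_lsum => p p0.
by rewrite /pinv exprVn.
Qed.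

(** The linear factors agree because [UV_sum] gives $(1-zU)(1-xV)=1-(z-x)U$; the exponents differ
    exactly by the terms of $\zeta(z)x+\wp(z)x^2/2$. *)
Lemma E2_shift z x p : nm z <= d / 2 -> p != (0, 0) ->
  E2 ((z - x) * pinv p) * cexp (zetaT z p * x + wpT z p * (x ^+ 2 / 2))
  = E2 (z * pinv p) * E2 (x * dinv z p).
Proof.
move=> zd p0; have h := UV_sum zd p0.
have e1 : (1 - z * pinv p) * (1 - x * dinv z p) = 1 - (z - x) * pinv p.
  have -> : (1 - z * pinv p) * (1 - x * dinv z p)
     = 1 - z * pinv p - x * dinv z p + x * (z * pinv p * dinv z p) by ring.
  by rewrite -h; ring.
rewrite /E2 [RHS]mulrACA e1 -[LHS]mulrA -!cexpD; congr (_ * cexp _).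
by rewrite /zetaT /wpT; field.
Qed.

Lemma cexp_sum (I : Type) (s : seq I) (F : I -> C) :
  cexp (\sum_(i <- s) F i) = \prod_(i <- s) cexp (F i).
Proof.
elim: s => [|a s IH]; first by rewrite !big_nil cexp0.
by rewrite !big_cons cexpD IH.
Qed.

(** The zero period is absent from [box], so its factor [E2 (x / z)] is written apart. *)
Definition Dprod z x : C := E2 (x / z) * lprod (dinv z) x.

Lemma sigma_shift z x : z != 0 -> nm z <= d / 2 ->
  wsigma w1 w2 (z - x) * cexp (wzeta w1 w2 z * x + wp w1 w2 z * (x ^+ 2 / 2))
  = wsigma w1 w2 z * Dprod z x.
Proof.
move=> z0 zd; rewrite !wsigmaE wzetaE wpE /Dprod.
have [B wB] := wpT_cubic zd.
have e0 : (z - x) * cexp (x / z + (x / z) ^+ 2 / 2) = z * E2 (x / z).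
  by rewrite /E2 [RHS]mulrA; congr (_ * _); field.
have e1 : lprod pinv (z - x) * cexp (lsum (zetaT z) * x + lsum (wpT z) * (x ^+ 2 / 2))
    = lprod pinv z * lprod (dinv z) x.
  have h1 := lprod_cvs c_gt0 (fun p => @U_le p) (z - x).
  have h2 := lprod_cvs c_gt0 (fun p => @U_le p) z.
  have h3 := lprod_cvs c_gt0 (fun p => V_le zd) x.
  have h4 := cvs_cexp (cvsD (cvsM (lsum_cvs (zetaT_cubic zd)) (cvs_cst x))
     (cvsM (lsum_cvs wB) (cvs_cst (x ^+ 2 / 2)))).
  apply: (cvs_uniq (cvsM h1 h4)); apply: cvs_ext (cvsM h2 h3) => N.
  have -> : psum (zetaT z) N * x + psum (wpT z) N * (x ^+ 2 / 2)
      = \sum_(p <- box N) (zetaT z p * x + wpT z p * (x ^+ 2 / 2)).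
    by rewrite big_split /= -!mulr_suml.
  rewrite cexp_sum -[LHS]big_split -[RHS]big_split /=.
  rewrite big_seq [RHS]big_seq; apply: eq_bigr => p; rewrite mem_box => /andP[p0 _].
  exact: esym (E2_shift x zd p0).
rewrite [RHS]mulrACA -e0 -e1 [RHS]mulrACA -cexpD; congr (_ * cexp _).
by field.
Qed.

Lemma wsigma_neq0 z : z != 0 -> nm z <= d / 2 -> wsigma w1 w2 z != 0.
Proof.
move=> z0 zd; rewrite wsigmaE mulf_neq0 //.
apply: (lprod_neq0 c_gt0 (fun p => @U_le p)) => p p0.
apply: contra_neq (period_dist_neq0 zd p0) => h.
by rewrite -[period _ _ _]mul1r -h mulfVK ?subrr // period_neq0.
Qed.

Lemma krichever_shift z alpha x : z != 0 -> nm z <= d / 2 ->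
  z - x != 0 -> nm (z - x) <= d / 2 ->
  krichever w1 w2 z alpha x * Dprod z x
  = wsigma w1 w2 x * cexp (alpha * x + wp w1 w2 z * (x ^+ 2 / 2)).
Proof.
move=> z0 zd y0 yd; have s0 := wsigma_neq0 z0 zd; have t0 := wsigma_neq0 y0 yd.
have -> : Dprod z x = wsigma w1 w2 (z - x)
    * cexp (wzeta w1 w2 z * x + wp w1 w2 z * (x ^+ 2 / 2)) / wsigma w1 w2 z.
  by rewrite sigma_shift // mulrC mulKf.
rewrite /krichever; set a := cexp (_ - _); set b := cexp (_ + _).
set s := wsigma w1 w2 z; set t := wsigma w1 w2 (z - x).
have -> : wsigma w1 w2 x * s / t * a * (t * b / s) = wsigma w1 w2 x * (a * b).
  by field; rewrite s0 t0.
rewrite -cexpD; congr (_ * cexp _); ring.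
Qed.

Lemma Dprod_taylor z : z != 0 -> nm z <= d / 2 ->
  modO 5 (Dprod z) (hrec [:: 1; 0; 0; - Ssum 3 z / 3; - Ssum 4 z / 4]).
Proof.
move=> z0 zd; have h1 := lprod_taylor c_gt0 (fun p => V_le zd).
have h2 : modO 5 (fun x => E2 (x / z)) (hrec [:: 1; 0; 0; - z ^- 3 / 3; - z ^- 4 / 4]).
  have [M M0 hM] := E2_taylor R.
  have O1 : Oz 1 (fun x => x / z) by rewrite -[1%N]addn0; apply: OzM (Oz_id R) (Oz_cst _).
  have := @Oz_comp _ 5 (fun y => E2 y - (1 - y ^+ 3 / 3 - y ^+ 4 / 4)) _ M (1 / 2) _ _ O1.
  move=> /(_ _ _)H; apply: Oz_ext (H _ _) => [x||y /ltW]; [|by rewrite divr_gt0|exact: hM].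
  by rewrite /= expr_div_n; field.
have h : modO 5 (Dprod z) _ := modO_mul h2 h1.
apply: modO_trans h _.
set a := lsum _; set b := lsum _.
pose a3 : C := z ^- 3; pose a4 : C := z ^- 4.
(* Both expansions have the form $1+O(x^3)$, so their product differs from the sum of the
   corrections only from degree 6 on. *)
apply: (@Oz_ext _ _ (fun x => x ^+ 6 * hrec [:: (- a3 / 3) * (- a / 3);
   (- a3 / 3) * (- b / 4) + (- a4 / 4) * (- a / 3); (- a4 / 4) * (- b / 4)] x)).
  by move=> x; rewrite /Ssum /= -/a -/b -/a3 -/a4; field.
by apply: (@Oz_le _ (6 + 0)) => //; apply: OzM (Oz_idX R 6) (Oz_hrec _).
Qed.

End Lattice.

(** * Taylor coefficients of the Krichever function and the derivative of wp *)

Section Coefficients.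
Variable R : realType.
Local Notation C := (cplx R).
Variables (w1 w2 : C) (d : R).
Hypothesis d0 : 0 < d.
Hypothesis lower : forall p, d * (sz p)%:R <= nm (period w1 w2 p).

Lemma modO_near k (f g h : C -> C) (r : R) : 0 < r ->
  (forall x, x != 0 -> nm x < r -> f x = g x) -> modO k f h -> modO k g h.
Proof. by move=> r0 fg; apply: (Oz_near r0) => x x0 xr; rewrite fg. Qed.

Lemma cexp_modO (a b : C) : modO 5 (fun x => cexp (a * x + b * (x ^+ 2 / 2)))
  (hrec [:: 1; a; a ^+ 2 / 2 + b / 2; a ^+ 3 / 6 + a * b / 2;
            a ^+ 4 / 24 + a ^+ 2 * b / 4 + b ^+ 2 / 8]).
Proof.
have [M M0 hM] := cexp_taylor R.
have O1 : Oz 1 (fun x : C => a * x + b * (x ^+ 2 / 2)).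
  have h1 := OzM (Oz_cst a) (Oz_id R).
  have h2 := OzM (Oz_cst (b / 2)) (Oz_idX R 2).
  apply: Oz_ext (OzD h1 (Oz_le (isT : 1 <= 0 + 2)%N h2)) => x /=.
  by ring.
have h := @Oz_comp _ 5 (fun y => cexp y - exp4 y) _ M 1 ltr01
  (fun y y1 => hM y (ltW y1)) O1.
(* The list holds the coefficients of degrees 5 to 8 of [exp4 (a * x + b * (x ^+ 2 / 2))]. *)
have O2 := OzM (Oz_idX R 5) (Oz_hrec [:: a * b ^+ 2 / 8 + a ^+ 3 * b / 12;
  b ^+ 3 / 48 + a ^+ 2 * b ^+ 2 / 16; a * b ^+ 3 / 48; b ^+ 4 / 384]).
apply: Oz_ext (OzD h O2) => x.
by rewrite /= /exp4; field.
Qed.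

(** The bound $d/4$ on [z] leaves room for the shifted point inside the disc of radius $d/2$. *)
Lemma small_shift (z x : C) : z != 0 -> nm z <= d / 4 -> nm x < nm z / 2 ->
  z - x != 0 /\ nm (z - x) <= d / 2.
Proof.
move=> z0 zd xz; have z1 : 0 < nm z by rewrite nm_gt0.
split; first by rewrite -nm_gt0; have := nm_rev z x; lra.
by have := nmD z (- x); rewrite nmN; lra.
Qed.

(** Once $a_0=0$ is known, [krichever_shift] can be divided by [x]; as [Dprod] starts with 1,
    comparing coefficients gives a triangular system for $a_1,\dots,a_5$. *)
Lemma krichever_coefs (z alpha : C) (a : nat -> C) :
  z != 0 -> nm z <= d / 4 -> expands_at0 (krichever w1 w2 z alpha) a ->
  [/\ a 0 = 0, a 1 = 1, a 2 = alpha & a 3 = alpha ^+ 2 / 2 + wp w1 w2 z / 2] /\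
  (a 4 = alpha ^+ 3 / 6 + alpha * wp w1 w2 z / 2 + Ssum w1 w2 3 z / 3 - Gsum w1 w2 3 / 3 /\
  a 5 = alpha ^+ 4 / 24 + alpha ^+ 2 * wp w1 w2 z / 4 + wp w1 w2 z ^+ 2 / 8
    + alpha * Ssum w1 w2 3 z / 3 + Ssum w1 w2 4 z / 4
    - alpha * Gsum w1 w2 3 / 3 - Gsum w1 w2 4 / 4).
Proof.
move=> z0 zd Ka; have z1 : 0 < nm z by rewrite nm_gt0.
have zd2 : nm z <= d / 2 by lra.
pose K := krichever w1 w2 z alpha.
set b := wp w1 w2 z.
have eqK x : nm x < nm z / 2 ->
    K x * Dprod w1 w2 z x = x * lprod (pinv w1 w2) x * cexp (alpha * x + b * (x ^+ 2 / 2)).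
  move=> xz; have [y0 yd] := small_shift z0 zd xz.
  exact: (krichever_shift d0 lower alpha z0 zd2 y0 yd).
have hD := Dprod_taylor d0 lower z0 zd2.
have hU := lprod_taylor (c_gt0 d0) (fun p => U_le d0 lower (p := p)).
have hE := cexp_modO alpha b.
have hK := expands_modO 6 Ka.
have z2 : 0 < nm z / 2 by rewrite divr_gt0.
have a0 : a 0 = 0.
  have K1 : modO 1 K (hrec [:: a 0]).
    apply: modO_trans (Oz_le (isT : 1 <= 6)%N hK) _.
    apply: (@Oz_ext _ _ (fun x => x * hrec [:: a 1; a 2; a 3; a 4; a 5] x)).
      by move=> x /=; ring.
    by apply: (@OzM _ 1 0); [exact: Oz_id|exact: Oz_hrec].
  have K2 := modO_mul K1 (Oz_le (isT : 1 <= 5)%N hD).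
  have K3 : modO 1 (fun x => K x * Dprod w1 w2 z x) (hrec [:: 0]).
    apply: (@Oz_near _ _ (fun x => x * (lprod (pinv w1 w2) x
        * cexp (alpha * x + b * (x ^+ 2 / 2)))) _ _ z2).
      by move=> x _ xz; rewrite eqK //= mulr0 addr0 subr0 mulrA.
    have bd (f : C -> C) (s : seq C) : modO 5 f (hrec s) -> Oz 0 f.
      move=> h; apply: Oz_ext (OzD (Oz_le (isT : 0 <= 5)%N h) (Oz_hrec s)) => x.
      by rewrite subrK.
    have h := OzM (Oz_id R) (OzM (bd _ _ hU) (bd _ _ hE)); exact: h.
  have := modO_hrec (modO_trans (modO_sym K2) K3) (ltn0Sn 0).
  by rewrite /= mulr1 addr0.
pose k x := x^-1 * K x.
have hk : modO 5 k (hrec [:: a 1; a 2; a 3; a 4; a 5]).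
  apply: (@Oz_divX _ 1); apply: (@Oz_near _ _ _ _ 1 ltr01 _ hK) => x x0 _.
  by rewrite -/(K x) /k /= a0; field.
have e1 := modO_mul hk hD.
have e2 := modO_mul hU hE.
have e3 : modO 5 (fun x => k x * Dprod w1 w2 z x) (hrec (hmul
    [:: 1; 0; 0; - Gsum w1 w2 3 / 3; - Gsum w1 w2 4 / 4]
    [:: 1; alpha; alpha ^+ 2 / 2 + b / 2; alpha ^+ 3 / 6 + alpha * b / 2;
        alpha ^+ 4 / 24 + alpha ^+ 2 * b / 4 + b ^+ 2 / 8])).
  apply: modO_near z2 _ e2 => x x0 xz.
  by rewrite /k -mulrA eqK // -!mulrA mulKf.
have e4 := modO_hrec (modO_trans (modO_sym e1) e3).
have := e4 0 isT; have := e4 1 isT; have := e4 2 isT; have := e4 3 isT.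
have := e4 4 isT; rewrite /= {e1 e2 e3 e4 hk hK hD hU hE}.
set s3 := Ssum _ _ 3 z; set s4 := Ssum _ _ 4 z.
set g3 := Gsum _ _ 3; set g4 := Gsum _ _ 4.
rewrite !(mulr0, mul0r, addr0, add0r, mulr1, mul1r) => h5 h4 h3 h2 h1.
rewrite h2 in h5 h4 h3 *; rewrite h1 in h5 h4 h3 *.
split; first by split.
split.
  have -> : a 4 = (1 * (- s3 / 3) + a 4) + s3 / 3 by ring.
  by rewrite h4; ring.
have -> : a 5 = (1 * (- s4 / 4) + (alpha * (- s3 / 3) + a 5)) + s4 / 4 + alpha * s3 / 3.
  by ring.
by rewrite h5; ring.
Qed.

Lemma deriv_wpT (z h : C) p : nm z <= d / 2 -> nm (z + h) <= d / 2 ->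
  p != (0, 0) ->
  wpT w1 w2 (z + h) p - wpT w1 w2 z p =
  h * ((-2) * dinv w1 w2 z p ^+ 3 +
       h * (2 * (dinv w1 w2 z p ^+ 3 * dinv w1 w2 (z + h) p)
            + dinv w1 w2 z p ^+ 2 * dinv w1 w2 (z + h) p ^+ 2)).
Proof.
move=> zd zd' p0; rewrite /wpT /dinv.
have n1 := period_dist_neq0 d0 lower zd p0.
have n2 := period_dist_neq0 d0 lower zd' p0.
by field; rewrite n1 n2.
Qed.

(** The difference quotient is computed exactly in each term by [deriv_wpT], and its deviation from
    the limit is [h] times a sum bounded uniformly in [h]. *)
Lemma wp_derive (z : C) : z != 0 -> nm z <= d / 4 ->
  derive1 (wp w1 w2) z = - 2 * Ssum w1 w2 3 z.
Proof.
move=> z0 zd; have z1 : 0 < nm z by rewrite nm_gt0.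
have zd2 : nm z <= d / 2 by lra.
pose B := 16 * (3 * (2 / d) ^+ 4).
have lp : exists2 M : R, 0 <= M & forall h, h != 0 -> nm h < nm z / 2 ->
    nm (h^-1 * (wp w1 w2 (h + z) - wp w1 w2 z) - - 2 * Ssum w1 w2 3 z) <= M * nm h.
  (* [B] bounds the lattice part; the rest bounds the pole term, using $|z+h|\ge|z|/2$. *)
  exists (B + (2 * (nm z / 2)^-1 * nm z ^- 3 + (nm z / 2) ^- 2 * nm z ^- 2)).
    have iz := ltW z1.
    rewrite addr_ge0 ?mulr_ge0 ?exprn_ge0 ?invr_ge0 ?addr_ge0 ?mulr_ge0 ?invr_ge0
      ?exprn_ge0 ?divr_ge0 //; exact: ltW.
  move=> h h0 hz.
  have hz' : nm (- h) < nm z / 2 by rewrite nmN.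
  have [y0 yd] := small_shift z0 zd hz'; rewrite opprK in y0 yd.
  have [B1 c1] := wpT_cubic d0 lower zd2; have [B2 c2] := wpT_cubic d0 lower yd.
  have c3 := pow_cubic (fun p => V_le d0 lower zd2 (p := p)) (leqnn 3).
  have Vz p : p != (0, 0) -> _ := V_le d0 lower zd2 (p := p).
  have Vh p : p != (0, 0) -> _ := V_le d0 lower yd (p := p).
  have c4 := mixed_cubic Vz Vh (isT : 3 <= 3 + 1)%N.
  have c5 := mixed_cubic Vz Vh (isT : 3 <= 2 + 2)%N.
  have c6 := cubicD (cubicZ 2 c4) c5.
  pose T := lsum (fun p => 2 * (dinv w1 w2 z p ^+ 3 * dinv w1 w2 (z + h) p ^+ 1)
            + dinv w1 w2 z p ^+ 2 * dinv w1 w2 (z + h) p ^+ 2).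
  have TB : nm T <= B.
    apply: le_trans (lsum_le c6) _; rewrite nm_nat /B.
    by rewrite le_eqVlt; apply/orP; left; apply/eqP; ring.
  have e : lsum (wpT w1 w2 (z + h)) - lsum (wpT w1 w2 z)
      = h * (- 2 * lsum (fun p => dinv w1 w2 z p ^+ 3) + h * T).
    rewrite -(lsumB c2 c1) -(lsumZ _ c6) -(lsumZ _ c3).
    rewrite -(lsumD (cubicZ _ c3) (cubicZ _ c6)).
    rewrite -(lsumZ _ (cubicD (cubicZ _ c3) (cubicZ _ c6))).
    by apply: eq_lsum => p p0; rewrite deriv_wpT.
  have -> : h^-1 * (wp w1 w2 (h + z) - wp w1 w2 z) - - 2 * Ssum w1 w2 3 z
     = (T + (2 * (z + h)^-1 * z ^- 3 + (z + h) ^- 2 * z ^- 2)) * h.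
    rewrite [h + z]addrC !wpE /Ssum.
    have -> : (z + h) ^- 2 + lsum (wpT w1 w2 (z + h)) - (z ^- 2 + lsum (wpT w1 w2 z))
      = (z + h) ^- 2 - z ^- 2 + (lsum (wpT w1 w2 (z + h)) - lsum (wpT w1 w2 z)) by ring.
    by rewrite e; field; rewrite h0 z0 y0.
  rewrite nmM; apply: ler_wpM2r; first exact: nm_ge0.
  apply: le_trans (nmD _ _) _; apply: lerD => //; apply: le_trans (nmD _ _) _.
  have yz : (nm (z + h))^-1 <= (nm z / 2)^-1.
    rewrite lef_pV2 ?posrE ?nm_gt0 ?divr_gt0 //.
    by have := nm_revD z h; lra.
  have i0 : 0 <= (nm (z + h))^-1 by rewrite invr_ge0 nm_ge0.
  have iz k : 0 <= (nm z ^+ k)^-1 by rewrite invr_ge0 exprn_ge0 ?nm_ge0.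
  apply: lerD.
    rewrite nmM nmM nm_nat !nmV nmX; apply: ler_wpM2r => //.
    by apply: ler_wpM2l.
  rewrite nmM !nmV !nmX -!exprVn; apply: ler_wpM2r; first by rewrite exprVn.
  by rewrite lerXn2r ?nnegrE // (le_trans i0 yz).
have [M M0 hM] := lp.
apply: cvg_lim; first exact: norm_hausdorff.
apply/cvgrPdist_lt => _ /posC[e e0 ->].
have M1 : 0 < M + 1 by lra.
pose r := Num.min (nm z / 2) (e / (M + 1)).
have r0 : 0 < r by rewrite lt_min !divr_gt0.
have rC : (0 : C) < real_complex R r by rewrite ltcR.
apply/nbhs_ballP; exists (real_complex R r) => //= h.
rewrite -ball_normE /ball_ /= sub0r normrN ltc_nm lt_min => /andP[h1 h2] h0.
rewrite ltc_nm nmB; apply: le_lt_trans (hM h h0 h1) _.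
move: h2; rewrite ltr_pdivlMr // => h2.
by have := nm_ge0 h; nra.
Qed.

End Coefficients.

(** * Expansions of the Weierstrass functions at 0 *)

Section Origin.
Variable R : realType.
Local Notation C := (cplx R).

Variables (w1 w2 : C) (d : R).
Hypothesis d0 : 0 < d.
Hypothesis lower : forall p, d * (sz p)%:R <= nm (period w1 w2 p).
Local Notation U := (pinv w1 w2).
Local Notation V := (dinv w1 w2).
Local Notation G := (Gsum w1 w2).

Lemma U_cubic (k : nat) : (3 <= k)%N -> cubic ((2 / d) ^+ k) (fun p => U p ^+ k).
Proof. by apply: pow_cubic => p; exact: U_le. Qed.

Definition Tsum (j k : nat) z : C := lsum (fun p => U p ^+ j * V z p ^+ k).

Lemma Oz_Tsum (j k : nat) : (3 <= j + k)%N -> Oz 0 (Tsum j k).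
Proof.
move=> jk; apply: (@OzI _ _ _ (16 * (2 / d) ^+ (j + k)) (d / 2)); first by rewrite divr_gt0.
by move=> z _ /ltW zd; rewrite mulr1; apply: lsum_le; apply: (UV_mixed d0 lower).
Qed.

(** Written through [U], the terms become rational functions of $y=zU$, and their expansions are
    identities for [field]. *)
Lemma V_over_U (z : C) p : nm z <= d / 2 -> p != (0, 0) ->
  V z p = - U p / (1 - z * U p) /\ 1 - z * U p != 0.
Proof.
move=> zd p0; have n1 := period_neq0 d0 lower p0; have n2 := period_dist_neq0 d0 lower zd p0.
have n3 : 1 - z * U p != 0.
  have -> : 1 - z * U p = - (z - period w1 w2 p) / period w1 w2 p.
    by rewrite /pinv; field.
  by rewrite mulf_neq0 ?invr_eq0 // oppr_eq0.
split=> //; have n4 : period w1 w2 p - z != 0 by rewrite -oppr_eq0 opprB.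
rewrite /dinv; have -> : 1 - z * U p = (period w1 w2 p - z) / period w1 w2 p.
  by rewrite /pinv; field.
by rewrite /pinv; field; rewrite n2 n1 n4.
Qed.

(** Truncation of $(1-y)^{-2}$ at $y=zU$ with exact remainder $y^5(6-5y)/(1-y)^2$, whose sum is
    expressed by [Tsum]. The next two expansions truncate $(1-y)^{-3}$ and $(1-y)^{-4}$ likewise. *)
Lemma wp_expand z : nm z <= d / 2 -> wp w1 w2 z = z ^- 2 +
  (2 * z * G 3 + 3 * z ^+ 2 * G 4 + (4 * z ^+ 3 * G 5 + 5 * z ^+ 4 * G 6)
   + z ^+ 5 * (6 * Tsum 5 2 z + (- 5 * z) * Tsum 6 2 z)).
Proof.
move=> zd; rewrite wpE; congr (_ + _).
have c3 := U_cubic (isT : 3 <= 3)%N; have c4 := U_cubic (isT : 3 <= 4)%N.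
have c5 := U_cubic (isT : 3 <= 5)%N; have c6 := U_cubic (isT : 3 <= 6)%N.
have t1 := UV_mixed d0 lower zd (isT : 3 <= 5 + 2)%N.
have t2 := UV_mixed d0 lower zd (isT : 3 <= 6 + 2)%N.
have [B1 k1] := cubic2 (2 * z) (3 * z ^+ 2) c3 c4.
have [B2 k2] := cubic2 (4 * z ^+ 3) (5 * z ^+ 4) c5 c6.
have [B3 k3] := cubic2 6 (- 5 * z) t1 t2.
rewrite /Gsum /Tsum -(lsum2 _ _ c3 c4) -(lsum2 _ _ c5 c6) -(lsum2 _ _ t1 t2).
rewrite -(lsumZ _ k3) -(lsumD k1 k2) -(lsumD (cubicD k1 k2) (cubicZ _ k3)).
apply: eq_lsum => p p0; have [h n] := V_over_U zd p0.
by rewrite /wpT h; field.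
Qed.

Lemma S3_expand z : nm z <= d / 2 -> Ssum w1 w2 3 z = z ^- 3 +
  ((-1) * G 3 + (- 3 * z) * G 4 + ((- 6 * z ^+ 2) * G 5 + (- 10 * z ^+ 3) * G 6)
   + z ^+ 4 * (15 * Tsum 4 3 z + (- 24 * z) * Tsum 5 3 z + 10 * z ^+ 2 * Tsum 6 3 z)).
Proof.
move=> zd; rewrite /Ssum; congr (_ + _).
have c3 := U_cubic (isT : 3 <= 3)%N; have c4 := U_cubic (isT : 3 <= 4)%N.
have c5 := U_cubic (isT : 3 <= 5)%N; have c6 := U_cubic (isT : 3 <= 6)%N.
have t1 := UV_mixed d0 lower zd (isT : 3 <= 4 + 3)%N.
have t2 := UV_mixed d0 lower zd (isT : 3 <= 5 + 3)%N.
have t3 := cubicZ (10 * z ^+ 2) (UV_mixed d0 lower zd (isT : 3 <= 6 + 3)%N).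
have [B1 k1] := cubic2 (-1) (- 3 * z) c3 c4.
have [B2 k2] := cubic2 (- 6 * z ^+ 2) (- 10 * z ^+ 3) c5 c6.
have [B3 k3] := cubic2 15 (- 24 * z) t1 t2.
rewrite /Gsum /Tsum -(lsum2 _ _ c3 c4) -(lsum2 _ _ c5 c6) -(lsum2 _ _ t1 t2).
rewrite -(lsumZ _ (UV_mixed d0 lower zd (isT : 3 <= 6 + 3)%N)) -(lsumD k3 t3).
rewrite -(lsumZ _ (cubicD k3 t3)) -(lsumD k1 k2) -(lsumD (cubicD k1 k2) (cubicZ _ (cubicD k3 t3))).
apply: eq_lsum => p p0; have [h n] := V_over_U zd p0.
by rewrite h; field.
Qed.

Lemma S4_expand z : nm z <= d / 2 -> Ssum w1 w2 4 z = z ^- 4 +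
  (1 * G 4 + z * (4 * Tsum 1 4 z + (- 6 * z) * Tsum 2 4 z
    + (4 * z ^+ 2 * Tsum 3 4 z + - z ^+ 3 * Tsum 4 4 z))).
Proof.
move=> zd; rewrite /Ssum; congr (_ + _).
have c4 := U_cubic (isT : 3 <= 4)%N.
have t1 := UV_mixed d0 lower zd (isT : 3 <= 1 + 4)%N.
have t2 := UV_mixed d0 lower zd (isT : 3 <= 2 + 4)%N.
have t3 := UV_mixed d0 lower zd (isT : 3 <= 3 + 4)%N.
have t4 := UV_mixed d0 lower zd (isT : 3 <= 4 + 4)%N.
have [B1 k1] := cubic2 4 (- 6 * z) t1 t2.
have [B2 k2] := cubic2 (4 * z ^+ 2) (- z ^+ 3) t3 t4.
rewrite /Gsum /Tsum -(lsum2 _ _ t1 t2) -(lsum2 _ _ t3 t4) -(lsumD k1 k2).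
rewrite -(lsum2 1 z c4 (cubicD k1 k2)).
apply: eq_lsum => p p0; have [h n] := V_over_U zd p0.
by rewrite h; field.
Qed.

Lemma G_odd (k : nat) : (3 <= k)%N -> odd k -> G k = 0.
Proof.
move=> k3 ok; pose N (p : int * int) := (- p.1, - p.2).
have NK : cancel N N by move=> [m n]; rewrite /N /= !opprK.
have szN p : sz (N p) = sz p by rewrite /sz /N /= !abszN.
have h : lsum (fun p => U (N p) ^+ k) = G k.
  apply: (lsum_reindex (A' := N) (U_cubic k3) NK NK) => [|p|p]; rewrite ?szN ?leq_pmull //.
have e : G k = - G k.
  rewrite -{1}h -[in RHS]mulN1r -(lsumZ (-1) (U_cubic k3)); apply: eq_lsum => p _.
  have -> : U (N p) = - U p.
    by rewrite /pinv /period /N /= !rmorphN /= !mulNr -opprD invrN.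
  by rewrite exprNn -signr_odd ok expr1.
have : 2 * G k = 0 by rewrite mulr2n mulrDl mul1r {2}e subrr.
by move/eqP; rewrite mulf_eq0 pnatr_eq0 /= => /eqP.
Qed.

Lemma Oz_Tsum_term (e : C) (n j k : nat) : (3 <= j + k)%N ->
  Oz 0 (fun z => e * z ^+ n * Tsum j k z).
Proof.
move=> jk; apply: (Oz_le (leq0n n)).
by have := OzM (OzM (Oz_cst e) (Oz_idX R n)) (Oz_Tsum jk); rewrite addn0.
Qed.

Lemma z2wp_modO : modO 7 (fun z => z ^+ 2 * wp w1 w2 z)
  (hrec [:: 1; 0; 0; 0; 3 * G 4; 0; 5 * G 6]).
Proof.
have O1 : Oz 0 (fun z : C => 6 * Tsum 5 2 z + (- 5 * z) * Tsum 6 2 z).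
  apply: Oz_ext (OzD (Oz_Tsum_term 6 0 (isT : 3 <= 5 + 2)%N)
    (Oz_Tsum_term (- 5%:R) 1 (isT : 3 <= 6 + 2)%N)) => z.
  by ring.
have d2 : 0 < d / 2 by rewrite divr_gt0.
apply: (Oz_near d2 _ (OzM (Oz_idX R 7) O1)) => z z0 /ltW zd.
rewrite wp_expand // (G_odd (k := 3)) // (G_odd (k := 5)) //=.
by field.
Qed.

Lemma z3S3_modO : modO 7 (fun z => z ^+ 3 * Ssum w1 w2 3 z)
  (hrec [:: 1; 0; 0; 0; - 3 * G 4; 0; - 10 * G 6]).
Proof.
have O1 : Oz 0 (fun z : C => 15 * Tsum 4 3 z + (- 24 * z) * Tsum 5 3 z
    + 10 * z ^+ 2 * Tsum 6 3 z).
  apply: Oz_ext (OzD (OzD (Oz_Tsum_term 15 0 (isT : 3 <= 4 + 3)%N)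
    (Oz_Tsum_term (- 24%:R) 1 (isT : 3 <= 5 + 3)%N))
    (Oz_Tsum_term 10 2 (isT : 3 <= 6 + 3)%N)) => z.
  by ring.
have d2 : 0 < d / 2 by rewrite divr_gt0.
apply: (Oz_near d2 _ (OzM (Oz_idX R 7) O1)) => z z0 /ltW zd.
rewrite S3_expand // (G_odd (k := 3)) // (G_odd (k := 5)) //=.
by field.
Qed.

Lemma z4S4_modO : modO 5 (fun z => z ^+ 4 * Ssum w1 w2 4 z)
  (hrec [:: 1; 0; 0; 0; G 4]).
Proof.
have O1 : Oz 0 (fun z : C => 4 * Tsum 1 4 z + (- 6 * z) * Tsum 2 4 z
    + (4 * z ^+ 2 * Tsum 3 4 z + - z ^+ 3 * Tsum 4 4 z)).
  apply: Oz_ext (OzD (OzD (Oz_Tsum_term 4 0 (isT : 3 <= 1 + 4)%N)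
    (Oz_Tsum_term (- 6%:R) 1 (isT : 3 <= 2 + 4)%N))
    (OzD (Oz_Tsum_term 4 2 (isT : 3 <= 3 + 4)%N)
    (Oz_Tsum_term (- 1) 3 (isT : 3 <= 4 + 4)%N))) => z.
  by ring.
have d2 : 0 < d / 2 by rewrite divr_gt0.
apply: (Oz_near d2 _ (OzM (Oz_idX R 5) O1)) => z z0 /ltW zd.
by rewrite S4_expand //=; field.
Qed.

(** After multiplication by $z^4$, degree 0 gives $a=1$ and degree 4 gives $G_4=6aG_4+60bG_4$,
    solvable for $b$ because $G_4\ne 0$. *)
Lemma quartic_constants (a b : C) (r : R) : 0 < r -> G 4 != 0 ->
  (forall z, z != 0 -> nm z < r ->
     Ssum w1 w2 4 z = a * wp w1 w2 z ^+ 2 + b * g2 w1 w2) ->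
  a = 1 /\ b = - 1 / 12.
Proof.
move=> r0 G0 h; pose t := [:: 1; 0; 0; 0; 3 * G 4; 0; 5 * G 6].
have h1 := modO_mul (Oz_le (isT : 5 <= 7)%N z2wp_modO) (Oz_le (isT : 5 <= 7)%N z2wp_modO).
have ha : modO 5 (fun=> a) (hrec [:: a]).
  by apply: Oz_ext (modO_refl 5 (fun=> a)) => x; rewrite /= mulr0 addr0.
have hb : modO 5 (fun x => b * (60 * G 4) * x ^+ 4) (hrec [:: 0; 0; 0; 0; b * (60 * G 4)]).
  by apply: Oz_ext (modO_refl 5 (fun x => b * (60 * G 4) * x ^+ 4)) => x /=; ring.
have h3 := modO_add (modO_mul ha h1) hb.
have h4 : modO 5 (fun z => z ^+ 4 * Ssum w1 w2 4 z)
    (hrec (hadd (hmul [:: a] (hmul t t)) [:: 0; 0; 0; 0; b * (60 * G 4)])).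
  by apply: modO_near r0 _ h3 => z z0 zr; rewrite h // g2E; ring.
have e := modO_hrec (modO_trans (modO_sym z4S4_modO) h4).
have a1 : a = 1.
  by have := e 0 isT; rewrite /= => ->; ring.
split=> //; have := e 4 isT; rewrite /= a1 => e4.
have : G 4 * (5 + b * 60) = 0.
  have -> : G 4 * (5 + b * 60) = - G 4 + (6 * G 4 + b * (60 * G 4)) by ring.
  by rewrite {1}e4; ring.
move/eqP; rewrite mulf_eq0 (negPf G0) /= => /eqP e5.
have -> : b = (5 + b * 60) / 60 - 1 / 12 by field.
by rewrite e5; field.
Qed.

End Origin.

(** * The hexagonal lattice and its deformations *)

Section Hexagonal.
Variable R : realType.
Local Notation C := (cplx R).

(** A primitive sixth root of unity; [1 - rho] is both its conjugate and its inverse. *)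
Definition rho : C := (1 / 2 +i* (Num.sqrt 3 / 2))%C.

Lemma rho_sqr : rho ^+ 2 = rho - 1.
Proof.
apply/eqP; rewrite eq_complex /=.
have h : (Num.sqrt 3 : R) * Num.sqrt 3 = 3 by rewrite -expr2 sqr_sqrtr.
apply/andP; split; apply/eqP.
  have -> : Num.sqrt 3 / 2 * (Num.sqrt 3 / 2) = (Num.sqrt 3 : R) * Num.sqrt 3 / 4 by field.
  by rewrite h; field.
by rewrite subr0; field.
Qed.

Local Notation w := (period 1 rho).
Local Notation wb := (period 1 (1 - rho)).

(** The norm form of the Eisenstein integers; [wb p] is the conjugate of [w p]. *)
Definition hexq (p : int * int) : R :=
  p.1%:~R ^+ 2 + p.1%:~R * p.2%:~R + p.2%:~R ^+ 2.

Lemma nm_hex p : nm (w p) ^+ 2 = hexq p /\ nm (wb p) ^+ 2 = hexq p.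
Proof.
case: p => m n; rewrite /hexq /=.
have h : (Num.sqrt 3 : R) ^+ 2 = 3 by rewrite sqr_sqrtr.
have rci (k : int) : (k%:~R : C) = real_complex R k%:~R by rewrite rmorph_int.
have e1 : w (m, n) = ((m%:~R + n%:~R / 2) +i* (n%:~R * (Num.sqrt 3 / 2)))%C.
  rewrite /period /= !rci; apply/eqP; rewrite eq_complex /=.
  by apply/andP; split; apply/eqP; field.
have e2 : wb (m, n) = ((m%:~R + n%:~R / 2) +i* (- (n%:~R * (Num.sqrt 3 / 2))))%C.
  rewrite /period /= !rci; apply/eqP; rewrite eq_complex /=.
  by apply/andP; split; apply/eqP; field.
rewrite e1 e2 /nm /= !sqr_sqrtr ?addr_ge0 ?sqr_ge0 // sqrrN exprMn expr_div_n h.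
by split; field.
Qed.

Lemma sz_sqr p : ((sz p)%:R : R) ^+ 2 = Num.max (p.1%:~R ^+ 2) (p.2%:~R ^+ 2).
Proof.
case: p => m n; rewrite /sz /=.
have ab (k : int) : ((absz k)%:R : R) ^+ 2 = k%:~R ^+ 2.
  by rewrite natr_absz intr_norm real_normK ?num_real.
rewrite -!ab; case: (leqP (absz m) (absz n)) => h.
  by rewrite max_r // lerXn2r ?nnegrE // ler_nat.
by rewrite max_l // lerXn2r ?nnegrE // ler_nat ltnW.
Qed.

(** The $3/4$ comes from completing the square; the 4 is chosen with a rational square root. *)
Lemma hexq_bounds p : 3 / 4 * (sz p)%:R ^+ 2 <= hexq p /\ hexq p <= 4 * (sz p)%:R ^+ 2.
Proof.
rewrite sz_sqr /hexq; move: p.1%:~R p.2%:~R => a b.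
have h1 : 0 <= (a / 2 + b) ^+ 2 by apply: sqr_ge0.
have h2 : 0 <= (a + b / 2) ^+ 2 by apply: sqr_ge0.
have h3 : 0 <= (a - b) ^+ 2 by apply: sqr_ge0.
have a0 : 0 <= a ^+ 2 by apply: sqr_ge0.
have b0 : 0 <= b ^+ 2 by apply: sqr_ge0.
rewrite !expr2 in h1 h2 h3 a0 b0 *.
by case: (leP (a * a) (b * b)) => h; split; nra.
Qed.

Lemma nm_wb p : nm (wb p) = nm (w p).
Proof.
have [h1 h2] := nm_hex p; apply/eqP.
by rewrite -(eqrXn2 (n := 2)) ?nm_ge0 // h1 h2.
Qed.

Lemma le_sqr (a b : R) : 0 <= b -> a ^+ 2 <= b ^+ 2 -> a <= b.
Proof.
move=> b0 h; rewrite leNgt; apply/negP => ba; move: h.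
by rewrite leNgt ltrXn2r ?nnegrE // ltW // (le_lt_trans b0).
Qed.

Lemma hex_upper p : nm (w p) <= 2 * (sz p)%:R.
Proof.
have [h _] := nm_hex p; have [_ h'] := hexq_bounds p.
apply: le_sqr; rewrite ?mulr_ge0 // h exprMn; apply: le_trans h' _.
by rewrite le_eqVlt; apply/orP; left; apply/eqP; ring.
Qed.

Lemma hex_lower p : 1 / 2 * (sz p)%:R <= nm (w p).
Proof.
have [h _] := nm_hex p; have [h' _] := hexq_bounds p.
apply: le_sqr; rewrite ?nm_ge0 // h exprMn; apply: le_trans h'.
by apply: ler_wpM2r; [exact: sqr_ge0|lra].
Qed.

(* A basis of the deformation [w + t * conj w] of the hexagonal lattice. *)
Definition tau1 (t : C) : C := 1 + t.
Definition tau2 (t : C) : C := rho + t * (1 - rho).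

Lemma period_tau t p : period (tau1 t) (tau2 t) p = w p + t * wb p.
Proof. by rewrite /period /tau1 /tau2; ring. Qed.

(** Conjugation preserves the norm, so the perturbation costs at most half of it, uniformly in
    [p]. *)
Lemma tau_ge (t : C) p : nm t <= 1 / 2 -> nm (w p) / 2 <= nm (period (tau1 t) (tau2 t) p).
Proof.
move=> t1; rewrite period_tau; have := nm_revD (w p) (t * wb p).
by rewrite nmM nm_wb; have := nm_ge0 (w p); nra.
Qed.

Lemma tau_lower t p : nm t <= 1 / 2 ->
  1 / 4 * (sz p)%:R <= nm (period (tau1 t) (tau2 t) p).
Proof. by move=> /(tau_ge p) h; have := hex_lower p; lra. Qed.

Lemma tau_basis s t : s != 0 -> nm t <= 1 / 2 -> lattice_basis (s * tau1 t) (s * tau2 t).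
Proof.
move=> s0 t1 a b h.
pose om : C := real_complex R a + real_complex R b * rho.
pose omb : C := real_complex R a + real_complex R b * (1 - rho).
have e : om + t * omb = 0.
  apply/(mulfI s0); rewrite mulr0 -[RHS]h /om /omb /tau1 /tau2; ring.
have omE : om = ((a + b / 2) +i* (b * (Num.sqrt 3 / 2)))%C.
  rewrite /om; apply/eqP; rewrite eq_complex /=.
  by apply/andP; split; apply/eqP; field.
have ombE : omb = ((a + b / 2) +i* (- (b * (Num.sqrt 3 / 2))))%C.
  rewrite /omb; apply/eqP; rewrite eq_complex /=.
  by apply/andP; split; apply/eqP; field.
have n : nm omb = nm om by rewrite omE ombE /nm /= sqrrN.
have om0 : om = 0.
  apply/eqP; rewrite -nm_eq0 eq_le nm_ge0 andbT.
  have : nm om = nm (t * omb) by rewrite -[om](addrK (t * omb)) e sub0r nmN.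
  by rewrite nmM n; have := nm_ge0 om; nra.
have s3 : Num.sqrt 3 / 2 != 0 :> R by rewrite mulf_neq0 ?gt_eqF ?sqrtr_gt0 ?invr_gt0.
have [re im] : a + b / 2 = 0 /\ b * (Num.sqrt 3 / 2) = 0.
  by move: om0; rewrite omE => -[-> ->].
move/eqP: im; rewrite mulf_eq0 (negPf s3) orbF => /eqP b0.
by split=> //; move: re; rewrite b0 mul0r addr0.
Qed.

Lemma box1 : box 1 = [:: (-1, -1); (-1, 0); (-1, 1); (0, -1); (0, 1); (1, -1); (1, 0); (1, 1)].
Proof. by []. Qed.

Lemma lsum_box1 (B B0 : R) F : cubic B0 F -> 0 <= B ->
  (forall p, (1 < sz p)%N -> nm (F p) <= B * (sz p)%:R ^- 4) ->
  nm (lsum F - psum F 1) <= 2 * B.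
Proof.
move=> FB BB h; apply: (cvs_le (N := 1) (lsum_cvs FB)) => n n1.
rewrite box_diff // -big_filter; apply: le_trans (nm_sum _ _) _; rewrite big_filter.
apply: (@le_trans _ _ (\sum_(p <- box n | (1 < sz p)%N) B * (sz p)%:R ^- 4)).
  by apply: ler_sum => p; apply: h.
by rewrite -mulr_sumr mulrC ler_wpM2r // sum_sz4_tail.
Qed.


Local Notation U0 := (pinv 1 rho).

Lemma w_lower p : 1 / 4 * (sz p)%:R <= nm (w p).
Proof. by have := hex_lower p; have := nm_ge0 (w p); lra. Qed.

Let q0 : 0 < 1 / 4 :> R. Proof. by []. Qed.

Lemma rho_inv : rho * (1 - rho) = 1.
Proof.
have -> : rho * (1 - rho) = rho - rho ^+ 2 by ring.
by rewrite rho_sqr; ring.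
Qed.

Lemma rho_neq0 : rho != 0.
Proof. by apply/eqP => h; have := rho_inv; rewrite h mul0r => /esym/eqP; rewrite oner_eq0. Qed.

Lemma rho6 : rho ^+ 6 = 1.
Proof.
have -> : rho ^+ 6 = (rho ^+ 2) ^+ 3 by rewrite -exprM.
rewrite rho_sqr.
have -> : (rho - 1) ^+ 3 = rho * rho ^+ 2 - 3 * rho ^+ 2 + 3 * rho - 1 by ring.
have -> : rho * rho ^+ 2 = rho ^+ 2 - rho by rewrite rho_sqr mulrBr mulr1 -expr2 rho_sqr.
by rewrite rho_sqr; ring.
Qed.

Lemma rhob6 : (1 - rho) ^+ 6 = 1.
Proof. by rewrite -[LHS]mul1r -{1}rho6 -exprMn rho_inv expr1n. Qed.

(** Multiplication by [rho] permutes the lattice, so $G_4=\rho^{-4}G_4=(\rho-1)G_4$; multiplying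
    $2-\rho$ by $1+\rho$ gives 3. *)
Lemma G4_hex : Gsum 1 rho 4 = 0.
Proof.
pose A (p : int * int) : int * int := (- p.2, p.1 + p.2).
pose A' (p : int * int) : int * int := (p.1 + p.2, - p.1).
have AK : cancel A A' by move=> [m n]; rewrite /A /A' /=; congr pair; lia.
have A'K : cancel A' A by move=> [m n]; rewrite /A /A' /=; congr pair; lia.
have c4 := U_cubic q0 w_lower (isT : 3 <= 4)%N.
have h : lsum (fun p => U0 (A p) ^+ 4) = Gsum 1 rho 4.
  apply: (lsum_reindex c4 AK A'K) => // -[m n]; rewrite /sz /A /A' /=; lia.
have wA p : w (A p) = rho * w p.
  rewrite /period /A /= rmorphN rmorphD /=.
  have -> : rho * (p.1%:~R * 1 + p.2%:~R * rho) = p.1%:~R * rho + p.2%:~R * rho ^+ 2 by ring.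
  by rewrite rho_sqr; ring.
have e : Gsum 1 rho 4 = (rho - 1) * Gsum 1 rho 4.
  rewrite -[in LHS]h -(lsumZ _ c4); apply: eq_lsum => p p0.
  rewrite /pinv wA invfM exprMn; congr (_ * _).
  have -> : rho^-1 = 1 - rho by apply: (mulfI rho_neq0); rewrite mulfV ?rho_neq0 ?rho_inv.
  have -> : (1 - rho) ^+ 4 = (1 - 2 * rho + rho ^+ 2) ^+ 2 by ring.
  rewrite rho_sqr; have -> : (1 - 2 * rho + (rho - 1)) ^+ 2 = rho ^+ 2 by ring.
  by rewrite rho_sqr.
have : 3 * Gsum 1 rho 4 = 0.
  have -> : 3 * Gsum 1 rho 4 = (1 + rho) * (Gsum 1 rho 4 - (rho - 1) * Gsum 1 rho 4)
     + (rho ^+ 2 - (rho - 1)) * Gsum 1 rho 4 by ring.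
  by rewrite -e subrr mulr0 add0r rho_sqr subrr mul0r.
by move/eqP; rewrite mulf_eq0 pnatr_eq0 /= => /eqP.
Qed.

(** Up to the factor $-4$, the derivative at $t=0$ of $G_4$ of the deformed lattice. *)
Definition H4 : C := lsum (fun p => wb p * U0 p ^+ 5).

Lemma nm_U0 p : nm (U0 p) = (nm (w p))^-1.
Proof. exact: nmV. Qed.

Lemma nm_w_gt0 p : (0 < sz p)%N -> 0 < nm (w p).
Proof.
move=> s0; apply: lt_le_trans (hex_lower p).
by rewrite mulr_gt0 ?ltr0n.
Qed.

Lemma nm_H4_term p : p != (0, 0) -> nm (wb p * U0 p ^+ 5) = nm (w p) ^- 4.
Proof.
rewrite -sz_gt0 => /nm_w_gt0 h; rewrite nmM nmX nm_U0 nm_wb.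
by field; rewrite gt_eqF.
Qed.

Lemma nm_w4 p : (1 < sz p)%N -> nm (w p) ^- 4 <= 16 / 9 * (sz p)%:R ^- 4.
Proof.
move=> s1; have s0 : (0 : R) < (sz p)%:R by rewrite ltr0n; lia.
have w0 : 0 < nm (w p) by apply: nm_w_gt0; lia.
have [h _] := nm_hex p; have [h' _] := hexq_bounds p; rewrite -h in h'.
rewrite -ler_pdivrMl // -[_^-1 * _]invfM lef_pV2 ?posrE ?mulr_gt0 ?exprn_gt0 //.
have -> : 16 / 9 * nm (w p) ^+ 4 = (4 / 3 * nm (w p) ^+ 2) ^+ 2 by field.
have -> : (sz p)%:R ^+ 4 = ((sz p)%:R ^+ 2) ^+ 2 :> R by ring.
by rewrite lerXn2r ?nnegrE ?mulr_ge0 ?sqr_ge0 //; lra.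
Qed.

Lemma H4_cubic : cubic (2 * 8 ^+ 4) (fun p => wb p * U0 p ^+ 5).
Proof.
move=> p p0; rewrite nm_H4_term //.
have := U_cubic q0 w_lower (isT : 3 <= 4)%N p0; rewrite nmX nm_U0 exprVn.
have -> : 2 / (1 / 4) = 8 :> R by field.
move/le_trans; apply; apply: ler_wpM2r; first by rewrite invr_ge0 exprn_ge0.
by have : 0 <= 8 ^+ 4 :> R by []; lra.
Qed.

Lemma psum_box1 (F : int * int -> C) : psum F 1 =
  F (-1, -1) + (F (-1, 0) + (F (-1, 1) + (F (0, -1) + (F (0, 1) + (F (1, -1)
   + (F (1, 0) + (F (1, 1) + 0))))))).
Proof. by rewrite /psum box1 !big_cons big_nil. Qed.

(** The six units contribute 6 and the pairs $\pm(1,1)$ at most $2/9$, while the tail beyond the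
    first shell is at most $32/9$. *)
Lemma lsum_hex_neq0 (B : R) (F : int * int -> C) : cubic B F ->
  (forall p, F (- p.1, - p.2) = F p) ->
  F (1, 0) = 1 -> F (0, 1) = 1 -> F (1, -1) = 1 -> nm (F (1, 1)) <= 1 / 9 ->
  (forall p, (1 < sz p)%N -> nm (F p) <= 16 / 9 * (sz p)%:R ^- 4) ->
  lsum F != 0.
Proof.
move=> FB Fe F10 F01 F1m F11 Ft.
have h := lsum_box1 FB (_ : 0 <= 16 / 9) Ft.
have {h} h : nm (lsum F - psum F 1) <= 2 * (16 / 9) by apply: h; rewrite divr_ge0.
have ps : psum F 1 = 6 + 2 * F (1, 1).
  rewrite psum_box1 (Fe (1, 1)) (Fe (1, 0)) (Fe (1, -1)) (Fe (0, 1)) F10 F01 F1m.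
  by ring.
apply/eqP => l0; move: h; rewrite l0 sub0r nmN ps => h.
have := nm_revD 6 (2 * F (1, 1)); rewrite nmM !nm_nat; lra.
Qed.

Lemma w_opp p : w (- p.1, - p.2) = - w p.
Proof. by rewrite /period /= !rmorphN /=; ring. Qed.

Lemma wb_opp p : wb (- p.1, - p.2) = - wb p.
Proof. by rewrite /period /= !rmorphN /=; ring. Qed.

Lemma U0_opp p : U0 (- p.1, - p.2) = - U0 p.
Proof. by rewrite /pinv w_opp invrN. Qed.

Lemma nm_w11 : nm (w (1, 1)) ^+ 2 = 3.
Proof. by have [-> _] := nm_hex (1, 1); rewrite /hexq /=; ring. Qed.

Lemma w10 : w (1, 0) = 1. Proof. by rewrite /period /=; ring. Qed.
Lemma w01 : w (0, 1) = rho. Proof. by rewrite /period /=; ring. Qed.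
Lemma w1m : w (1, -1) = 1 - rho.
Proof. by rewrite /period /= rmorphN1; ring. Qed.

Lemma rhob_neq0 : 1 - rho != 0.
Proof. by apply/eqP => h; have := rho_inv; rewrite h mulr0 => /esym/eqP; rewrite oner_eq0. Qed.

(** On the units $\bar w=w^{-1}$, so the term is $w^{-6}=1$; at $(1,1)$ one has $|w|^2=3$, whence
    $1/9$. *)
Lemma H4_neq0 : H4 != 0.
Proof.
apply: (lsum_hex_neq0 H4_cubic).
- by move=> p; rewrite wb_opp U0_opp; ring.
- have -> : wb (1, 0) = 1 by rewrite /period /=; ring.
  by rewrite /pinv w10 invr1 expr1n mulr1.
- have -> : wb (0, 1) = 1 - rho by rewrite /period /=; ring.
  rewrite /pinv w01; apply: (mulIf (expf_neq0 5 rho_neq0)).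
  rewrite -mulrA exprVn mulVf ?expf_neq0 ?rho_neq0 // mul1r mulr1.
  rewrite -[LHS]mulr1 -[X in _ * X = _]rho6.
  have -> : (1 - rho) * rho ^+ 6 = rho * (1 - rho) * rho ^+ 5 by ring.
  by rewrite rho_inv mul1r.
- have -> : wb (1, -1) = rho by rewrite /period /= rmorphN1; ring.
  rewrite /pinv w1m; apply: (mulIf (expf_neq0 5 rhob_neq0)).
  rewrite -mulrA exprVn mulVf ?expf_neq0 ?rhob_neq0 // mul1r mulr1.
  rewrite -[LHS]mulr1 -[X in _ * X = _]rhob6.
  have -> : rho * (1 - rho) ^+ 6 = rho * (1 - rho) * (1 - rho) ^+ 5 by ring.
  by rewrite rho_inv mul1r.
- rewrite nm_H4_term // -[4%N]/(2 * 2)%N exprM nm_w11.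
  by rewrite div1r lef_pV2 ?posrE; lra.
move=> p s1; rewrite nm_H4_term ?nm_w4 // -sz_gt0; lia.
Qed.

Lemma G6_hex_neq0 : Gsum 1 rho 6 != 0.
Proof.
apply: (lsum_hex_neq0 (U_cubic q0 w_lower (isT : 3 <= 6)%N)).
- by move=> p; rewrite U0_opp; ring.
- by rewrite /pinv w10 invr1 expr1n.
- by rewrite /pinv w01 exprVn rho6 invr1.
- by rewrite /pinv w1m exprVn rhob6 invr1.
- rewrite nmX nm_U0 exprVn -[6%N]/(2 * 3)%N exprM nm_w11.
  by rewrite div1r lef_pV2 ?posrE; lra.
move=> p s1; apply: le_trans (nm_w4 s1); rewrite nmX nm_U0 exprVn.
have w0 : 0 < nm (w p) by apply: nm_w_gt0; lia.
have w1 : 1 <= nm (w p).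
  have := hex_lower p; have : (2 : R) <= (sz p)%:R by rewrite ler_nat.
  lra.
by rewrite lef_pV2 ?posrE ?exprn_gt0 // ler_weXn2l.
Qed.

End Hexagonal.

(** * Dependence of the lattice functions on the deformation parameter *)

Section Deformation.
Variable R : realType.
Local Notation C := (cplx R).
Local Notation rho := (@rho R).
Local Notation w := (period 1 rho).
Local Notation wb := (period 1 (1 - rho)).
Local Notation U0 := (pinv 1 rho).
Local Notation V0 := (dinv 1 rho).
Local Notation Ut t := (pinv (tau1 t) (tau2 t)).
Local Notation Vt t := (dinv (tau1 t) (tau2 t)).

(** Errors are measured relative to the bounds [X] and [Y], so that they simply add under
    multiplication; powers follow by induction. *)
Lemma prod_diff (x y x' y' : C) (X Y a b e : R) : nm x' <= X -> nm y <= Y ->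
  nm (x - x') <= a * e * X -> nm (y - y') <= b * e * Y ->
  nm (x * y - x' * y') <= (a + b) * e * (X * Y).
Proof.
move=> hx hy dx dy; have X0 := le_trans (nm_ge0 _) hx; have Y0 := le_trans (nm_ge0 _) hy.
have -> : x * y - x' * y' = (x - x') * y + x' * (y - y') by ring.
apply: le_trans (nmD _ _) _; rewrite !nmM.
have h1 := ler_pM (nm_ge0 _) (nm_ge0 _) dx hy.
have h2 := ler_pM (nm_ge0 _) (nm_ge0 _) hx dy.
apply: le_trans (lerD h1 h2) _; rewrite le_eqVlt; apply/orP; left; apply/eqP; ring.
Qed.

Lemma pow_diff (x x' : C) (X e : R) (n : nat) : nm x <= X -> nm x' <= X ->
  nm (x - x') <= e * X -> nm (x ^+ n - x' ^+ n) <= n%:R * e * X ^+ n.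
Proof.
move=> hx hx' dx; have X0 := le_trans (nm_ge0 _) hx.
elim: n => [|n IH]; first by rewrite subrr nm0 !mul0r.
have -> : n.+1%:R = 1 + n%:R :> R by rewrite -natr1 addrC.
rewrite !exprS; apply: prod_diff => //; last by rewrite mul1r.
by rewrite nmX lerXn2r ?nnegrE ?nm_ge0.
Qed.

Lemma mixed_diff (x y x' y' : C) (X e : R) (j k : nat) :
  nm x <= X -> nm x' <= X -> nm y <= X -> nm y' <= X ->
  nm (x - x') <= e * X -> nm (y - y') <= e * X ->
  nm (x ^+ j * y ^+ k - x' ^+ j * y' ^+ k) <= (j + k)%:R * e * X ^+ (j + k).
Proof.
move=> hx hx' hy hy' dx dy; have X0 := le_trans (nm_ge0 _) hx.
rewrite natrD exprD; apply: prod_diff; rewrite ?pow_diff // nmX.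
  by rewrite lerXn2r ?nnegrE ?nm_ge0.
by rewrite lerXn2r ?nnegrE ?nm_ge0.
Qed.

Lemma inv_diff (a b x : C) : x - a != 0 -> x - b != 0 ->
  (x - a)^-1 - (x - b)^-1 = (a - b) * ((x - a)^-1 * (x - b)^-1).
Proof. by move=> h1 h2; field; rewrite h1 h2. Qed.

Let q0 : 0 < 1 / 4 :> R. Proof. by []. Qed.

(** The periods differ by $t\bar w$, of norm at most [2 * nm t * sz p], and each of the two inverses
    is at most [8 / sz p]. *)
Lemma V_diff (t z : C) p : nm t <= 1 / 2 -> nm z <= 1 / 8 -> p != (0, 0) ->
  nm (Vt t z p - V0 z p) <= 16 * nm t * (8 / (sz p)%:R).
Proof.
move=> t1 z1 p0; have zd : nm z <= 1 / 4 / 2 by lra.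
have lt := fun p => tau_lower p t1; have l0 := @w_lower R.
have e8 : 2 / (1 / 4) = 8 :> R by field.
have s0 : (0 : R) < (sz p)%:R by rewrite ltr0n sz_gt0.
have h1 := inv_le s0 (V_le q0 lt zd p0); have h2 := inv_le s0 (V_le q0 l0 zd p0).
rewrite e8 in h1 h2.
rewrite /dinv inv_diff ?(period_dist_neq0 q0 lt zd p0) ?(period_dist_neq0 q0 l0 zd p0) //.
rewrite -/(Vt t z p) -/(V0 z p) period_tau addrAC subrr add0r !nmM nm_wb.
have h3 := hex_upper R p.
apply: (@le_trans _ _ (nm t * (2 * (sz p)%:R) * (8 / (sz p)%:R * (8 / (sz p)%:R)))).
  by rewrite ler_pM ?mulr_ge0 ?nm_ge0 ?ler_pM ?nm_ge0.
by rewrite le_eqVlt; apply/orP; left; apply/eqP; field; rewrite gt_eqF.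
Qed.

Lemma U_V0 (w1 w2 : C) p : pinv w1 w2 p = - dinv w1 w2 0 p.
Proof. by rewrite /pinv /dinv sub0r invrN opprK. Qed.

Lemma U_diff (t : C) p : nm t <= 1 / 2 -> p != (0, 0) ->
  nm (Ut t p - U0 p) <= 16 * nm t * (8 / (sz p)%:R).
Proof.
move=> t1 p0; rewrite !U_V0 -opprD nmN; apply: V_diff => //.
by rewrite nm0 divr_ge0.
Qed.

Lemma Tsum_diff (t z : C) (j k : nat) : nm t <= 1 / 2 -> nm z <= 1 / 8 -> (3 <= j + k)%N ->
  nm (Tsum (tau1 t) (tau2 t) j k z - Tsum 1 rho j k z)
  <= 16 * ((j + k)%:R * (16 * nm t) * 8 ^+ (j + k)).
Proof.
move=> t1 z1 jk; have zd : nm z <= 1 / 4 / 2 by lra.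
have lt := fun p => tau_lower p t1; have l0 := @w_lower R.
have e8 : 2 / (1 / 4) = 8 :> R by field.
rewrite /Tsum -(lsumB (UV_mixed q0 lt zd jk) (UV_mixed q0 l0 zd jk)).
apply: lsum_le => p p0.
have s0 : (0 : R) < (sz p)%:R by rewrite ltr0n sz_gt0.
have s1 : (1 : R) <= (sz p)%:R by rewrite ler1n sz_gt0.
have h1 := inv_le s0 (V_le q0 lt zd p0); have h2 := inv_le s0 (V_le q0 l0 zd p0).
have h3 := inv_le s0 (U_le q0 lt p0); have h4 := inv_le s0 (U_le q0 l0 p0).
rewrite e8 in h1 h2 h3 h4.
have := mixed_diff j k h3 h4 h1 h2 (U_diff t1 p0) (V_diff t1 z1 p0).
move/le_trans; apply; rewrite -[leRHS]mulrA; apply: ler_wpM2l.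
  by rewrite !mulr_ge0 ?nm_ge0.
rewrite expr_div_n; apply: ler_wpM2l; first by rewrite exprn_ge0.
by rewrite lef_pV2 ?posrE ?exprn_gt0 // ler_weXn2l.
Qed.

Lemma Tsum_cvs (t : nat -> C) (z : C) (j k : nat) : cvs t 0 ->
  (forall n, nm (t n) <= 1 / 2) -> nm z <= 1 / 8 -> (3 <= j + k)%N ->
  cvs (fun n => Tsum (tau1 (t n)) (tau2 (t n)) j k z) (Tsum 1 rho j k z).
Proof.
move=> t0 t1 z1 jk e e0.
pose M : R := 16 * ((j + k)%:R * 16 * 8 ^+ (j + k)).
have M0 : 0 <= M by rewrite !mulr_ge0 ?exprn_ge0.
have [|N hN] := t0 (e / (M + 1)); first by rewrite divr_gt0 //; lra.
exists N => n /hN; rewrite subr0 ltr_pdivlMr; last by lra.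
move=> h; apply: le_lt_trans (Tsum_diff (t1 n) z1 jk) _; apply: le_lt_trans h.
have -> : 16 * ((j + k)%:R * (16 * nm (t n)) * 8 ^+ (j + k)) = nm (t n) * M.
  by rewrite /M; ring.
by rewrite ler_wpM2l ?nm_ge0 // lerDl.
Qed.

Lemma wp_Tsum (w1 w2 z : C) (d : R) : 0 < d ->
  (forall p, d * (sz p)%:R <= nm (period w1 w2 p)) -> nm z <= d / 2 ->
  wp w1 w2 z = z ^- 2 + (2 * z * Tsum w1 w2 1 2 z + - z ^+ 2 * Tsum w1 w2 2 2 z).
Proof.
move=> d0 lower zd; rewrite wpE; congr (_ + _).
rewrite /Tsum -(lsum2 _ _ (UV_mixed d0 lower zd (isT : 3 <= 1 + 2)%N)
  (UV_mixed d0 lower zd (isT : 3 <= 2 + 2)%N)).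
by apply: eq_lsum => p p0; rewrite (wpTE d0 lower).
Qed.

Lemma Ssum3_Tsum (w1 w2 z : C) : Ssum w1 w2 3 z = z ^- 3 + Tsum w1 w2 0 3 z.
Proof. by congr (_ + _); apply: eq_lsum => p p0; rewrite mul1r. Qed.

Lemma Gsum_Tsum (w1 w2 z : C) k : Gsum w1 w2 k = Tsum w1 w2 k 0 z.
Proof. by apply: eq_lsum => p p0; rewrite mulr1. Qed.

Lemma wp_cvs (t : nat -> C) (z : C) : cvs t 0 -> (forall n, nm (t n) <= 1 / 2) ->
  nm z <= 1 / 8 -> cvs (fun n => wp (tau1 (t n)) (tau2 (t n)) z) (wp 1 rho z).
Proof.
move=> t0 t1 z1; have zd : nm z <= 1 / 4 / 2 by lra.
rewrite (wp_Tsum q0 (@w_lower R) zd).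
have h1 := cvsM (cvs_cst (2 * z)) (Tsum_cvs t0 t1 z1 (isT : 3 <= 1 + 2)%N).
have h2 := cvsM (cvs_cst (- z ^+ 2)) (Tsum_cvs t0 t1 z1 (isT : 3 <= 2 + 2)%N).
apply: cvs_ext (cvsD (cvs_cst (z ^- 2)) (cvsD h1 h2)) => n.
by rewrite (wp_Tsum q0 (fun p => tau_lower p (t1 n)) zd).
Qed.

Lemma Ssum3_cvs (t : nat -> C) (z : C) : cvs t 0 -> (forall n, nm (t n) <= 1 / 2) ->
  nm z <= 1 / 8 -> cvs (fun n => Ssum (tau1 (t n)) (tau2 (t n)) 3 z) (Ssum 1 rho 3 z).
Proof.
move=> t0 t1 z1; rewrite Ssum3_Tsum.
apply: cvs_ext (cvsD (cvs_cst (z ^- 3)) (Tsum_cvs t0 t1 z1 (isT : 3 <= 0 + 3)%N)) => n.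
by rewrite Ssum3_Tsum.
Qed.

Lemma G4_cvs (t : nat -> C) : cvs t 0 -> (forall n, nm (t n) <= 1 / 2) ->
  cvs (fun n => Gsum (tau1 (t n)) (tau2 (t n)) 4) 0.
Proof.
move=> t0 t1; have z1 : nm (0 : C) <= 1 / 8 by rewrite nm0 divr_ge0.
have := Tsum_cvs t0 t1 z1 (isT : 3 <= 4 + 0)%N; rewrite -Gsum_Tsum G4_hex.
by apply: cvs_ext => n; rewrite -Gsum_Tsum.
Qed.

(** With $y=t\bar w/w$, the remainder of $(1+y)^{-4}$ after $1-4y$ is
    $y^2(10+20y+15y^2+4y^3)/(1+y)^4$, and $49=10+20+15+4$. The constant term vanishes by
    [G4_hex]. *)
Lemma G4_linear (t : C) : nm t <= 1 / 2 ->
  nm (Gsum (tau1 t) (tau2 t) 4 + 4 * t * H4 R) <= 16 * (49 * 8 ^+ 4) * nm t ^+ 2.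
Proof.
move=> t1; have lt := fun p => tau_lower p t1.
have e8 : 2 / (1 / 4) = 8 :> R by field.
have c4 := U_cubic q0 lt (isT : 3 <= 4)%N; have c40 := U_cubic q0 (@w_lower R) (isT : 3 <= 4)%N.
rewrite e8 in c4.
pose r p := (wb p * U0 p) ^+ 2 * Ut t p ^+ 4 * (10 + 20 * t * (wb p * U0 p)
  + 15 * t ^+ 2 * (wb p * U0 p) ^+ 2 + 4 * t ^+ 3 * (wb p * U0 p) ^+ 3).
have rB : cubic (49 * 8 ^+ 4) r.
  move=> p p0; have n1 : nm (wb p * U0 p) = 1.
    rewrite nmM nm_U0 nm_wb divff // gt_eqF // nm_w_gt0 // sz_gt0 //.
  rewrite /r; set e := wb p * U0 p in n1 *.
  rewrite 2!nmM [nm (e ^+ 2)]nmX n1 expr1n mul1r mulrC -[leRHS]mulrA.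
  apply: ler_pM; rewrite ?nm_ge0 ?(c4 p p0) //.
  have tk (k : nat) : nm (t ^+ k * e ^+ k) <= 1.
    rewrite nmM !nmX n1 expr1n mulr1 exprn_ile1 ?nm_ge0 //; lra.
  have := nmD5 10 (20 * (t ^+ 1 * e ^+ 1)) (15 * (t ^+ 2 * e ^+ 2)) (4 * (t ^+ 3 * e ^+ 3)) 0.
  rewrite nm0 ![nm (_%:R * _)]nmM !nm_nat.
  have := tk 1%N; have := tk 2%N; have := tk 3%N => k3 k2 k1 h.
  have -> : 10 + 20 * t * e + 15 * t ^+ 2 * e ^+ 2 + 4 * t ^+ 3 * e ^+ 3
    = 10 + 20 * (t ^+ 1 * e ^+ 1) + 15 * (t ^+ 2 * e ^+ 2) + 4 * (t ^+ 3 * e ^+ 3) + 0 by ring.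
  lra.
have c5 := H4_cubic R.
have -> : Gsum (tau1 t) (tau2 t) 4 + 4 * t * H4 R = t ^+ 2 * lsum r.
  have -> : Gsum (tau1 t) (tau2 t) 4 = Gsum (tau1 t) (tau2 t) 4 - Gsum 1 rho 4.
    by rewrite G4_hex subr0.
  rewrite -(lsumB c4 c40) -(lsumZ (4 * t) c5) -(lsumZ (t ^+ 2) rB).
  rewrite -(lsumD (cubicB c4 c40) (cubicZ (4 * t) c5)).
  apply: eq_lsum => p p0; have n1 := period_neq0 q0 lt p0.
  have n0 := period_neq0 q0 (@w_lower R) p0.
  rewrite period_tau in n1; rewrite /r /pinv period_tau.
  by field; rewrite n0 n1.
rewrite nmM nmX mulrC; apply: ler_wpM2r; first by rewrite exprn_ge0 ?nm_ge0.
exact: lsum_le rB.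
Qed.

Lemma G4_neq0_near : exists2 e : R, 0 < e & forall t : C, t != 0 -> nm t < e ->
  nm t <= 1 / 2 /\ Gsum (tau1 t) (tau2 t) 4 != 0.
Proof.
pose K : R := 16 * (49 * 8 ^+ 4).
have K0 : 0 <= K by rewrite !mulr_ge0 ?exprn_ge0.
have H0 : 0 < nm (H4 R) by rewrite nm_gt0 H4_neq0.
have K1 : 0 < K + 1 by lra.
exists (Num.min (1 / 2) (nm (H4 R) / (K + 1))); first by rewrite lt_min !divr_gt0.
move=> t t0; rewrite lt_min => /andP[t1]; rewrite ltr_pdivlMr // => t2.
have t1' := ltW t1; split=> //; apply/eqP => g0.
have := G4_linear t1'; rewrite g0 add0r !nmM nm_nat -/K.
have n0 : 0 < nm t by rewrite nm_gt0.
nra.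
Qed.

Lemma deform_seq : exists t : nat -> C, [/\ cvs t 0, forall n, nm (t n) <= 1 / 2 &
  forall n, Gsum (tau1 (t n)) (tau2 (t n)) 4 != 0].
Proof.
have [e e0 h] := G4_neq0_near; pose t n : C := real_complex R (e / n.+2%:R).
have nt n : nm (t n) = e / n.+2%:R by rewrite nm_real gtr0_norm // divr_gt0.
have te n : nm (t n) < e by rewrite nt ltr_pdivrMr // ltr_pMr // ltr1n.
have t0 n : t n != 0 by rewrite -nm_gt0 nt divr_gt0.
exists t; split=> [d d0|n|n].
- have [N N0 hN] := small_inv e d0; exists N => n Nn; rewrite subr0 nt.
  apply: le_lt_trans hN; rewrite ler_wpM2l ?(ltW e0) // lef_pV2 ?posrE ?ltr0n //.
  by rewrite ler_nat; lia.
- by have [] := h _ (t0 n) (te n).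
- by have [] := h _ (t0 n) (te n).
Qed.

End Deformation.

(** * Zariski density of the lattice parameters *)

Section Density.
Variable R : realType.
Local Notation C := (cplx R).
Local Notation rho := (@rho R).

Definition ev2 (c : {poly {poly C}}) (x y : C) : C := c.[y%:P].[x].
(** The outermost variable is [l], so that [poly_ind] splits a polynomial into a multiple of
    $\lambda$ and its restriction to $\lambda=0$. *)
Definition ev3 (c : {poly {poly {poly C}}}) (x y l : C) : C := ev2 c.[l%:P%:P] x y.

Lemma cvs_ev1 (p : {poly C}) (u : nat -> C) l : cvs u l -> cvs (fun n => p.[u n]) p.[l].
Proof.
move=> ul; elim/poly_ind: p => [|p c IH].
  by rewrite horner0; apply: cvs_ext (cvs_cst 0) => n; rewrite horner0.
rewrite hornerMXaddC; apply: cvs_ext (cvsD (cvsM IH ul) (cvs_cst c)) => n.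
by rewrite hornerMXaddC.
Qed.

Lemma ev2MXaddC p c x y : ev2 (p * 'X + c%:P) x y = ev2 p x y * y + c.[x].
Proof. by rewrite /ev2 hornerMXaddC hornerD hornerM hornerC. Qed.

Lemma ev3MXaddC p c x y l : ev3 (p * 'X + c%:P) x y l = ev3 p x y l * l + ev2 c x y.
Proof. by rewrite /ev3 /ev2 hornerMXaddC hornerD hornerM hornerD hornerM !hornerC. Qed.

Lemma cvs_ev2 c (u v : nat -> C) x y : cvs u x -> cvs v y ->
  cvs (fun n => ev2 c (u n) (v n)) (ev2 c x y).
Proof.
move=> ux vy; elim/poly_ind: c => [|p c IH].
  by rewrite /ev2 !horner0; apply: cvs_ext (cvs_cst 0) => n; rewrite !horner0.
rewrite ev2MXaddC; apply: cvs_ext (cvsD (cvsM IH vy) (cvs_ev1 c ux)) => n.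
by rewrite ev2MXaddC.
Qed.

Lemma cvs_ev3 c (u v w : nat -> C) x y l : cvs u x -> cvs v y -> cvs w l ->
  cvs (fun n => ev3 c (u n) (v n) (w n)) (ev3 c x y l).
Proof.
move=> ux vy wl; elim/poly_ind: c => [|p c IH].
  by rewrite /ev3 /ev2 !horner0; apply: cvs_ext (cvs_cst 0) => n; rewrite !horner0.
rewrite ev3MXaddC; apply: cvs_ext (cvsD (cvsM IH wl) (cvs_ev2 c ux vy)) => n.
by rewrite ev3MXaddC.
Qed.

(** The sequence may repeat values, so roots are not counted: the limit is a root by continuity, and
    dividing by $X-l$ preserves the zeros [u n]. *)
Lemma seq_root (p : {poly C}) (u : nat -> C) l : cvs u l -> (forall n, u n != l) ->
  (forall n, p.[u n] = 0) -> p = 0.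
Proof.
move=> ul unl; elim: {p}(size p) {-2}p (leqnn (size p)) => [|k IH] p sp pu.
  by apply/eqP; rewrite -size_poly_eq0 -leqn0.
have pl : root p l.
  apply/rootP; apply: (cvs_uniq (cvs_ev1 p ul)).
  by apply: cvs_ext (cvs_cst 0) => n; rewrite pu.
have /factor_theorem[q qE] := pl.
case: (eqVneq q 0) => [q0|q0]; first by rewrite qE q0 mul0r.
suff : q = 0 by move/eqP; rewrite (negPf q0).
apply: IH => [|n].
  by move: sp; rewrite qE size_Mmonic ?monicXsubC // size_XsubC addn2.
have := pu n; rewrite qE hornerM hornerXsubC => /eqP.
by rewrite mulf_eq0 subr_eq0 (negPf (unl n)) orbF => /eqP.
Qed.

Lemma inj_root (T : idomainType) (p : {poly T}) (f : nat -> T) : injective f ->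
  (forall n, p.[f n] = 0) -> p = 0.
Proof.
move=> fi pf; apply/eqP; apply: contraT => p0.
have := max_poly_roots p0 (_ : all (root p) (map f (iota 0 (size p)))) _.
rewrite size_map size_iota ltnn => -> //.
  by apply/allP => _ /mapP[n _ ->]; apply/rootP.
by rewrite map_inj_uniq ?iota_uniq.
Qed.

Lemma ev2_eq0 (c : {poly {poly C}}) :
  (forall x y, x != 0 -> y != 0 -> ev2 c x y = 0) -> c = 0.
Proof.
move=> h; have nS (n : nat) : (n.+1%:R : C) != 0 by rewrite pnatr_eq0.
have nI : injective (fun n : nat => n.+1%:R : C).
  by move=> m n /eqP; rewrite eqr_nat => /eqP[].
apply: (@inj_root _ c (fun n => (n.+1%:R : C)%:P)) => [m n /polyC_inj/nI //|n].
by apply: (@inj_root _ _ (fun n => n.+1%:R : C) nI) => m; apply: h.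
Qed.

Lemma ev2_line (c : {poly {poly C}}) (a b : C) :
  exists p : {poly C}, forall k, p.[k] = ev2 c (a * k) (b * k).
Proof.
elim/poly_ind: c => [|c e [p hp]].
  by exists 0 => k; rewrite /ev2 !horner0.
exists (p * (b *: 'X) + (e \Po (a *: 'X))) => k.
by rewrite ev2MXaddC hornerD hornerM hp horner_comp !hornerE.
Qed.

(* The curves [y^2 = x^3 / k_n] are permuted by [(x, y) -> (s^2 x, s^3 y)] and
   parametrized by [t -> (k_n t^2, k_n t^3)]. *)
Lemma plane_dense (c : {poly {poly C}}) (x y : nat -> C) (l : C) :
  (forall n, x n != 0) -> (forall n, y n != 0) ->
  (forall n, x n ^+ 3 / y n ^+ 2 != l) -> cvs (fun n => x n ^+ 3 / y n ^+ 2) l ->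
  (forall s n, s != 0 -> ev2 c (s ^+ 2 * x n) (s ^+ 3 * y n) = 0) -> c = 0.
Proof.
move=> x0 y0 kl kc h; apply: ev2_eq0 => a b a0 b0.
have [p hp] := ev2_line c ((b / a) ^+ 2) ((b / a) ^+ 3).
have p0 : p = 0.
  apply: (seq_root kc kl) => n; rewrite hp.
  (* This scaling moves the given point to the point of parameter $b/a$ on the same cubic. *)
  have := h (b / a * (x n / y n)) n; have xn := x0 n; have yn := y0 n.
  rewrite !mulf_neq0 ?invr_neq0 // => /(_ isT).
  have -> : (b / a * (x n / y n)) ^+ 2 * x n = (b / a) ^+ 2 * (x n ^+ 3 / y n ^+ 2).
    by field; rewrite a0 yn.
  have -> // : (b / a * (x n / y n)) ^+ 3 * y n = (b / a) ^+ 3 * (x n ^+ 3 / y n ^+ 2).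
  by field; rewrite a0 yn.
(* At $k=a^3/b^2$ the curve point of parameter $b/a$ is $(a,b)$ itself. *)
have := hp (a ^+ 3 / b ^+ 2); rewrite p0 horner0.
have -> : (b / a) ^+ 2 * (a ^+ 3 / b ^+ 2) = a by field; rewrite a0 b0.
by have -> : (b / a) ^+ 3 * (a ^+ 3 / b ^+ 2) = b by field; rewrite a0 b0.
Qed.

Lemma modO_Oz1 (f : C -> C) c s (k : nat) : (0 < k)%N -> modO k f (hrec (c :: s)) ->
  Oz 1 (fun x => f x - c).
Proof.
move=> k0 h; have h2 := @OzM _ 1 0 _ _ (Oz_id R) (Oz_hrec s).
by apply: Oz_ext (OzD (Oz_le k0 h) h2) => x /=; ring.
Qed.

Let q0 : 0 < 1 / 4 :> R. Proof. by []. Qed.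

(** The ratio $\wp^3/\wp'^2$ tends to $1/4$; it misses that value near 0 because
    $Y^2-X^3=-35G_6z^6+O(z^7)$ with $G_6\ne 0$. *)
Lemma hex_curve : exists z : nat -> C, [/\
  forall n, z n != 0 /\ nm (z n) <= 1 / 16,
  forall n, wp 1 rho (z n) != 0, forall n, - 2 * Ssum 1 rho 3 (z n) != 0,
  forall n, wp 1 rho (z n) ^+ 3 / (- 2 * Ssum 1 rho 3 (z n)) ^+ 2 != 1 / 4 &
  cvs (fun n => wp 1 rho (z n) ^+ 3 / (- 2 * Ssum 1 rho 3 (z n)) ^+ 2) (1 / 4)].
Proof.
pose X z := z ^+ 2 * wp 1 rho z; pose Y z := z ^+ 3 * Ssum 1 rho 3 z.
pose g := Gsum 1 rho 6.
have hX : modO 7 X (hrec [:: 1; 0; 0; 0; 3 * Gsum 1 rho 4; 0; 5 * g]).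
  exact: (z2wp_modO q0 (@w_lower R)).
have hY : modO 7 Y (hrec [:: 1; 0; 0; 0; - 3 * Gsum 1 rho 4; 0; - 10 * g]).
  exact: (z3S3_modO q0 (@w_lower R)).
rewrite G4_hex !mulr0 in hX hY.
have h7 : Oz 7 (fun z => Y z * Y z - X z * (X z * X z) + 35 * g * z ^+ 6).
  have h2 := modO_mul hY hY; have h3 := modO_mul hX (modO_mul hX hX).
  (* The terms of degrees 12 and 18 of $(1-10gz^6)^2-(1+5gz^6)^3$. *)
  have O := OzM (Oz_idX R 7) (Oz_hrec [:: 0; 0; 0; 0; 0; 25 * g ^+ 2;
     0; 0; 0; 0; 0; - 125 * g ^+ 3]).
  apply: Oz_ext (OzD (OzB h2 h3) O) => z /=; ring.
have [M1 [r1 [M10 r10 _ hX1]]] := modO_Oz1 (isT : 0 < 7)%N hX.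
have [M2 [r2 [M20 r20 _ hY1]]] := modO_Oz1 (isT : 0 < 7)%N hY.
have [M3 [r3 [M30 r30 _ hXY]]] := h7.
have g0 : 0 < nm g by rewrite nm_gt0 G6_hex_neq0.
pose M := M1 + M2 + M3 + 35 * nm g + 1.
have M0 : 0 < M by rewrite /M; lra.
(* The bound [1 / (4 * M)] keeps [X] and [Y] close to 1, and [nm g / M] makes the $O(z^7)$ error
   smaller than $35|g||z|^6$. *)
pose e : R := Num.min (Num.min r1 r2) (Num.min r3 (Num.min (1 / 16)
   (Num.min (1 / (4 * M)) (nm g / M)))).
have e0 : 0 < e by rewrite !lt_min r10 r20 r30 !divr_gt0 ?mulr_gt0.
pose z n : C := real_complex R (e / n.+2%:R).
have nz n : nm (z n) = e / n.+2%:R by rewrite nm_real gtr0_norm // divr_gt0.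
have ze n : nm (z n) < e by rewrite nz ltr_pdivrMr // ltr_pMr // ltr1n.
have z0 n : z n != 0 by rewrite -nm_gt0 nz divr_gt0.
have key n : [/\ nm (z n) <= 1 / 16, 1 / 2 <= nm (X (z n)), 1 / 2 <= nm (Y (z n)),
    Y (z n) * Y (z n) - X (z n) * (X (z n) * X (z n)) != 0 &
    nm (Y (z n) * Y (z n) - X (z n) * (X (z n) * X (z n))) <= M * nm (z n)].
  have := ze n; rewrite !lt_min => /andP[/andP[a1 a2] /and4P[a3 a4 a5 a6]].
  have b1 := hX1 _ (z0 n) a1; have b2 := hY1 _ (z0 n) a2; have b3 := hXY _ (z0 n) a3.
  move: a5; rewrite ltr_pdivlMr ?mulr_gt0 // => a5.
  move: a6; rewrite ltr_pdivlMr // => a6.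
  have nz0 : 0 < nm (z n) by rewrite nm_gt0.
  rewrite expr1 in b1 b2.
  set x := X (z n) in b1 b3 *; set y := Y (z n) in b2 b3 *; set k := nm (z n) in a1 a2 a3 a4 a5 a6 b1 b2 b3 nz0 *.
  have k1 : k <= 1 by lra.
  have c1 : M1 * k <= M * k by rewrite ler_wpM2r ?(ltW nz0) // /M; lra.
  have c2 : M2 * k <= M * k by rewrite ler_wpM2r ?(ltW nz0) // /M; lra.
  have c3 : M3 * k <= M * k by rewrite ler_wpM2r ?(ltW nz0) // /M; lra.
  have k6 : 0 < k ^+ 6 by rewrite exprn_gt0.
  have k61 : k ^+ 6 <= k by rewrite -[leRHS]expr1 ler_wiXn2l // ltW.
  have n6 : nm (35 * g * z n ^+ 6) = 35 * nm g * k ^+ 6 by rewrite nmM nmX [nm (35 * g)]nmM nm_nat.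
  have b3' : nm (y * y - x * (x * x) + 35 * g * z n ^+ 6) <= M3 * k * k ^+ 6.
    by have -> : M3 * k * k ^+ 6 = M3 * k ^+ 7 by ring.
  split.
  - exact: ltW.
  - by have := nm_rev 1 x; rewrite nm1 nmB; lra.
  - by have := nm_rev 1 y; rewrite nm1 nmB; lra.
  - apply/eqP => d0; move: b3'; rewrite d0 add0r n6 ler_pM2r //; lra.
  - have := nm_revD (y * y - x * (x * x)) (35 * g * z n ^+ 6); rewrite n6.
    have : M3 * k * k ^+ 6 <= M3 * k.
      by rewrite ler_piMr ?mulr_ge0 // ?(ltW nz0) //; lra.
    have : 35 * nm g * k ^+ 6 <= 35 * nm g * k by rewrite ler_wpM2l //; lra.
    have : (M3 + 35 * nm g) * k <= M * k by rewrite ler_wpM2r ?(ltW nz0) // /M; lra.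
    lra.
have wX n : wp 1 rho (z n) = X (z n) / z n ^+ 2.
  by rewrite /X mulrC mulKf // expf_neq0.
have sY n : Ssum 1 rho 3 (z n) = Y (z n) / z n ^+ 3.
  by rewrite /Y mulrC mulKf // expf_neq0.
have X0 n : X (z n) != 0 by have [_ h _ _ _] := key n; rewrite -nm_gt0; lra.
have Y0 n : Y (z n) != 0 by have [_ _ h _ _] := key n; rewrite -nm_gt0; lra.
have kE n : wp 1 rho (z n) ^+ 3 / (- 2 * Ssum 1 rho 3 (z n)) ^+ 2 - 1 / 4
    = - (Y (z n) * Y (z n) - X (z n) * (X (z n) * X (z n))) / (4 * Y (z n) ^+ 2).
  rewrite wX sY; move: (X (z n)) (Y (z n)) (z n) (z0 n) (Y0 n) => x y v v0 y0.
  by field; rewrite v0 y0.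
exists z; split=> [n|n|n|n|].
- by split=> //; have [] := key n.
- by rewrite wX mulf_neq0 ?invr_neq0 ?expf_neq0.
- rewrite sY mulf_neq0 ?oppr_eq0 ?pnatr_eq0 // mulf_neq0 // invr_neq0 //.
  exact: expf_neq0.
- have [_ _ _ h _] := key n.
  rewrite -subr_eq0 kE mulf_neq0 ?oppr_eq0 // invr_neq0 // mulf_neq0 ?pnatr_eq0 //.
  exact: expf_neq0.
move=> d d0; have [N N0 hN] := small_inv (M * e) d0.
exists N => n Nn; have [_ _ hy _ hm] := key n.
rewrite kE nmM nmN nmV nmM nm_nat nmX.
apply: (@le_lt_trans _ _ (M * nm (z n))).
  rewrite ler_pdivrMr; last by rewrite mulr_gt0 // exprn_gt0 // nm_gt0.
  apply: le_trans hm _; rewrite ler_peMr ?mulr_ge0 ?nm_ge0 ?(ltW M0) //.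
  by nra.
apply: le_lt_trans hN; rewrite nz mulrA ler_wpM2l ?(ltW (mulr_gt0 M0 e0)) // lef_pV2 ?posrE ?ltr0n //.
by rewrite ler_nat (leq_trans Nn (leqW (leqW (leqnn n)))).
Qed.

(** The hypothesis is restricted to $G_4\ne 0$ so that, after division by $\lambda$, it holds again
    for the quotient; the hexagonal values enter only as limits. *)
Lemma lattice_dense (c : {poly {poly {poly C}}}) :
  (forall s t z : C, s != 0 -> nm t <= 1 / 2 -> Gsum (tau1 t) (tau2 t) 4 != 0 ->
     z != 0 -> nm z <= 1 / 16 ->
     ev3 c (s ^+ 2 * wp (tau1 t) (tau2 t) z) (s ^+ 3 * (- 2 * Ssum (tau1 t) (tau2 t) 3 z))
       (s ^+ 4 * g2 (tau1 t) (tau2 t)) = 0) -> c = 0.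
Proof.
elim/poly_ind: c => [//|p c IH] h.
have [t [t0 t1 tG]] := deform_seq R.
have c0 : c = 0.
  have [z [z0 wz sz kz kc]] := hex_curve.
  apply: (plane_dense wz sz kz kc) => s n s0; have [zn zn1] := z0 n.
  have zn2 : nm (z n) <= 1 / 8 by lra.
  have h1 := cvsM (cvs_cst (s ^+ 2)) (wp_cvs t0 t1 zn2).
  have h2 := cvsM (cvs_cst (s ^+ 3)) (cvsM (cvs_cst (- 2)) (Ssum3_cvs t0 t1 zn2)).
  have h3 := cvsM (cvs_cst (s ^+ 4)) (cvsM (cvs_cst 60) (G4_cvs t0 t1)).
  rewrite mulr0 mulr0 in h3.
  have := cvs_ev3 (p * 'X + c%:P) h1 h2 h3.
  rewrite ev3MXaddC mulr0 add0r => hc.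
  apply: (cvs_uniq hc); apply: cvs_ext (cvs_cst 0) => m.
  by rewrite -(h s (t m) (z n)) // g2E.
rewrite c0 addr0; rewrite IH ?mul0r // => s u z s0 u1 uG z0 z1.
have := h s u z s0 u1 uG z0 z1; rewrite c0 ev3MXaddC.
have -> : ev2 0 = fun _ _ => 0 by apply: funext => x; apply: funext => y; rewrite /ev2 !horner0.
have n0 : s ^+ 4 * g2 (tau1 u) (tau2 u) != 0.
  by rewrite g2E mulf_neq0 ?expf_neq0 // mulf_neq0 // pnatr_eq0.
by rewrite addr0 => /eqP; rewrite mulf_eq0 (negPf n0) orbF => /eqP.
Qed.

End Density.

(** * The universal Taylor polynomials *)

Section Scaling.
Variable R : realType.
Local Notation C := (cplx R).
Variables (w1 w2 : C) (d : R).
Hypothesis d0 : 0 < d.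
Hypothesis lower : forall p, d * (sz p)%:R <= nm (period w1 w2 p).
Variable s : C.
Hypothesis s0 : s != 0.

(** Shrinking by $s^{-1}$ multiplies $\wp,\wp',g_2$ by $s^2,s^3,s^4$, so polynomials in them become
    polynomials in [s]. *)
Lemma period_scale p : period (s^-1 * w1) (s^-1 * w2) p = s^-1 * period w1 w2 p.
Proof. by rewrite /period; ring. Qed.

Lemma U_scale p : pinv (s^-1 * w1) (s^-1 * w2) p = s * pinv w1 w2 p.
Proof. by rewrite /pinv period_scale invfM invrK. Qed.

Lemma V_scale z p : dinv (s^-1 * w1) (s^-1 * w2) (s^-1 * z) p = s * dinv w1 w2 z p.
Proof. by rewrite /dinv period_scale -mulrBr invfM invrK. Qed.

Lemma lower_scale p :
  nm s^-1 * d * (sz p)%:R <= nm (period (s^-1 * w1) (s^-1 * w2) p).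
Proof. by rewrite period_scale nmM -mulrA ler_wpM2l ?nm_ge0. Qed.

Lemma Gsum_scale k : (3 <= k)%N ->
  Gsum (s^-1 * w1) (s^-1 * w2) k = s ^+ k * Gsum w1 w2 k.
Proof.
move=> k3; rewrite /Gsum -(lsumZ _ (U_cubic d0 lower k3)).
by apply: eq_lsum => p _; rewrite U_scale exprMn.
Qed.

Lemma Ssum_scale k z : (3 <= k)%N -> nm z <= d / 2 ->
  Ssum (s^-1 * w1) (s^-1 * w2) k (s^-1 * z) = s ^+ k * Ssum w1 w2 k z.
Proof.
move=> k3 zd; rewrite /Ssum mulrDr; congr (_ + _).
  by rewrite exprMn exprVn invfM invrK.
rewrite -(lsumZ _ (pow_cubic (fun p => V_le d0 lower zd (p := p)) k3)).
by apply: eq_lsum => p _; rewrite V_scale exprMn.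
Qed.

Lemma wp_scale z : nm z <= d / 2 ->
  wp (s^-1 * w1) (s^-1 * w2) (s^-1 * z) = s ^+ 2 * wp w1 w2 z.
Proof.
move=> zd; rewrite !wpE mulrDr; congr (_ + _).
  by rewrite exprMn exprVn invfM invrK.
have [B c] := wpT_cubic d0 lower zd; rewrite -(lsumZ _ c).
by apply: eq_lsum => p _; rewrite /wpT V_scale U_scale; ring.
Qed.

End Scaling.

Section Polynomials.
Variable R : realType.
Local Notation C := (cplx R).
Implicit Types (p : mpoly.mpoly 4 rat) (alpha beta gamma lambda : C).

(** Isolates what is needed of [mpoly]: a finite sum of monomials, with the power of [alpha]
    absorbed into [e]. *)
Lemma eval4_sum p alpha : exists (I : Type) (r : seq I)
    (e : I -> C) (i j k : I -> nat), forall beta gamma lambda,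
  eval4 p alpha beta gamma lambda
  = \sum_(m <- r) e m * (beta ^+ i m * (gamma ^+ j m * lambda ^+ k m)).
Proof.
exists _, (mpoly.msupp p), (fun m => ratr (mpoly.mcoeff m p) * alpha ^+ mpoly.fun_of_multinom m ord0),
  (fun m => mpoly.fun_of_multinom m (lift ord0 ord0)), (fun m => mpoly.fun_of_multinom m (lift ord0 (lift ord0 ord0))),
  (fun m => mpoly.fun_of_multinom m (lift ord0 (lift ord0 (lift ord0 ord0)))) => b c l.
rewrite /eval4 /mpoly.mmap; apply: eq_bigr => m _.
by rewrite /mpoly.mmap1 !big_ord_recl big_ord0 mulr1 /= -!mulrA.
Qed.

Lemma eval4_ev3 p alpha : exists Q : {poly {poly {poly C}}}, forall beta gamma lambda,
  eval4 p alpha beta gamma lambda = ev3 Q beta gamma lambda.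
Proof.
have [I [r [e [i [j [k h]]]]]] := eval4_sum p alpha.
exists (\sum_(m <- r) ((e m *: 'X^(i m))%:P * 'X^(j m))%:P * 'X^(k m)) => b c l.
rewrite h /ev3 /ev2; elim: r {h} => [|m r IH]; first by rewrite !big_nil !horner0.
rewrite !big_cons IH !(hornerD, hornerM, hornerC, hornerXn, hornerZ, horner_exp).
by rewrite !mulrA.
Qed.

(** The equation $2i+3j+4k=4$ has only the solutions $(2,0,0)$ and $(0,0,1)$. The scalars [a] and
    [b] precede the other variables: they are the same for all lattices. *)
Lemma eval4_weight4 p alpha : exists a b : C, forall beta gamma lambda,
  exists2 q : {poly C},
    forall s, q.[s] = eval4 p alpha (s ^+ 2 * beta) (s ^+ 3 * gamma) (s ^+ 4 * lambda) &
    q`_4 = a * beta ^+ 2 + b * lambda.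
Proof.
have [I [r [e [i [j [k h]]]]]] := eval4_sum p alpha.
suff [a [b hab]] : exists a b : C, forall beta gamma lambda,
    exists2 q : {poly C}, forall s, q.[s] = \sum_(m <- r) e m *
      ((s ^+ 2 * beta) ^+ i m * ((s ^+ 3 * gamma) ^+ j m * (s ^+ 4 * lambda) ^+ k m)) &
    q`_4 = a * beta ^+ 2 + b * lambda.
  exists a, b => x y l; have [q q1 q2] := hab x y l.
  by exists q => // s; rewrite q1 h.
elim: r {h} => [|m r [a [b hab]]].
  exists 0, 0 => x y l; exists 0 => [s|]; first by rewrite horner0 big_nil.
  by rewrite coef0 !mul0r addr0.
pose d1 : C := if [&& i m == 2, j m == 0 & k m == 0]%N then e m else 0.
pose d2 : C := if [&& i m == 0, j m == 0 & k m == 1]%N then e m else 0.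
exists (a + d1), (b + d2) => x y l; have [q q1 q2] := hab x y l.
exists (q + (e m * (x ^+ i m * (y ^+ j m * l ^+ k m))) *: 'X^(2 * i m + 3 * j m + 4 * k m)) => [s|].
  rewrite hornerD hornerZ hornerXn q1 big_cons addrC; congr (_ + _).
  have E n (u : C) v : (s ^+ n * u) ^+ v = s ^+ (n * v) * u ^+ v by rewrite exprMn exprM.
  by rewrite !E !exprD; ring.
rewrite coefD q2 coefZ coefXn /d1 /d2.
have -> : (4 == 2 * i m + 3 * j m + 4 * k m)%N
    = [&& i m == 2, j m == 0 & k m == 0]%N || [&& i m == 0, j m == 0 & k m == 1]%N by lia.
case: and3P => [[/eqP -> /eqP -> /eqP ->]|_] /=; first by ring.
by case: and3P => [[/eqP -> /eqP -> /eqP ->]|_] /=; ring.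
Qed.

Lemma monomial_coef (q : {poly C}) (c : C) n :
  (forall s, s != 0 -> q.[s] = c * s ^+ n) -> q`_n = c.
Proof.
move=> h; have : q - c *: 'X^n = 0.
  apply: (@inj_root _ _ (fun k => k.+1%:R : C)) => [i j /eqP|k].
    by rewrite eqr_nat => /eqP[].
  by rewrite hornerD hornerN hornerZ hornerXn h ?subrr // pnatr_eq0.
by move/(congr1 (fun r : {poly C} => r`_n)); rewrite coefB coefZ coefXn eqxx mulr1 coef0 => /eqP; rewrite subr_eq0 => /eqP.
Qed.

(** For fixed [alpha], this shape covers all the coefficients up to $x^5$. *)
Lemma eval4_dense p alpha (c0 c1 c2 c3 c4 : C) :
  (forall s t z : C, s != 0 -> nm t <= 1 / 2 -> z != 0 -> nm z <= 1 / 16 ->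
     let b := s ^+ 2 * wp (tau1 t) (tau2 t) z in
     let g := s ^+ 3 * (- 2 * Ssum (tau1 t) (tau2 t) 3 z) in
     let l := s ^+ 4 * g2 (tau1 t) (tau2 t) in
     eval4 p alpha b g l = c0 + c1 * b + c2 * b ^+ 2 + c3 * g + c4 * l) ->
  forall b g l, eval4 p alpha b g l = c0 + c1 * b + c2 * b ^+ 2 + c3 * g + c4 * l.
Proof.
move=> h; have [Q hQ] := eval4_ev3 p alpha.
pose T : {poly {poly {poly C}}} :=
  ((c0%:P + c1 *: 'X + c2 *: 'X^2)%:P + c3%:P%:P * 'X)%:P + c4%:P%:P%:P * 'X.
have hT b g l : ev3 T b g l = c0 + c1 * b + c2 * b ^+ 2 + c3 * g + c4 * l.
  by rewrite /ev3 /ev2 /T !(hornerD, hornerM, hornerC, hornerX, hornerXn, hornerZ).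
have ev3B b g l : ev3 (Q - T) b g l = ev3 Q b g l - ev3 T b g l.
  by rewrite /ev3 /ev2 !(hornerD, hornerN).
have QT : Q - T = 0.
  apply: lattice_dense => s t z s0 t1 _ z0 z1.
  by rewrite ev3B -hQ hT h // subrr.
move=> b g l; rewrite hQ -hT; apply/eqP; rewrite -subr_eq0 -ev3B QT.
by rewrite /ev3 /ev2 !horner0.
Qed.

End Polynomials.

Section TaylorPolynomials.
Variable R : realType.
Local Notation C := (cplx R).
Variable P : nat -> mpoly.mpoly 4 rat.
Hypothesis KP : krichever_polys R P.

Let q0 : 0 < 1 / 4 :> R. Proof. by []. Qed.

Lemma lattice_coefs (alpha s t z : C) :
  s != 0 -> nm t <= 1 / 2 -> z != 0 -> nm z <= 1 / 16 ->
  let b := s ^+ 2 * wp (tau1 t) (tau2 t) z in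
  let g := s ^+ 3 * (- 2 * Ssum (tau1 t) (tau2 t) 3 z) in
  let l := s ^+ 4 * g2 (tau1 t) (tau2 t) in
  let e n := eval4 (P n) alpha b g l in
  [/\ e 0 = 0, e 1 = 1, e 2 = alpha & e 3 = alpha ^+ 2 / 2 + b / 2] /\
  (e 4 = alpha ^+ 3 / 6 + alpha * b / 2 - g / 6 /\
   e 5 = alpha ^+ 4 / 24 + alpha ^+ 2 * b / 4 + b ^+ 2 / 8 - alpha * g / 6
     + s ^+ 4 * Ssum (tau1 t) (tau2 t) 4 z / 4 - l / 240).
Proof.
move=> s0 t1 z0 z1 b g l e.
have lt := fun p => tau_lower p t1.
have zd : nm z <= 1 / 4 / 2 by lra.
have si : s^-1 != 0 by rewrite invr_neq0.
have nsi : 0 < nm s^-1 by rewrite nm_gt0.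
have d0 : 0 < nm s^-1 * (1 / 4) by rewrite mulr_gt0.
have ls := lower_scale lt s.
have sz0 : s^-1 * z != 0 by rewrite mulf_neq0.
have szd : nm (s^-1 * z) <= nm s^-1 * (1 / 4) / 4.
  by rewrite nmM -!mulrA ler_wpM2l ?nm_ge0 //; lra.
have szd2 : nm (s^-1 * z) <= nm s^-1 * (1 / 4) / 2 by have := nm_ge0 (s^-1 * z); lra.
have nl := not_in_lattice d0 ls sz0 szd2.
have := krichever_coefs d0 ls sz0 szd (KP alpha (tau_basis si t1) nl).
rewrite (wp_derive d0 ls sz0 szd) !(wp_scale q0 lt) // !(Ssum_scale q0 lt) //.
have gE : g2 (s^-1 * tau1 t) (s^-1 * tau2 t) = l.
  by rewrite /l !g2E (Gsum_scale q0 lt) //; ring.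
have G3 : Gsum (s^-1 * tau1 t) (s^-1 * tau2 t) 3 = 0.
  exact: (G_odd d0 ls).
have G4 : Gsum (s^-1 * tau1 t) (s^-1 * tau2 t) 4 = l / 60.
  by rewrite -gE g2E; field.
have gE' : - 2 * (s ^+ 3 * Ssum (tau1 t) (tau2 t) 3 z) = g by rewrite /g; ring.
rewrite gE G3 G4 gE' -/b -!/(e _).
have -> : s ^+ 3 * Ssum (tau1 t) (tau2 t) 3 z = - g / 2 by rewrite /g; field.
move=> [h1 [h2 h3]]; split=> //; split; first by rewrite h2; field.
by rewrite h3; field.
Qed.

(* The polynomial [P 5] provides the differential equation
   [wp'' = 6 wp^2 - g2 / 2]: by homogeneity [wp'' / 6] is a combination of
   [wp^2] and [g2], whose coefficients are read off at z = 0. *)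
Lemma quartic_identity (t z : C) : nm t <= 1 / 2 -> z != 0 -> nm z <= 1 / 16 ->
  Ssum (tau1 t) (tau2 t) 4 z = wp (tau1 t) (tau2 t) z ^+ 2 - g2 (tau1 t) (tau2 t) / 12.
Proof.
(* At $\alpha=0$ only weight 4 remains: the coefficient is $\wp^2/8+S_4/4-g_2/240$, where $S_4$ is
   the fourth-power sum. *)
have [a [b hab]] := eval4_weight4 (P 5) (0 : C).
have key u v : nm u <= 1 / 2 -> v != 0 -> nm v <= 1 / 16 ->
    Ssum (tau1 u) (tau2 u) 4 v = (4 * a - 1 / 2) * wp (tau1 u) (tau2 u) v ^+ 2
      + (4 * b + 1 / 60) * g2 (tau1 u) (tau2 u).
  move=> u1 v0 v1.
  have [q q1 q2] := hab (wp (tau1 u) (tau2 u) v) (- 2 * Ssum (tau1 u) (tau2 u) 3 v)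
    (g2 (tau1 u) (tau2 u)).
  have /monomial_coef : forall s, s != 0 -> q.[s] = (wp (tau1 u) (tau2 u) v ^+ 2 / 8
      + Ssum (tau1 u) (tau2 u) 4 v / 4 - g2 (tau1 u) (tau2 u) / 240) * s ^+ 4.
    move=> s s0; have [_ [_ h]] := lattice_coefs 0 s0 u1 v0 v1.
    by rewrite q1 h; field.
  rewrite q2 => h.
  have -> : Ssum (tau1 u) (tau2 u) 4 v = 4 * (wp (tau1 u) (tau2 u) v ^+ 2 / 8
      + Ssum (tau1 u) (tau2 u) 4 v / 4 - g2 (tau1 u) (tau2 u) / 240)
      - wp (tau1 u) (tau2 u) v ^+ 2 / 2 + g2 (tau1 u) (tau2 u) / 60 by field.
  by rewrite -h; field.
move=> t1 z0 z1; rewrite key //.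
(* Since [a] and [b] do not depend on the lattice, a single one with $G_4\ne 0$ determines them. *)
have [u [_ u1 uG]] := deform_seq R.
have r0 : 0 < 1 / 16 :> R by [].
have [-> ->] := quartic_constants q0 (fun p => tau_lower p (u1 0)) r0 (uG 0)
  (fun v v0 v1 => key _ v (u1 0) v0 (ltW v1)).
by field.
Qed.

Lemma taylor_coefs (alpha b g l : C) :
  [/\ eval4 (P 0) alpha b g l = 0, eval4 (P 1) alpha b g l = 1,
      eval4 (P 2) alpha b g l = alpha &
      eval4 (P 3) alpha b g l = (alpha ^+ 2 + b) / 2] /\
  (eval4 (P 4) alpha b g l = (alpha ^+ 3 + 3 * alpha * b - g) / 6 /\
   eval4 (P 5) alpha b g l = (5 * alpha ^+ 4 + 30 * alpha ^+ 2 * b + 45 * b ^+ 2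
     - 20 * alpha * g - 3 * l) / 120).
Proof.
have h (n : nat) (c0 c1 c2 c3 c4 : C) := @eval4_dense R (P n) alpha c0 c1 c2 c3 c4.
split; first split.
- rewrite (h 0 0 0 0 0 0); first by ring.
  move=> s t z s0 t1 z0 z1 x y w; have [[-> _ _ _] _] := lattice_coefs alpha s0 t1 z0 z1.
  by ring.
- rewrite (h 1 1 0 0 0 0); first by ring.
  move=> s t z s0 t1 z0 z1 x y w; have [[_ -> _ _] _] := lattice_coefs alpha s0 t1 z0 z1.
  by ring.
- rewrite (h 2 alpha 0 0 0 0); first by ring.
  move=> s t z s0 t1 z0 z1 x y w; have [[_ _ -> _] _] := lattice_coefs alpha s0 t1 z0 z1.
  by ring.
- rewrite (h 3 (alpha ^+ 2 / 2) (1 / 2) 0 0 0); first by field.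
  move=> s t z s0 t1 z0 z1 x y w; have [[_ _ _ ->] _] := lattice_coefs alpha s0 t1 z0 z1.
  by rewrite -/x; field.
split.
- rewrite (h 4 (alpha ^+ 3 / 6) (alpha / 2) 0 (- 1 / 6) 0); first by field.
  move=> s t z s0 t1 z0 z1 x y w; have [_ [-> _]] := lattice_coefs alpha s0 t1 z0 z1.
  by rewrite -/x -/y; field.
(* By [quartic_identity], $3/8=1/8+1/4$ and $-1/40=-1/240-1/48$. *)
rewrite (h 5 (alpha ^+ 4 / 24) (alpha ^+ 2 / 4) (3 / 8) (- alpha / 6) (- 1 / 40)).
  by field.
move=> s t z s0 t1 z0 z1 x y w; have [_ [_ ->]] := lattice_coefs alpha s0 t1 z0 z1.
by rewrite quartic_identity // -/y /x /w; field.
Qed.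

End TaylorPolynomials.

(** * Consequences of the functional equation *)

Section FunctionalEquation.
Variable R : realType.
Local Notation C := (cplx R).

Lemma modO_scale k (f : C -> C) (c a0 a1 a2 a3 a4 : C) : c != 0 ->
  modO k f (hrec [:: a0; a1; a2; a3; a4]) ->
  modO k (fun x => f (c * x))
    (hrec [:: a0; a1 * c; a2 * c ^+ 2; a3 * c ^+ 3; a4 * c ^+ 4]).
Proof.
move=> c0 [M [r [M0 r0 _ h]]]; have nc : 0 < nm c by rewrite nm_gt0.
apply: (@OzI _ _ _ (M * nm c ^+ k) (r / nm c)); first by rewrite divr_gt0.
move=> x x0; rewrite ltr_pdivlMr // => xr.
have cx : nm (c * x) = nm x * nm c by rewrite nmM mulrC.
have := h (c * x) (mulf_neq0 c0 x0); rewrite cx => /(_ xr) b.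
have -> : f (c * x) - hrec [:: a0; a1 * c; a2 * c ^+ 2; a3 * c ^+ 3; a4 * c ^+ 4] x
    = f (c * x) - hrec [:: a0; a1; a2; a3; a4] (c * x) by rewrite /=; ring.
by apply: le_trans b _; rewrite exprMn mulrAC mulrA.
Qed.

(** Elimination with an explicit cofactor [k], leaving an identity for [field]. *)
Lemma lin_eq (x y l r k : C) : l = r -> x - y = k * (l - r) -> x = y.
Proof. by move=> -> /eqP; rewrite subrr mulr0 subr_eq0 => /eqP. Qed.

(* The equation at [(x1, x2, x3) = (0, t, - t)] with denominators cleared. *)
Lemma symmetric_equation (g : C -> C) (a1 a2 a3 a4 : C) (r : R) : 0 < r ->
  modO 5 g (hrec [:: 1; a1; a2; a3; a4]) ->
  (forall t, t != 0 -> nm t < r ->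
     g (1 * t) * g (2 * t) + g (-1 * t) * g (- 2 * t) = 2 * (g (2 * t) * g (- 2 * t))) ->
  a2 = 2 * a1 ^+ 2 /\ 5 * a4 + 4 * a2 ^+ 2 = 14 * a1 * a3.
Proof.
move=> r0 hg h.
have n1 : (-1 : C) != 0 by rewrite oppr_eq0 oner_eq0.
have n2 : (2 : C) != 0 by rewrite pnatr_eq0.
have n3 : (- 2 : C) != 0 by rewrite oppr_eq0 pnatr_eq0.
have g1 := modO_scale (oner_neq0 C) hg; have g2 := modO_scale n1 hg.
have g3 := modO_scale n2 hg; have g4 := modO_scale n3 hg.
have e1 := modO_add (modO_mul g1 g3) (modO_mul g2 g4).
have hc : modO 5 (fun=> 2) (hrec [:: 2 : C]).
  by apply: Oz_ext (modO_refl 5 (fun=> 2)) => x; rewrite /= mulr0 addr0.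
have e2 := modO_mul hc (modO_mul g3 g4).
have e := modO_hrec (modO_trans (modO_sym (modO_near r0 h e1)) e2).
(* Both sides are even in $t$ and agree at $t=0$, so degrees 2 and 4 carry the first information. *)
have := e 2 isT; have := e 4 isT; rewrite /= {e e1 e2 hc g1 g2 g3 g4}.
rewrite !(mulr0, mul0r, addr0, add0r, mulr1, mul1r) => e4 e2.
by split; [apply: (lin_eq e2 (k := - 1 / 6))|apply: (lin_eq e4 (k := - 1 / 6))]; field.
Qed.

End FunctionalEquation.

Theorem lemma6p1 (R : realType) (alpha beta gamma lambda : cplx R)
    (f : cplx R -> cplx R) (f_Kr : is_fKr alpha beta gamma lambda f)
    (f_eq : exists2 r : cplx R, 0 < r &
      forall x1 x2 x3 : cplx R,
        `|x1| < r -> `|x2| < r -> `|x3| < r ->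
        x1 != x2 -> x1 != x3 -> x2 != x3 ->
        1 / (f (x2 - x1) * f (x3 - x1)) + 1 / (f (x1 - x2) * f (x3 - x2))
          + 1 / (f (x1 - x3) * f (x2 - x3)) = 0) :
  beta = 3 * alpha ^+ 2 /\
  lambda = 12 * alpha * (9 * alpha ^+ 3 + gamma).
Proof.
have [P KP fP] := f_Kr.
have [[p0 p1 p2 p3] [p4 p5]] := taylor_coefs KP alpha beta gamma lambda.
have := expands_modO 6 fP; rewrite /mkseq /= p0 p1 p2 p3 p4 p5 => hf.
set a2 := (_ + beta) / 2 in hf; set a3 := (_ - gamma) / 6 in hf.
set a4 := _ / 120 in hf.
pose g x := x^-1 * f x.
have fg x : x != 0 -> f x = x * g x by move=> x0; rewrite /g mulVKf.
have hg : modO 5 g (hrec [:: 1; alpha; a2; a3; a4]).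
  apply: (@Oz_divX _ 1); apply: (@Oz_near _ _ _ _ 1 ltr01 _ hf) => x x0 _.
  by rewrite fg //=; ring.
have [M [r1 [M0 r10 _ g1]]] := modO_Oz1 (isT : 0 < 5)%N hg.
have M1 : 0 < M + 1 by lra.
have [_ /posC[r0 r00 ->] feq] := f_eq.
(* The half leaves room for the arguments $\pm 2t$, where [g] must not vanish either. *)
pose r := Num.min r0 (Num.min r1 (1 / (M + 1)) / 2).
have r2 : 0 < r by rewrite lt_min r00 divr_gt0 // lt_min r10 divr_gt0.
have gn x : x != 0 -> nm x < 2 * r -> g x != 0.
  move=> x0 xr.
  have : nm x < Num.min r1 (1 / (M + 1)).
    apply: lt_le_trans xr _; rewrite mulrC -ler_pdivlMr //.
    by rewrite /r ge_min lexx orbT.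
  rewrite lt_min => /andP[xr1]; rewrite ltr_pdivlMr // => xM.
  have := g1 x x0 xr1; rewrite expr1 => h; apply/eqP => gx.
  by move: h; rewrite gx sub0r nmN nm1; have := nm_ge0 x; lra.
have [|h1 h2] := symmetric_equation r2 hg.
  move=> t t0 tr.
  have tr0 : nm t < r0 by move: tr; rewrite lt_min => /andP[].
  have nt : - t != 0 by rewrite oppr_eq0.
  have t2 : 2 * t != 0 by rewrite mulf_neq0 // pnatr_eq0.
  have nt2 : - 2 * t != 0 by rewrite mulNr oppr_eq0.
  have := feq 0 t (- t); rewrite !ltc_nm nm0 nmN => /(_ r00 tr0 tr0).
  rewrite eq_sym t0 [0 == - t]eq_sym nt -subr_eq0 opprK.
  have tt : t + t = 2 * t by ring.
  rewrite tt t2 => /(_ isT isT isT).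
  have -> : t - 0 = 1 * t by ring.
  have -> : - t - 0 = -1 * t by ring.
  have -> : 0 - t = -1 * t by ring.
  have -> : - t - t = - 2 * t by ring.
  have -> : 0 + t = 1 * t by ring.
  have n1 : nm t < 2 * r by have := nm_ge0 t; lra.
  have n2 : nm (2 * t) < 2 * r by rewrite nmM nm_nat; lra.
  have n3 : nm (- 2 * t) < 2 * r by rewrite nmM nmN nm_nat; lra.
  have := gn _ t2 n2; have := gn _ nt2 n3.
  have := gn (- t) nt; rewrite nmN => /(_ n1); have := gn t t0 n1.
  have e1 : 1 * t = t by ring.
  have em1 : -1 * t = - t by ring.
  rewrite e1 em1 !fg //.
  move: (g t) (g (- t)) (g (2 * t)) (g (- 2 * t)) => u v x y u0 v0 y0 x0 e.
  (* The cofactor is a common denominator of the three fractions once [f x] is written as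
     [x * g x]. *)
  apply: (lin_eq e (k := 2 * t ^+ 2 * u * v * x * y)).
  by field; rewrite u0 v0 x0 y0 t0.
have hb : beta = 3 * alpha ^+ 2.
  by apply: (lin_eq h1 (k := 2)); rewrite /a2; field.
(* In [5 * a4] the unknown $\lambda$ has coefficient $-1/8$, hence the cofactor. *)
by split=> //; apply: (lin_eq h2 (k := - 8)); rewrite /a2 /a3 /a4 hb; field.
Qed.
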